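(* Let $\Omega\subset\mathbb{R}^n$ be open, $T>0$, let $H=H(t,x,p)\in C^2([0,T]\times\Omega\times\mathbb{R}^n)$ have positive definite Hessian $D_{pp}H(t,x,p)$ for all $(t,x,p)$, and let $u_0:\Omega\to\mathbb{R}$ be locally Lipschitz continuous. Let $u:[0,T]\times\Omega\to\mathbb{R}$ be a continuous viscosity solution of $$\partial_t u+H(t,x,D_xu)=0 \ \text{ in } ]0,T[\times\Omega,\qquad u(0,x)=u_0(x)\ \text{ in }\Omega,$$ and let $y_0\in\Omega$. Then the following properties are equivalent. (i) There exists $K>0$ such that $u_0$ has a proximal $K$-subgradient at $y$ for all $y$ in a neighbourhood of $y_0$. (ii) There exist $R,t_0>0$ (with $]0,t_0]\times B_R(y_0)\subset\, ]0,T[\times\Omega$) such that $u\in C^{1,1}_{loc}(]0,t_0]\times B_R(y_0))$.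
   Context: Notation: $]a,b[$ and $]a,b]$ denote open and left-open intervals; $B_R(y_0)$ is the open ball of radius $R$ centred at $y_0$. $C^{1,1}_{loc}$ denotes the $C^1$ functions (jointly in $(t,x)$) whose gradient is locally Lipschitz. Given $K>0$, a vector $p_0\in\mathbb{R}^n$ is a proximal $K$-subgradient of $v:\Omega\to\mathbb{R}$ at $x_0\in\Omega$ if $v(x)\ge v(x_0)+\langle p_0,x-x_0\rangle-\frac K2|x-x_0|^2$ for all $x$ in a neighbourhood of $x_0$ (the neighbourhood may depend on $x_0$). *)

(* Defs.v *)
From HB Require Import structures.
From mathcomp Require Import all_boot all_order all_algebra.
From mathcomp Require Import all_classical all_reals all_analysis.

Set Implicit Arguments.
Unset Strict Implicit.
Unset Printing Implicit Defensive.

Import Order.TTheory GRing.Theory Num.Theory.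
Import numFieldNormedType.Exports.

Local Open Scope classical_set_scope.
Local Open Scope ring_scope.

(* The library norm on ['rV[R]_n] is the sup norm; it is used below only for
   topological and local Lipschitz properties, which do not depend on the choice
   of norm.  The Euclidean norm is [enorm]. *)
Definition dot (R : realType) (n : nat) (x y : 'rV[R]_n) : R :=
  \sum_(i < n) x 0 i * y 0 i.

Definition enorm (R : realType) (n : nat) (x : 'rV[R]_n) : R :=
  Num.sqrt (dot x x).

Definition eball (R : realType) (n : nat) (y0 : 'rV[R]_n) (r : R) :
    set 'rV[R]_n :=
  [set x | enorm (x - y0) < r].

Definition locally_lipschitz (R : realType) (V W : normedModType R)
    (D : set V) (f : V -> W) : Prop :=
  forall x, D x -> exists2 U, nbhs x U & [lipschitz f y | y in U `&` D].

(* Fréchet differentiability relative to [D], with differential [L].  On the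
   sets used here (such as [[0, T] * Omega]) the differential is unique; at
   boundary times the time derivative is one-sided. *)
Definition diff_within (R : realType) (V : normedModType R) (D : set V)
    (f : V -> R) (z : V) (L : V -> R) : Prop :=
  forall e : R, 0 < e ->
    \forall y \near z, D y -> `|f y - f z - L (y - z)| <= e * `|y - z|.

(* Meant for finite-dimensional [V], where continuity of [z |-> df z v] for
   every [v] is continuity of the differential in operator norm. *)
Definition C1_on (R : realType) (V : normedModType R) (D : set V)
    (f : V -> R) : Prop :=
  exists df : V -> {linear V -> R},
    (forall z, D z -> diff_within D f z (df z)) /\
    (forall v, {within D, continuous (fun z => df z v)}).

Definition C2_on (R : realType) (V : normedModType R) (D : set V)
    (f : V -> R) : Prop :=
  exists df : V -> {linear V -> R},
    (forall z, D z -> diff_within D f z (df z)) /\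
    (forall v, C1_on D (fun z => df z v)).

(* [g z] is the space-time gradient [(d_t f, D_x f)] at [z = (t, x)]. *)
Definition C11_loc (R : realType) (n : nat) (D : set (R * 'rV[R]_n))
    (f : R * 'rV[R]_n -> R) : Prop :=
  exists g : R * 'rV[R]_n -> R * 'rV[R]_n,
    (forall z, D z ->
       diff_within D f z (fun h => (g z).1 * h.1 + dot (g z).2 h.2)) /\
    locally_lipschitz D g.

Definition gradient (R : realType) (n : nat) (f : 'rV[R]_n -> R)
    (x : 'rV[R]_n) : 'rV[R]_n :=
  \row_(i < n) 'D_(delta_mx 0 i) f x.

Definition hessian (R : realType) (n : nat) (f : 'rV[R]_n -> R)
    (x : 'rV[R]_n) : 'M[R]_n :=
  \matrix_(i < n, j < n)
    'D_(delta_mx 0 i) (fun y => 'D_(delta_mx 0 j) f y) x.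

Definition posdefmx (R : realType) (n : nat) (A : 'M[R]_n) : Prop :=
  forall q : 'rV[R]_n, q != 0 -> 0 < (q *m A *m q^T) 0 0.

Definition proximal_subgradient (R : realType) (n : nat) (K : R)
    (v : 'rV[R]_n -> R) (x0 p0 : 'rV[R]_n) : Prop :=
  \forall x \near x0,
    v x >= v x0 + dot p0 (x - x0) - K / 2 * enorm (x - x0) ^+ 2.

(* [d_t phi + H (t, x, D_x phi)] at the point [(t, x)]. *)
Definition HJ_operator (R : realType) (n : nat)
    (H : R * 'rV[R]_n * 'rV[R]_n -> R) (phi : R * 'rV[R]_n -> R)
    (t : R) (x : 'rV[R]_n) : R :=
  derive1 (fun s : R => phi (s, x)) t + H (t, x, gradient (fun y => phi (t, y)) x).

Definition viscosity_subsolution (R : realType) (n : nat) (T : R)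
    (Omega : set 'rV[R]_n) (H : R * 'rV[R]_n * 'rV[R]_n -> R)
    (u : R * 'rV[R]_n -> R) : Prop :=
  forall phi : R * 'rV[R]_n -> R, C1_on (`]0, T[ `*` Omega) phi ->
  forall (t : R) (x : 'rV[R]_n), (`]0, T[ `*` Omega) (t, x) ->
    (\forall z \near (t, x), u z - phi z <= u (t, x) - phi (t, x)) ->
    HJ_operator H phi t x <= 0.

Definition viscosity_supersolution (R : realType) (n : nat) (T : R)
    (Omega : set 'rV[R]_n) (H : R * 'rV[R]_n * 'rV[R]_n -> R)
    (u : R * 'rV[R]_n -> R) : Prop :=
  forall phi : R * 'rV[R]_n -> R, C1_on (`]0, T[ `*` Omega) phi ->
  forall (t : R) (x : 'rV[R]_n), (`]0, T[ `*` Omega) (t, x) ->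
    (\forall z \near (t, x), u z - phi z >= u (t, x) - phi (t, x)) ->
    HJ_operator H phi t x >= 0.

Definition viscosity_solution (R : realType) (n : nat) (T : R)
    (Omega : set 'rV[R]_n) (H : R * 'rV[R]_n * 'rV[R]_n -> R)
    (u0 : 'rV[R]_n -> R) (u : R * 'rV[R]_n -> R) : Prop :=
  [/\ {within `[0, T] `*` Omega, continuous u},
      viscosity_subsolution T Omega H u,
      viscosity_supersolution T Omega H u &
      forall x, Omega x -> u (0, x) = u0 x].

(* Main.v *)
(* (i) => (ii).  If [u0 + k |x|^2 / 2] is convex near [y0], then for short times
   every point [(t, x)] is reached by exactly one characteristic [(X, P)] with
   [P 0 = p - k X 0], for each slope [p].  Its action [S (t, x, p)] is C^{1,1} in
   [(t, x)] and, by convexity of [H], strongly concave in [p] with modulus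
   proportional to [t].  Hence the generalised Hopf formula
   [w (t, x) = max_p (S (t, x, p) - f^* (p))], with [f^*] the convex conjugate of
   [u0 + k |x|^2 / 2], has a unique and locally Lipschitz maximiser for [t > 0];
   so [w] is a classical C^{1,1} solution, and [u = w] near [(0, y0)] by
   comparison.

   (ii) => (i).  A doubling of variables bounds [D_x u] as [t -> 0].  For [t > 0]
   and [y] near [y0], let [X' = D_p H (s, X, Du (s, X))], [X t = y]; comparing [u]
   along [X] with [u] along the curves [X + sigma (x - y)], [sigma] affine from 1
   at time [t] to 0 at a later time [tau], gives
   [u (t, x) >= u (t, y) + l (x - y) - K / 2 |x - y|^2] with [K] independent of
   [t], because uniform convexity absorbs the difference of the gradients.  The
   slopes [l] are bounded, so this passes to the limit [t -> 0]. *)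
Require Import Defs.
From HB Require Import structures.
From mathcomp Require Import all_boot all_order all_algebra.
From mathcomp Require Import all_classical all_reals all_analysis.
From mathcomp Require Import ring lra.

Import Order.TTheory GRing.Theory Num.Theory.
Import numFieldNormedType.Exports.

Local Open Scope classical_set_scope.
Local Open Scope ring_scope.

Set Implicit Arguments.
Unset Strict Implicit.
Unset Printing Implicit Defensive.

(** * Differential calculus relative to a set *)

Section Calculus.
Context {R : realType}.
Implicit Types (U V W X : normedModType R).

(** The slope [p] labels the initial datum [p.x - k |x|^2 / 2], whose gradient is [p - k x]. Near
    [y0], a [k]-semiconvex [u0] is a supremum of such data up to additive constants; the Hopf
    formula transports each of them and takes the supremum again. Here [k = K + 1]: [K] pays for the
    proximal inequality, and the extra [1] makes the local supports strict, which lets them become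
    global. Nothing controls [H] for large momenta, so every constant lives on a box in [(t, x, p)],
    and momenta must be bounded before the time is shortened; for the same reason the barrier in the
    comparison argument has its slope fixed in advance. No second derivative of the action is taken:
    a quadratic remainder, a supergradient in [p] and a concavity inequality suffice. In the
    converse direction the Lipschitz constant of [Du] may blow up as [t -> 0]. It only serves to
    make the curve [X] exist; [K] is built from bounds of [H] on a box, and that box needs a
    gradient bound uniform in [t]. Derivatives of [H] at the end times are one-sided, hence a
    calculus relative to a set. *)

Lemma near_iff V (z : V) (P : V -> Prop) :
  (\forall y \near z, P y) <->
  (exists2 d : R, 0 < d & forall y, `|y - z| < d -> P y).
Proof.
split=> [/nbhs_normP[d /= d0 dP]|[d d0 dP]].
  by exists d => // y yz; apply: dP; rewrite /= /ball_ /= distrC.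
by apply/nbhs_normP; exists d => //= y; rewrite /ball_ /= distrC => /dP.
Qed.

Definition contw V W (D : set V) (f : V -> W) (z : V) : Prop :=
  forall e : R, 0 < e -> exists2 d : R, 0 < d &
    forall y, `|y - z| < d -> D y -> `|f y - f z| <= e.

Lemma contwP V W (D : set V) (f : V -> W) :
  {within D, continuous f} <-> (forall z, D z -> contw D f z).
Proof.
split=> [/subspace_continuousP cf z Dz e e0|cf].
  have /cvgrPdist_le/(_ e e0) := cf z Dz.
  rewrite near_withinE => /near_iff[d d0 dP]; exists d => // y yz Dy.
  by rewrite distrC; exact: dP.
apply/subspace_continuousP => z Dz; apply/cvgrPdist_le => e e0.
rewrite near_withinE; apply/near_iff; have [d d0 dP] := cf z Dz e e0.
by exists d => // y yz Dy; rewrite distrC; exact: dP.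
Qed.

Lemma contw_setTP V W (f : V -> W) (z : V) :
  {for z, continuous f} <-> contw setT f z.
Proof.
split=> [/cvgrPdist_le cf e e0|cf].
  have /near_iff[d d0 dP] := cf e e0.
  by exists d => // y yz _; rewrite distrC; exact: dP.
apply/cvgrPdist_le => e e0; apply/near_iff; have [d d0 dP] := cf e e0.
by exists d => // y yz; rewrite distrC; exact: dP.
Qed.

Lemma contw_sub V W (D D' : set V) (f : V -> W) z :
  D' `<=` D -> contw D f z -> contw D' f z.
Proof.
move=> DD cf e e0; have [d d0 dP] := cf e e0.
by exists d => // y yz /DD; exact: dP.
Qed.

Lemma contw_lip V W (D : set V) (f : V -> W) z (C : R) :
  (forall y, D y -> `|f y - f z| <= C * `|y - z|) -> contw D f z.
Proof.
move=> fC e e0; exists (e / (`|C| + 1)); first by rewrite divr_gt0 ?ltr_wpDl.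
move=> y yz /fC /le_trans; apply; move: yz; rewrite ltr_pdivlMr ?ltr_wpDl//.
move=> /ltW; apply: le_trans; rewrite mulrC ler_wpM2l//.
by rewrite (le_trans (ler_norm C))// lerDl.
Qed.

(** Differentials are plain functions satisfying this predicate, so that they can be written as
    lambda terms; boundedness is part of it because the spaces are arbitrary normed modules. *)
Definition linb V W (L : V -> W) : Prop :=
  (forall a x y, L (a *: x + y) = a *: L x + L y) /\
  (exists C : R, forall x, `|L x| <= C * `|x|).

Lemma linbD V W (L : V -> W) x y : linb L -> L (x + y) = L x + L y.
Proof. by move=> [LL _]; have := LL 1 x y; rewrite !scale1r. Qed.

Lemma linb0 V W (L : V -> W) : linb L -> L 0 = 0.
Proof.
by move=> lL; have := linbD 0 0 lL; rewrite addr0 => /esym/eqP; rewrite addrC -subr_eq0 addrK => /eqP.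
Qed.

Lemma linbZ V W (L : V -> W) a x : linb L -> L (a *: x) = a *: L x.
Proof. by move=> lL; have := lL.1 a x 0; rewrite (linb0 lL) !addr0. Qed.

Lemma linbN V W (L : V -> W) x : linb L -> L (- x) = - L x.
Proof. by move=> lL; rewrite -scaleN1r linbZ// scaleN1r. Qed.

Lemma linbB V W (L : V -> W) x y : linb L -> L (x - y) = L x - L y.
Proof. by move=> lL; rewrite linbD// linbN. Qed.

Lemma linb_bound V W (L : V -> W) : linb L ->
  exists2 C : R, 0 < C & forall x, `|L x| <= C * `|x|.
Proof.
move=> [_ [C LC]]; exists (`|C| + 1); first by rewrite ltr_wpDl.
move=> x; apply: (le_trans (LC x)); rewrite ler_wpM2r//.
by rewrite (le_trans (ler_norm C))// lerDl.
Qed.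

Definition diffw V W (D : set V) (f : V -> W) (z : V) (L : V -> W) : Prop :=
  forall e : R, 0 < e -> exists2 d : R, 0 < d &
    forall y, `|y - z| < d -> D y -> `|f y - f z - L (y - z)| <= e * `|y - z|.

Lemma diffwP V (D : set V) (f : V -> R) z (L : V -> R) :
  diff_within D f z L <-> diffw D f z L.
Proof. by split=> df e e0; apply/near_iff/df. Qed.

Lemma diffw_sub V W (D D' : set V) (f : V -> W) z L :
  D' `<=` D -> diffw D f z L -> diffw D' f z L.
Proof.
move=> DD cf e e0; have [d d0 dP] := cf e e0.
by exists d => // y yz /DD; exact: dP.
Qed.

Lemma diffw_eqL V W (D : set V) (f : V -> W) z L L' :
  (forall h, L h = L' h) -> diffw D f z L -> diffw D f z L'.
Proof.
move=> LL cf e e0; have [d d0 dP] := cf e e0.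
by exists d => // y yz Dy; rewrite -LL; exact: dP.
Qed.

(** This moves a differential between a cylinder and the whole space, or from the Hopf function to
    [u] where the two agree. *)
Lemma diffw_near V W (D D' : set V) (f g : V -> W) z L (r : R) :
  0 < r -> (forall y, `|y - z| < r -> D' y -> D y /\ f y = g y) -> f z = g z ->
  diffw D f z L -> diffw D' g z L.
Proof.
move=> r0 rP fg cf e e0; have [d d0 dP] := cf e e0.
exists (Num.min d r); first by rewrite lt_min d0.
move=> y; rewrite lt_min => /andP[yd yr] /(rP _ yr)[Dy fgy].
by rewrite -fgy -fg; exact: dP.
Qed.

Lemma diffw_ext V W (D : set V) (f g : V -> W) z L :
  (forall y, f y = g y) -> diffw D f z L -> diffw D g z L.
Proof. by move=> fg; apply: (@diffw_near _ _ _ _ _ _ _ _ 1). Qed.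

Lemma diffw_contw V W (D : set V) (f : V -> W) z L :
  linb L -> diffw D f z L -> contw D f z.
Proof.
move=> /linb_bound[C C0 LC] df; have [d d0 dP] := df 1 ltr01.
move=> e e0; exists (Num.min d (e / (1 + C))).
  by rewrite lt_min d0 divr_gt0// addr_gt0.
move=> y; rewrite lt_min => /andP[yd].
rewrite ltr_pdivlMr ?addr_gt0// => yr Dy.
rewrite -[f y - f z](subrK (L (y - z))).
apply: (le_trans (ler_normD _ _)); have := dP y yd Dy; have := LC (y - z).
by move: yr; lra.
Qed.

Lemma diffw_cst V W (D : set V) (c : W) z : diffw D (fun=> c) z (fun=> 0).
Proof.
move=> e e0; exists 1 => // y _ _; rewrite !subrr normr0.
by rewrite mulr_ge0// ltW.
Qed.

Lemma diffw_linb V W (D : set V) (f : V -> W) z : linb f -> diffw D f z f.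
Proof.
move=> lf e e0; exists 1 => // y _ _; rewrite linbB// subrr normr0.
by rewrite mulr_ge0// ltW.
Qed.

Lemma diffwD V W (D : set V) (f g : V -> W) z L M :
  diffw D f z L -> diffw D g z M ->
  diffw D (fun y => f y + g y) z (fun h => L h + M h).
Proof.
move=> df dg e e0; have e2 : 0 < e / 2 by rewrite divr_gt0.
have [d d0 dP] := df _ e2; have [r r0 rP] := dg _ e2.
exists (Num.min d r); first by rewrite lt_min d0.
move=> y; rewrite lt_min => /andP[yd yr] Dy.
have := dP y yd Dy; have := rP y yr Dy.
have -> : f y + g y - (f z + g z) - (L (y - z) + M (y - z)) =
  (f y - f z - L (y - z)) + (g y - g z - M (y - z)).
  by rewrite !opprD !addrA -!(addrAC _ (g y)) -!(addrAC _ (- g z)).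
by have := ler_normD (f y - f z - L (y - z)) (g y - g z - M (y - z)); lra.
Qed.

Lemma diffwN V W (D : set V) (f : V -> W) z L :
  diffw D f z L -> diffw D (fun y => - f y) z (fun h => - L h).
Proof.
move=> df e e0; have [d d0 dP] := df _ e0; exists d => // y yd Dy.
by rewrite -!opprD normrN; exact: dP.
Qed.

Lemma diffwB V W (D : set V) (f g : V -> W) z L M :
  diffw D f z L -> diffw D g z M ->
  diffw D (fun y => f y - g y) z (fun h => L h - M h).
Proof. by move=> df dg; apply: diffwD => //; exact: diffwN. Qed.

Lemma diffw_comp V W X (D : set V) (E : set W) (f : V -> W) (g : W -> X)
    z L M : (forall y, D y -> E (f y)) -> linb L -> linb M ->
  diffw D f z L -> diffw E g (f z) M -> diffw D (g \o f) z (M \o L).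
Proof.
move=> fE lL lM df dg e e0.
have [C C0 LC] := linb_bound lL; have [C' C'0 MC] := linb_bound lM.
have e1 : 0 < e / (C + 1) / 2 by rewrite !divr_gt0// addr_gt0.
have [d d0 dP] := dg _ e1.
have e2 : 0 < Num.min 1 (e / 2 / C') by rewrite lt_min ltr01 !divr_gt0.
have [r r0 rP] := df _ e2.
exists (Num.min r (d / (C + 1))); first by rewrite lt_min r0 divr_gt0// addr_gt0.
move=> y; rewrite lt_min => /andP[yr].
rewrite ltr_pdivlMr ?addr_gt0// => yd Dy.
have := rP y yr Dy; set F := f y - f z - L (y - z) => HF.
have HF1 : `|F| <= `|y - z|.
  by rewrite (le_trans HF)// ler_piMl// ge_min lexx.
have HF2 : C' * `|F| <= e / 2 * `|y - z|.
  rewrite -ler_pdivlMl// (le_trans HF)// mulrA ler_wpM2r//.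
  by rewrite ge_min [_^-1 * _]mulrC lexx orbT.
have fyz : `|f y - f z| <= (C + 1) * `|y - z|.
  rewrite -[f y - f z](subrK (L (y - z))) (le_trans (ler_normD _ _))//.
  by have := LC (y - z); rewrite -/F; lra.
have := dP (f y) _ (fE _ Dy); rewrite (le_lt_trans fyz); last by lra.
move=> /(_ isT) H1 /=.
have -> : g (f y) - g (f z) - M (L (y - z)) =
    (g (f y) - g (f z) - M (f y - f z)) + M F.
  by rewrite /F (linbB _ (L _) lM) addrA subrK.
apply: (le_trans (ler_normD _ _)).
have H2 := le_trans (MC F) HF2.
have H3 : e / (C + 1) / 2 * `|f y - f z| <= e / 2 * `|y - z|.
  have cE : e / (C + 1) * (C + 1) = e by rewrite divfK ?gt_eqF ?addr_gt0.
  have : e / (C + 1) * `|f y - f z| <= e / (C + 1) * ((C + 1) * `|y - z|).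
    by rewrite ler_wpM2l// divr_ge0 ?ltW// addr_gt0.
  by rewrite [in X in _ <= X -> _]mulrA cE; lra.
by move: H1; rewrite /=; lra.
Qed.

Definition bilinb V W X (B : V -> W -> X) : Prop :=
  [/\ forall y, linb (B ^~ y), forall x, linb (B x) &
      exists C : R, forall x y, `|B x y| <= C * (`|x| * `|y|)].

Lemma diffw_bilin V W X U (D : set U) (B : V -> W -> X) (f : U -> V)
    (g : U -> W) z L M : bilinb B -> linb L -> linb M ->
  diffw D f z L -> diffw D g z M ->
  diffw D (fun y => B (f y) (g y)) z (fun h => B (L h) (g z) + B (f z) (M h)).
Proof.
move=> [Bl Br [C0 BC0]] lL lM df dg.
have [C C1 BC] : exists2 C, 0 < C & forall x y, `|B x y| <= C * (`|x| * `|y|).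
  exists (`|C0| + 1); first by rewrite ltr_wpDl.
  move=> x y; apply: (le_trans (BC0 _ _)); rewrite ler_wpM2r ?mulr_ge0//.
  by rewrite (le_trans (ler_norm _))// lerDl.
have [CL CL0 LC] := linb_bound lL.
have Lg : contw D g z := diffw_contw lM dg.
move=> e e0.
pose e1 := e / 3 / (C * (`|g z| + 1)).
pose e2 := e / 3 / (C * (`|f z| + 1)).
pose e3 := Num.min 1 (e / 3 / (C * CL)).
have gz1 : 0 < `|g z| + 1 by rewrite ltr_wpDl.
have fz1 : 0 < `|f z| + 1 by rewrite ltr_wpDl.
have e10 : 0 < e1 by rewrite !divr_gt0// mulr_gt0.
have e20 : 0 < e2 by rewrite !divr_gt0// mulr_gt0.
have e30 : 0 < e3 by rewrite lt_min ltr01 !divr_gt0// mulr_gt0.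
have [d1 d10 dP1] := df _ e10; have [d2 d20 dP2] := dg _ e20.
have [d3 d30 dP3] := Lg _ e30.
exists (Num.min d1 (Num.min d2 d3)); first by rewrite !lt_min d10 d20.
move=> y; rewrite !lt_min => /and3P[y1 y2 y3] Dy.
have {dP1}H1 := dP1 y y1 Dy; have {dP2}H2 := dP2 y y2 Dy.
have {dP3}H3 := dP3 y y3 Dy.
set a := f y - f z - L (y - z) in H1; set b := g y - g z - M (y - z) in H2.
(* The remainder splits into that of [f] paired with [g y], that of [g] paired with [f z], and the
   second order term [B (L (y - z)) (g y - g z)], small because [g] is continuous at [z]; each gets
   a third of [e]. *)
have -> : B (f y) (g y) - B (f z) (g z) - (B (L (y - z)) (g z) + B (f z) (M (y - z)))
   = B a (g y) + B (f z) b + B (L (y - z)) (g y - g z).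
  rewrite /a /b !(linbB _ _ (Bl _)) !(linbB _ _ (Br _)).
  have key (p q r s t w : X) :
      p - s - (w + t) = p - q - r + (q - s - t) + (r - w).
    rewrite [RHS]addrAC [_ - r + _]addrA subrK [p - q - w]addrAC.
    rewrite -[q - s - t]addrA [RHS]addrA subrK opprD [LHS]addrA.
    by rewrite [p - s - w]addrAC -[LHS]addrA.
  exact: key.
have gy : `|g y| <= `|g z| + 1.
  rewrite -[g y](subrK (g z)) addrC (le_trans (ler_normD _ _))// lerD2l.
  by rewrite (le_trans H3)// ge_min lexx.
apply: (le_trans (ler_normD _ _)).
have T1 : `|B a (g y)| <= e / 3 * `|y - z|.
  apply: (le_trans (BC _ _)).
  have e1E : C * (`|g z| + 1) * e1 = e / 3.
    by rewrite /e1 mulrC divfK// gt_eqF// mulr_gt0.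
  have -> : e / 3 * `|y - z| = C * (e1 * `|y - z| * (`|g z| + 1)).
    by rewrite -e1E; ring.
  by rewrite ler_pM2l// ler_pM.
have T2 : `|B (f z) b| <= e / 3 * `|y - z|.
  apply: (le_trans (BC _ _)).
  have e2E : C * (`|f z| + 1) * e2 = e / 3.
    by rewrite /e2 mulrC divfK// gt_eqF// mulr_gt0.
  have -> : e / 3 * `|y - z| = C * ((`|f z| + 1) * (e2 * `|y - z|)).
    by rewrite -e2E; ring.
  by rewrite ler_pM2l// ler_pM// lerDl.
have T3 : `|B (L (y - z)) (g y - g z)| <= e / 3 * `|y - z|.
  apply: (le_trans (BC _ _)).
  have e3E : C * CL * (e / 3 / (C * CL)) = e / 3.
    by rewrite mulrC divfK// gt_eqF// mulr_gt0.
  have -> : e / 3 * `|y - z| = C * (CL * `|y - z| * (e / 3 / (C * CL))).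
    by rewrite -[in LHS]e3E; ring.
  rewrite ler_pM2l// ler_pM//.
  by rewrite (le_trans H3)// ge_min lexx orbT.
have := ler_normD (B a (g y)) (B (f z) b); lra.
Qed.

Lemma diffwM V (D : set V) (f g : V -> R) z L M : linb L -> linb M ->
  diffw D f z L -> diffw D g z M ->
  diffw D (fun y => f y * g y) z (fun h => L h * g z + f z * M h).
Proof.
move=> lL lM df dg.
apply: (@diffw_bilin _ _ _ _ D (fun x y : R => x * y)) => //; split.
- move=> y; split=> [a b c|]; first by rewrite mulrDl -mulrA.
  by exists `|y| => x; rewrite normrM mulrC.
- move=> y; split=> [a b c|]; first by rewrite mulrDr mulrCA.
  by exists `|y| => x; rewrite normrM.
- by exists 1 => x y; rewrite normrM mul1r.
Qed.

Lemma diffw_pair V W X (D : set V) (f : V -> W) (g : V -> X) z L M :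
  diffw D f z L -> diffw D g z M ->
  diffw D (fun y => (f y, g y)) z (fun h => (L h, M h)).
Proof.
move=> df dg e e0; have [d d0 dP] := df _ e0; have [r r0 rP] := dg _ e0.
exists (Num.min d r); first by rewrite lt_min d0.
move=> y; rewrite lt_min => /andP[yd yr] Dy.
by rewrite prod_normE /= ge_max dP// rP.
Qed.

Lemma linb_id V : linb (@idfun V).
Proof. by split=> //; exists 1 => x; rewrite mul1r. Qed.

Lemma linb_fst V W : linb (@fst V W).
Proof.
by split=> //; exists 1 => x; rewrite mul1r prod_normE le_max lexx.
Qed.

Lemma linb_snd V W : linb (@snd V W).
Proof.
by split=> //; exists 1 => x; rewrite mul1r prod_normE le_max lexx orbT.
Qed.

Lemma linb_comp V W X (L : V -> W) (M : W -> X) :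
  linb L -> linb M -> linb (M \o L).
Proof.
move=> lL lM; split=> [a x y /=|]; first by rewrite lL.1 lM.1.
have [C C0 LC] := linb_bound lL; have [C' C'0 MC] := linb_bound lM.
exists (C' * C) => x /=; apply: (le_trans (MC _)).
by rewrite -mulrA ler_pM2l.
Qed.

Lemma linb_add V W (L M : V -> W) : linb L -> linb M ->
  linb (fun h => L h + M h).
Proof.
move=> lL lM; split=> [a x y|].
  by rewrite lL.1 lM.1 scalerDr addrACA.
have [C C0 LC] := linb_bound lL; have [C' C'0 MC] := linb_bound lM.
exists (C + C') => x; rewrite mulrDl; apply: (le_trans (ler_normD _ _)).
by rewrite lerD.
Qed.

Lemma linb_opp V W (L : V -> W) : linb L -> linb (fun h => - L h).
Proof.
move=> lL; split=> [a x y|]; first by rewrite lL.1 opprD scalerN.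
by have [C C0 LC] := linb_bound lL; exists C => x; rewrite normrN.
Qed.

Lemma linb_sub V W (L M : V -> W) : linb L -> linb M ->
  linb (fun h => L h - M h).
Proof. by move=> lL lM; apply: linb_add => //; exact: linb_opp. Qed.

Lemma linb_zero V W : linb (fun _ : V => 0 : W).
Proof.
split=> [a x y|]; first by rewrite scaler0 addr0.
by exists 0 => x; rewrite normr0 mul0r.
Qed.

Lemma linb_scale V W (c : R) (L : V -> W) : linb L -> linb (fun h => c *: L h).
Proof.
move=> lL; split=> [a x y|].
  by rewrite lL.1 scalerDr !scalerA mulrC.
have [C C0 LC] := linb_bound lL; exists (`|c| * C) => x.
by rewrite normrZ -mulrA ler_wpM2l.
Qed.

Lemma linb_line V (v : V) : linb (fun h : R => h *: v).
Proof.
split=> [a x y|]; first by rewrite scalerDl scalerA.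
by exists `|v| => x; rewrite normrZ mulrC.
Qed.

End Calculus.

(** * Curves, mean value inequalities and primitives *)

Section RealCalculus.
Context {R : realType}.
Implicit Types (U V W X : normedModType R).

(** Relative to [[a, b]] this is one-sided at the end points, so a curve has to be known on a closed
    time interval only. *)
Definition der W (D : set R) (f : R -> W) (s : R) (d : W) : Prop :=
  diffw D f s (fun h => h *: d).

Lemma der_contw W (D : set R) (f : R -> W) s d : der D f s d -> contw D f s.
Proof. exact/diffw_contw/linb_line. Qed.

Lemma near_dnbhs0 (P : R -> Prop) :
  (\forall h \near 0^', P h) <->
  (exists2 d : R, 0 < d & forall h, `|h| < d -> h != 0 -> P h).
Proof.
split=> [H|[d d0 dP]].
  have /near_iff[d d0 dP] : \forall h \near (0 : R), h != 0 -> P h by exact: H.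
  by exists d => // h hd; apply: dP; rewrite subr0.
suff : \forall h \near (0 : R), h != 0 -> P h by [].
by apply/near_iff; exists d => // h; rewrite subr0; exact: dP.
Qed.

Lemma der_is_derive (D : set R) (f : R -> R) s d (r : R) : 0 < r ->
  (forall y, `|y - s| < r -> D y) -> der D f s d -> is_derive s 1 f d.
Proof.
move=> r0 rD df.
have key : h^-1 *: (f (h *: (1 : R) + s) - f s) @[h --> 0^'] --> d.
  apply/cvgrPdist_le => e e0; have [q q0 qP] := df e e0.
  apply/near_dnbhs0; exists (Num.min q r); first by rewrite lt_min q0.
  move=> h; rewrite lt_min => /andP[hq hr] h0.
  have E : h *: (1 : R) + s - s = h by rewrite addrK /GRing.scale /= mulr1.
  have := qP (h *: (1 : R) + s); rewrite E => /(_ hq (rD _ _)).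
  rewrite E => /(_ hr) H.
  have -> : d - h^-1 *: (f (h *: (1 : R) + s) - f s) =
     - (h^-1 * (f (h *: (1 : R) + s) - f s - h *: d)).
    by rewrite -[h *: d]/(h * d) mulrBr [h^-1 * (h * d)]mulrA mulVf// mul1r opprB.
  rewrite normrN normrM normfV mulrC ler_pdivrMr ?normr_gt0//.
apply: DeriveDef; first by apply/cvg_ex; exists d.
exact: cvg_lim.
Qed.

Lemma is_derive_der (f : R -> R) (s d : R) : is_derive s 1 f d -> der setT f s d.
Proof.
move=> [df vf] e e0; have := df; rewrite /derivable.
move/cvgrPdist_le => /(_ e e0); rewrite -[lim _]/('D_1 f s) vf.
move/near_dnbhs0 => [r r0 rP]; exists r => // y yr _.
have [->|ys] := eqVneq y s; first by rewrite !subrr scale0r subr0 !normr0 mulr0.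
have h0 : y - s != 0 by rewrite subr_eq0.
have H : `|d - (y - s)^-1 * (f ((y - s) * 1 + s) - f s)| <= e by exact: rP.
rewrite mulr1 subrK in H; rewrite -[(y - s) *: d]/((y - s) * d).
have -> : f y - f s - (y - s) * d =
    - ((y - s) * (d - (y - s)^-1 * (f y - f s))).
  by rewrite mulrBr [(y - s) * (_ * _)]mulrA mulfV// mul1r opprB.
by rewrite normrN normrM mulrC ler_wpM2r.
Qed.

(** Inside []a, b[] the relative derivative is an ordinary one, and at the end points it still gives
    continuity; this is what the mean value theorem asks for. *)
Lemma der_le (f d : R -> R) (a b g : R) : a <= b ->
  (forall s, a <= s <= b -> der `[a, b] f s (d s)) ->
  (forall s, a <= s <= b -> d s <= g) -> f b - f a <= g * (b - a).
Proof.
move=> ab df dg.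
have [||c] := @MVT_segment R f d a b ab.
- move=> x; rewrite in_itv/= => /andP[ax xb].
  apply: (@der_is_derive `[a, b] _ _ _ (Num.min (x - a) (b - x))).
  + by rewrite lt_min !subr_gt0 ax.
  + move=> y; rewrite lt_min /= in_itv /= !ltr_norml => H; lra.
  + by apply: df; rewrite !ltW.
- apply/contwP => z zab; apply: (@der_contw _ _ _ _ (d z)); apply: df.
  by move: zab; rewrite /= in_itv.
by rewrite in_itv /= => cab ->; rewrite ler_wpM2r ?subr_ge0// dg.
Qed.

Lemma der_ge (f d : R -> R) (a b g : R) : a <= b ->
  (forall s, a <= s <= b -> der `[a, b] f s (d s)) ->
  (forall s, a <= s <= b -> g <= d s) -> g * (b - a) <= f b - f a.
Proof.
move=> ab df dg.
have H := @der_le (fun s => - f s) (fun s => - d s) a b (- g) ab.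
suff : - f b - - f a <= - g * (b - a) by lra.
apply: H => s sab; last by rewrite lerN2 dg.
apply: diffw_eqL (diffwN (df s sab)) => h.
by rewrite scalerN.
Qed.

Lemma der_abs (f d : R -> R) (a b g : R) : a <= b ->
  (forall s, a <= s <= b -> der `[a, b] f s (d s)) ->
  (forall s, a <= s <= b -> `|d s| <= g) -> `|f b - f a| <= g * (b - a).
Proof.
move=> ab df dg; rewrite ler_norml -mulNr.
rewrite (@der_ge _ d)// ?(@der_le _ d)// => s /dg; rewrite ler_norml.
  by move=> /andP[].
by move=> /andP[].
Qed.

Lemma der_comp V W (E : set R) (D : set V) (c : R -> V) (f : V -> W) s v M :
  (forall y, E y -> D (c y)) -> linb M ->
  der E c s v -> diffw D f (c s) M -> der E (f \o c) s (M v).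
Proof.
move=> cD lM dc df.
apply: diffw_eqL (diffw_comp cD (linb_line v) lM dc df) => h /=.
exact: linbZ.
Qed.

Lemma der_sub W (D D' : set R) (f : R -> W) s d :
  D' `<=` D -> der D f s d -> der D' f s d.
Proof. exact: diffw_sub. Qed.

Lemma der_eqd W (D : set R) (f : R -> W) s d d' :
  d = d' -> der D f s d -> der D f s d'.
Proof. by move=> ->. Qed.

Lemma der_cst W (D : set R) (c : W) s : der D (fun=> c) s 0.
Proof. by apply: diffw_eqL (diffw_cst _ _ _) => h; rewrite scaler0. Qed.

Lemma der_id (D : set R) s : der D (fun s : R => s) s 1.
Proof.
apply: diffw_eqL (diffw_linb _ _ (linb_id _)) => h.
by rewrite /GRing.scale /= mulr1.
Qed.

Lemma derD W (D : set R) (f g : R -> W) s a b :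
  der D f s a -> der D g s b -> der D (fun s => f s + g s) s (a + b).
Proof.
by move=> df dg; apply: diffw_eqL (diffwD df dg) => h; rewrite scalerDr.
Qed.

Lemma derN W (D : set R) (f : R -> W) s a :
  der D f s a -> der D (fun s => - f s) s (- a).
Proof. by move=> df; apply: diffw_eqL (diffwN df) => h; rewrite scalerN. Qed.

Lemma derB W (D : set R) (f g : R -> W) s a b :
  der D f s a -> der D g s b -> der D (fun s => f s - g s) s (a - b).
Proof. by move=> df dg; apply: derD => //; exact: derN. Qed.

Lemma derM (D : set R) (f g : R -> R) s a b :
  der D f s a -> der D g s b ->
  der D (fun s => f s * g s) s (a * g s + f s * b).
Proof.
move=> df dg.
apply: diffw_eqL (diffwM (linb_line a) (linb_line b) df dg) => h.
by rewrite /GRing.scale /=; ring.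
Qed.

Lemma derZ W (D : set R) (f : R -> R) (v : W) s a :
  der D f s a -> der D (fun s => f s *: v) s (a *: v).
Proof.
move=> df.
have lv : linb (fun r : R => r *: v) by exact: linb_line.
by apply: (der_comp (D := setT) (f := fun r : R => r *: v) _ lv df) => //;
  exact: diffw_linb.
Qed.

Lemma der_pair V W (D : set R) (f : R -> V) (g : R -> W) s a b :
  der D f s a -> der D g s b -> der D (fun s => (f s, g s)) s (a, b).
Proof. exact: diffw_pair. Qed.

(** Composition with the segment from [z] to [z'] reduces this to [der_le]; the differential has to
    be bounded in the direction [z' - z] only, and [D] may have a boundary. *)
Lemma seg_le V (D : set V) (f : V -> R) (L : V -> V -> R) (z z' : V) (g : R) :
  (forall q : R, 0 <= q <= 1 -> D (z + q *: (z' - z))) ->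
  (forall q : R, 0 <= q <= 1 -> let y := z + q *: (z' - z) in
     [/\ linb (L y), diffw D f y (L y) & L y (z' - z) <= g]) ->
  f z' - f z <= g.
Proof.
move=> segD H; pose c (q : R) := z + q *: (z' - z).
have dc q E : der E c q (z' - z).
  apply: der_eqd (derD (der_cst _ z _) (derZ (z' - z) (der_id _ _))).
  by rewrite add0r scale1r.
have -> : f z' - f z = (f \o c) 1 - (f \o c) 0.
  by rewrite /= /c scale1r scale0r addr0 [z + _]addrC subrK.
rewrite -[g]mulr1 -[X in g * X]subr0.
apply: (@der_le _ (fun q => L (c q) (z' - z))) => // q q01.
- have [lL df _] := H q q01.
  apply: (der_comp _ lL (dc q _) df) => y /=.
  by rewrite in_itv; exact: segD.
- by have [] := H q q01.
Qed.

Lemma seg_abs V (D : set V) (f : V -> R) (L : V -> V -> R) (z z' : V) (g : R) :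
  (forall q : R, 0 <= q <= 1 -> D (z + q *: (z' - z))) ->
  (forall q : R, 0 <= q <= 1 -> let y := z + q *: (z' - z) in
     [/\ linb (L y), diffw D f y (L y) & `|L y (z' - z)| <= g]) ->
  `|f z' - f z| <= g.
Proof.
move=> segD H; rewrite ler_norml; apply/andP; split; last first.
  apply: (@seg_le V D f L z z' g segD) => q q01 y.
  have [lL df] := H q q01; rewrite ler_norml => /andP[_ Hg].
  by split.
have := @seg_le V D (fun y => - f y) (fun y h => - L y h) z z' g segD.
suff H' : forall q : R, 0 <= q <= 1 -> let y := z + q *: (z' - z) in
  [/\ linb (fun h => - L y h), diffw D (fun y => - f y) y (fun h => - L y h)
    & - L y (z' - z) <= g] by move=> /(_ H'); lra.
move=> q q01 y; have [lL df Hn] := H q q01; split.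
- exact: linb_opp.
- exact: diffwN.
- by move: Hn; rewrite ler_norml -/y; lra.
Qed.

(** The integral starts at [a - 1], so that every [s >= a], including [a] itself, lies to the right
    of the starting point and has a two-sided derivative; the additive constant never matters. *)
Definition prim (a : R) (f : R -> R) (s : R) : R :=
  \int[lebesgue_measure]_(t in `[a - 1, s]) f t.

Lemma prim_der (a : R) (f : R -> R) : (forall s, contw setT f s) ->
  forall s, a <= s -> der setT (prim a f) s (f s).
Proof.
move=> cf s sa.
have ctf : continuous f by move=> x; apply/contw_setTP.
have [||||dF vF] := @continuous_FTC1 R f (BLeft (a - 1)) s (s + 1).
- by rewrite ltrDl.
- apply: continuous_compact_integrable; first exact: segment_compact.
  exact: continuous_subspaceT.
- by rewrite /= lte_fin; lra.
- exact: ctf.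
move: dF vF; rewrite -/(prim a f); set F := prim a f => dF vF.
have dF' : is_derive s 1 F (f s).
  by apply: DeriveDef; [exact: dF|rewrite -derive1E].
exact: is_derive_der.
Qed.

End RealCalculus.

(** * The sup norm and the scalar product on row vectors *)

Section Vectors.
Context {R : realType} {n : nat}.
Implicit Types (x y z : 'rV[R]_n) (V W : normedModType R).

Lemma coord_le_norm x i : `|x 0 i| <= `|x|.
Proof.
rewrite [X in _ <= X]mx_normrE.
by apply: (le_bigmax _ (fun ij : 'I_1 * 'I_n => `|x ij.1 ij.2|) (0, i)).
Qed.

Lemma norm_le_coord x (c : R) : 0 <= c -> (forall i, `|x 0 i| <= c) -> `|x| <= c.
Proof.
move=> c0 xc; rewrite [X in X <= _]mx_normrE.
by apply/bigmax_leP; split=> // -[i j] _ /=; rewrite [i]ord1.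
Qed.

Lemma dotC x y : dot x y = dot y x.
Proof. by apply: eq_bigr => i _; rewrite mulrC. Qed.

(** The norm is the sup norm; this dimension factor is the source of most of the [n%:R] in the
    constants. *)
Lemma dot_le_norm x y : `|dot x y| <= n%:R * (`|x| * `|y|).
Proof.
rewrite (le_trans (ler_norm_sum _ _ _))//.
rewrite mulr_natl -[X in _ <= _ *+ X]card_ord -sumr_const ler_sum// => i _.
by rewrite normrM ler_pM// coord_le_norm.
Qed.

Lemma dot_linbr x : linb (dot x).
Proof.
split=> [a y z|].
  rewrite /dot /GRing.scale /= mulr_sumr -big_split; apply: eq_bigr => i _ /=.
  by rewrite !mxE; ring.
by exists (n%:R * `|x|) => y; rewrite -mulrA dot_le_norm.
Qed.

Lemma dot_linbl y : linb (fun x => dot x y).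
Proof.
have [L [C LC]] := dot_linbr y; split=> [a x z|].
  by rewrite !(dotC _ y) L.
by exists C => x; rewrite dotC LC.
Qed.

Lemma dotDl x y z : dot (x + y) z = dot x z + dot y z.
Proof. exact: (linbD _ _ (dot_linbl z)). Qed.
Lemma dotNl x z : dot (- x) z = - dot x z.
Proof. exact: (linbN _ (dot_linbl z)). Qed.
Lemma dotNr x z : dot z (- x) = - dot z x.
Proof. exact: (linbN _ (dot_linbr z)). Qed.
Lemma dotBl x y z : dot (x - y) z = dot x z - dot y z.
Proof. exact: (linbB _ _ (dot_linbl z)). Qed.
Lemma dotBr x y z : dot z (x - y) = dot z x - dot z y.
Proof. exact: (linbB _ _ (dot_linbr z)). Qed.
Lemma dotZl a x z : dot (a *: x) z = a * dot x z.
Proof. exact: (linbZ _ _ (dot_linbl z)). Qed.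
Lemma dotZr a x z : dot z (a *: x) = a * dot z x.
Proof. exact: (linbZ _ _ (dot_linbr z)). Qed.
Lemma dot0l z : dot 0 z = 0.
Proof. exact: (linb0 (dot_linbl z)). Qed.
Lemma dot0r z : dot z 0 = 0.
Proof. exact: (linb0 (dot_linbr z)). Qed.

Lemma dot_bilinb : bilinb (@dot R n).
Proof.
split; [exact: dot_linbl|exact: dot_linbr|].
by exists n%:R => x y; exact: dot_le_norm.
Qed.

Lemma dot_ge0 x : 0 <= dot x x.
Proof. by rewrite sumr_ge0// => i _; rewrite -expr2 sqr_ge0. Qed.

Lemma enorm_sqr x : enorm x ^+ 2 = dot x x.
Proof. by rewrite sqr_sqrtr// dot_ge0. Qed.

Lemma sqr_norm_le_dot x : `|x| ^+ 2 <= dot x x.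
Proof.
rewrite -[leRHS]enorm_sqr lerXn2r ?nnegrE ?sqrtr_ge0//.
apply: norm_le_coord => [|i]; first exact: sqrtr_ge0.
rewrite -sqrtr_sqr ler_wsqrtr// /dot (bigD1 i)//= -expr2 lerDl.
by rewrite sumr_ge0// => j _; rewrite -expr2 sqr_ge0.
Qed.

Lemma dot_le_sqr_norm x : dot x x <= n%:R * `|x| ^+ 2.
Proof. by rewrite expr2 (le_trans (ler_norm _)) ?dot_le_norm. Qed.

Lemma norm_le_enorm x : `|x| <= enorm x.
Proof.
rewrite -[X in X <= _]ger0_norm// -sqrtr_sqr ler_wsqrtr//.
exact: sqr_norm_le_dot.
Qed.

Lemma enorm_le_norm x : enorm x <= n%:R * `|x|.
Proof.
rewrite -[n%:R * _]ger0_norm ?mulr_ge0// -sqrtr_sqr ler_wsqrtr//.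
rewrite (le_trans (dot_le_sqr_norm x))// exprMn ler_wpM2r ?sqr_ge0//.
by rewrite -natrX ler_nat; case: (n) => // m; rewrite -{1}[m.+1]expn1 leq_pexp2l.
Qed.

Lemma coord_linb i : linb (fun x : 'rV[R]_n => x 0 i).
Proof.
split=> [a x y|]; first by rewrite !mxE.
by exists 1 => x; rewrite mul1r coord_le_norm.
Qed.

Lemma der_coord (D : set R) (X : R -> 'rV[R]_n) (s : R) (v : 'rV[R]_n) i :
  der D X s v -> der D (fun s => X s 0 i) s (v 0 i).
Proof.
move=> dX.
by apply: (der_comp (D := setT) (f := fun x : 'rV[R]_n => x 0 i) _ (coord_linb i) dX) => //;
  exact/diffw_linb/coord_linb.
Qed.

Lemma ball_forall_ord (V : normedModType R) (z : V) (P : 'I_n -> V -> Prop) :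
  (forall i, exists2 d : R, 0 < d & forall y : V, `|y - z| < d -> P i y) ->
  exists2 d : R, 0 < d & forall y : V, `|y - z| < d -> forall i, P i y.
Proof.
move=> H; apply/near_iff; have := @filter_forall V 'I_n P (nbhs z) _.
by apply => i; apply/near_iff.
Qed.

Lemma der_row (D : set R) (X : R -> 'rV[R]_n) (s : R) (v : 'rV[R]_n) :
  (forall i, der D (fun s => X s 0 i) s (v 0 i)) -> der D X s v.
Proof.
move=> dX e e0.
have [|d d0 dP] := @ball_forall_ord R s
    (fun i (y : R) => D y -> `|X y 0 i - X s 0 i - (y - s) * v 0 i| <= e * `|y - s|).
  by move=> i; have [d d0 dP] := dX i e e0; exists d.
exists d => // y yd Dy.
apply: norm_le_coord => [|i]; first by rewrite mulr_ge0// ltW.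
by rewrite !mxE; exact: dP.
Qed.

Lemma contw_row V (D : set V) (X : V -> 'rV[R]_n) (z : V) :
  (forall i, contw D (fun s => X s 0 i) z) -> contw D X z.
Proof.
move=> dX e e0.
have [|d d0 dP] := @ball_forall_ord V z
    (fun i (y : V) => D y -> `|X y 0 i - X z 0 i| <= e).
  by move=> i; have [d d0 dP] := dX i e e0; exists d.
exists d => // y yd Dy.
apply: norm_le_coord => [|i]; first exact: ltW.
by rewrite !mxE; exact: dP.
Qed.

Lemma der_dot (D : set R) (X Y : R -> 'rV[R]_n) (s : R) (v w : 'rV[R]_n) :
  der D X s v -> der D Y s w ->
  der D (fun s => dot (X s) (Y s)) s (dot v (Y s) + dot (X s) w).
Proof.
move=> dX dY.
have := diffw_bilin dot_bilinb (linb_line v) (linb_line w) dX dY.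
apply: diffw_eqL => h; rewrite dotZl dotZr /GRing.scale /=; ring.
Qed.

Lemma der_norm (X d : R -> 'rV[R]_n) (a b g : R) : a <= b -> 0 <= g ->
  (forall s, a <= s <= b -> der `[a, b] X s (d s)) ->
  (forall s, a <= s <= b -> `|d s| <= g) -> `|X b - X a| <= g * (b - a).
Proof.
move=> ab g0 dX dg; apply: norm_le_coord => [|i].
  by rewrite mulr_ge0// subr_ge0.
rewrite !mxE; apply: (@der_abs _ (fun s => X s 0 i) (fun s => d s 0 i)) => // s sab.
  exact/der_coord/dX.
by rewrite (le_trans (coord_le_norm _ _))// dg.
Qed.

Lemma box_compact y0 (r : R) : compact [set x | `|x - y0| <= r].
Proof.
apply: bounded_closed_compact.
  exists (r + `|y0|); split; first by rewrite num_real.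
  move=> M rM x /= xr; rewrite ltW// (le_lt_trans _ rM)//.
  by rewrite -[x](subrK y0) (le_trans (ler_normD _ _))// lerD2r.
have -> : [set x | `|x - y0| <= r] = closed_ball_ Num.norm y0 r.
  by rewrite eqEsubset; split=> x /=; rewrite /closed_ball_ /= distrC.
exact: closed_closed_ball_.
Qed.

Lemma box_convex x y y0 (r q : R) : `|x - y0| <= r -> `|y - y0| <= r ->
  0 <= q <= 1 -> `|x + q *: (y - x) - y0| <= r.
Proof.
move=> xr yr /andP[q0 q1].
have -> : x + q *: (y - x) - y0 = (1 - q) *: (x - y0) + q *: (y - y0).
  by apply/rowP => i; rewrite !mxE; ring.
rewrite (le_trans (ler_normD _ _))// !normrZ !ger0_norm ?subr_ge0//.
nra.
Qed.

End Vectors.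

(** * Consequences of compactness *)

Section Compactness.
Context {R : realType}.
Implicit Types (V W : normedModType R).

Lemma compact_max V (K : set V) (f : V -> R) z0 : K z0 -> compact K ->
  (forall z, K z -> contw K f z) ->
  exists2 c, K c & forall z, K z -> f z <= f c.
Proof.
move=> Kz0 cK cf.
have [|c] := @compact_EVT_max V R f K (ex_intro _ _ Kz0) cK.
  exact/contwP.
by rewrite inE => Kc cP; exists c => // z Kz; apply: cP; rewrite inE.
Qed.

Lemma compact_bdd V W (K : set V) (f : V -> W) : compact K ->
  (forall z, K z -> contw K f z) ->
  exists2 C : R, 0 < C & forall z, K z -> `|f z| <= C.
Proof.
move=> cK cf.
have [->|/set0P[z0 Kz0]] := eqVneq K set0; first by exists 1.
have [|c Kc cP] := @compact_max V K (fun z => `|f z|) z0 Kz0 cK.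
  move=> z Kz e e0; have [d d0 dP] := cf z Kz e e0; exists d => // y yd Ky.
  by rewrite (le_trans (ler_dist_dist _ _))// dP.
exists (`|f c| + 1); first by rewrite ltr_wpDl.
by move=> z /cP /le_trans; apply; rewrite lerDl.
Qed.

(** Pairs of close points are handled by a local constant, distant pairs by the bound of [f] on
    [K]. *)
Lemma compact_lip V W (K D : set V) (f : V -> W) : compact K -> K `<=` D ->
  locally_lipschitz D f ->
  exists2 C : R, 0 < C &
    forall z z', K z -> K z' -> `|f z' - f z| <= C * `|z' - z|.
Proof.
move=> cK KD lf.
have lfP z : D z -> exists d k : R, [/\ 0 < d, 0 <= k &
    forall y y', `|y - z| < d -> `|y' - z| < d -> D y -> D y' ->
    `|f y' - f y| <= k * `|y' - y|].
  move=> Dz; have [U zU [k0 [_ kP]]] := lf z Dz.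
  have /near_iff[d d0 dU] : \forall y \near z, U y by exact: zU.
  exists d, (`|k0| + 1); split => // y y' yd y'd Dy Dy'.
  have := kP (`|k0| + 1); rewrite (le_lt_trans (ler_norm k0)) ?ltrDl//.
  by move=> /(_ isT (y', y)) /=; apply; split; split => //; exact: dU.
have cf z : K z -> contw K f z.
  move=> Kz; have [d [k [d0 k0 dP]]] := lfP z (KD _ Kz) => e e0.
  exists (Num.min d (e / (k + 1))); first by rewrite lt_min d0 divr_gt0// ltr_wpDl.
  move=> y; rewrite lt_min => /andP[yd]; rewrite ltr_pdivlMr ?ltr_wpDl// => ye Ky.
  have := dP z y; rewrite subrr normr0 => /(_ d0 yd (KD _ Kz) (KD _ Ky)).
  by move/le_trans; apply; nra.
have [G G0 GP] := compact_bdd cK cf.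
(* Near covering along [C -> +oo]: for [y] within [d / 2] of [z], a point [y'] is either within [d]
   of [z], where the local constant applies, or at distance at least [d / 2] from [y], where any [C]
   beyond [2 * G / (d / 2)] suffices. *)
have : \forall C \near +oo, K `<=` (fun y => K y -> forall y', K y' -> `|f y' - f y| <= C * `|y' - y|).
  move/compact_near_coveringP: cK; apply => z Kz.
  have [d [k [d0 k0 dP]]] := lfP z (KD _ Kz).
  exists ([set y | `|y - z| < d / 2], [set C | Num.max k (2 * G / (d / 2)) < C]).
    split; last by exists (Num.max k (2 * G / (d / 2))); split => //; rewrite num_real.
    by apply/near_iff; exists (d / 2) => //; rewrite divr_gt0.
  move=> [y C] /= [yd]; rewrite gt_max => /andP[kC GC] Ky y' Ky'.
  have [y'd|y'd] := ltP `|y' - z| d.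
    have := dP y y' (lt_trans yd _) y'd (KD _ Ky) (KD _ Ky').
    rewrite ltr_pdivrMr// ltr_pMr// ltr1n => /(_ isT) /le_trans; apply.
    by rewrite ler_wpM2r// ltW.
  have d2 : d / 2 <= `|y' - y|.
    have -> : y' - y = (y' - z) - (y - z) by rewrite opprB addrA subrK.
    have := lerB_dist (y' - z) (y - z); move: yd y'd; lra.
  rewrite (le_trans (ler_normB _ _))//.
  have := GP _ Ky; have := GP _ Ky'.
  have : 2 * G <= C * `|y' - y|.
    move: GC; rewrite ltr_pdivrMr ?divr_gt0// => /ltW /le_trans; apply.
    rewrite ler_wpM2l//; apply: le_trans (ltW kC); exact: k0.
  lra.
move=> H; have [C [CP C0]] : exists C : R,
    (K `<=` (fun y => K y -> forall y', K y' -> `|f y' - f y| <= C * `|y' - y|)) /\ 0 < C.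
  apply: (@filter_ex _ (pinfty_nbhs R) _ _ (filterI H _)).
  by exists 0; split.
by exists C => // z z' Kz; exact: (CP _ Kz Kz).
Qed.

End Compactness.

(** * A contraction principle for families of reals *)

Section FixedPoint.
Context {R : realType}.


Lemma pow2_small (c e : R) : 0 < e -> exists k : nat, c / 2 ^+ k <= e.
Proof.
move=> e0; have [c0|c0] := leP c 0.
  by exists 0%N; rewrite expr0 divr1 (le_trans c0)// ltW.
exists (Num.truncn (c / e)).+1; rewrite ler_pdivrMr ?exprn_gt0// mulrC -ler_pdivrMr//.
have /ltW/le_trans := truncnS_gt (c / e); apply.
rewrite -natrX ler_nat; exact/ltnW/ltn_expl.
Qed.

(** The tail of the geometric series bounds all later increments, so the intervals of radius
    [2 c / 2^k] around the [u k] meet pairwise; the supremum of their left ends lies in each of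
    them. *)
Lemma geometric_limit (u : nat -> R) (c : R) :
  (forall k, `|u k.+1 - u k| <= c / 2 ^+ k) ->
  exists z, forall k, `|u k - z| <= 2 * c / 2 ^+ k.
Proof.
move=> uc.
have c0 : 0 <= c by have := uc 0%N; rewrite expr0 divr1; exact: le_trans.
have H m k : `|u (k + m)%N - u k| <= 2 * c / 2 ^+ k - 2 * c / 2 ^+ (k + m).
  elim: m => [|m IH]; first by rewrite addn0 !subrr normr0.
  rewrite addnS; have := uc (k + m)%N.
  have := ler_normD (u (k + m).+1 - u (k + m)%N) (u (k + m)%N - u k).
  have -> : 2 * c / 2 ^+ (k + m).+1 = c / 2 ^+ (k + m).
    by rewrite exprS invfM; field; rewrite expf_neq0.
  have E : 2 * c / 2 ^+ (k + m) = c / 2 ^+ (k + m) + c / 2 ^+ (k + m) by ring.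
  by rewrite addrA subrK; move: IH; rewrite E; lra.
have pos j : 0 <= 2 * c / 2 ^+ j by rewrite !mulr_ge0// invr_ge0 exprn_ge0.
have ab m k : u m - 2 * c / 2 ^+ m <= u k + 2 * c / 2 ^+ k.
  have [km|/ltnW mk] := leqP k m.
    have := H (m - k)%N k; rewrite subnKC// => Hk.
    by have := ler_norm (u m - u k); have := pos m; lra.
  have := H (k - m)%N m; rewrite subnKC// => Hk.
  by have := ler_norm (- (u k - u m)); rewrite normrN; have := pos k; lra.
pose S := [set u m - 2 * c / 2 ^+ m | m in [set: nat]].
have S0 : S !=set0 by exists (u 0%N - 2 * c / 2 ^+ 0); exists 0%N.
have Su k : ubound S (u k + 2 * c / 2 ^+ k) by move=> _ [m _ <-].
exists (sup S) => k; rewrite ler_norml.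
have : sup S <= u k + 2 * c / 2 ^+ k by apply: ge_sup.
have : u k - 2 * c / 2 ^+ k <= sup S.
  by apply: ub_le_sup; [exists (u 0%N + 2 * c / 2 ^+ 0)|exists k].
lra.
Qed.

(* Applied to paths, seen as families of reals indexed by time and coordinate;
   an exponential weight [E] allows arbitrary time intervals. *)
Lemma fixpoint (I : Type) (Adm : (I -> R) -> Prop) (E : I -> R)
    (Phi : (I -> R) -> I -> R) (Z0 : I -> R) (d0 : R) :
  (forall i, 0 <= E i) -> Adm Z0 -> (forall Z, Adm Z -> Adm (Phi Z)) ->
  (forall Z Z' d, Adm Z -> Adm Z' -> 0 <= d ->
     (forall i, `|Z i - Z' i| <= d * E i) ->
     forall i, `|Phi Z i - Phi Z' i| <= d / 2 * E i) ->
  0 <= d0 -> (forall i, `|Phi Z0 i - Z0 i| <= d0 * E i) ->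
  (forall Z, (forall e, 0 < e -> exists2 Z', Adm Z' &
     forall i, `|Z' i - Z i| <= e * E i) -> Adm Z) ->
  exists2 Z, Adm Z & forall i, Phi Z i = Z i.
Proof.
move=> E0 AZ0 APhi ctr d00 dP0 Acl.
pose Zs k := iter k Phi Z0.
have AZs k : Adm (Zs k) by elim: k => //= k; exact: APhi.
have Zstep k i : `|Zs k.+1 i - Zs k i| <= d0 * E i / 2 ^+ k.
  elim: k i => [|k IH] i; first by rewrite expr0 divr1 dP0.
  have -> : d0 * E i / 2 ^+ k.+1 = d0 / 2 ^+ k / 2 * E i.
    by rewrite exprS invfM; ring.
  apply: (ctr _ _ _ (AZs k.+1) (AZs k)) => [|j].
    by rewrite mulr_ge0// invr_ge0 exprn_ge0.
  by rewrite mulrAC; exact: IH.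
have /choice[Z ZP] : forall i, exists z, forall k,
    `|Zs k i - z| <= 2 * (d0 * E i) / 2 ^+ k.
  by move=> i; exact: geometric_limit.
have ZP' k i : `|Zs k i - Z i| <= (2 * d0 / 2 ^+ k) * E i.
  by have := ZP i k; rewrite [2 * _]mulrA mulrAC.
have small e : 0 < e -> exists k : nat, 2 * d0 / 2 ^+ k <= e by exact: pow2_small.
have AZ : Adm Z.
  apply: Acl => e e0; have [k ke] := small e e0; exists (Zs k) => // i.
  by apply: (le_trans (ZP' k i)); rewrite ler_wpM2r.
exists Z => // i; apply/eqP; rewrite -subr_eq0 -normr_eq0; apply/eqP.
apply: le_anti; rewrite normr_ge0 andbT; apply/ler_addgt0Pr => e e0; rewrite add0r.
have [|k ke] := small (e / (E i + 1)).
  by rewrite divr_gt0// ltr_wpDl.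
have pk : 0 <= 2 * d0 / 2 ^+ k by rewrite !mulr_ge0// invr_ge0 exprn_ge0.
have H1 := ctr _ _ _ (AZs k) AZ pk (ZP' k) i.
have H2 := ZP' k.+1 i.
have H3 : 2 * d0 / 2 ^+ k * E i <= e.
  have : 2 * d0 / 2 ^+ k * (E i + 1) <= e by rewrite -ler_pdivlMr// ltr_wpDl.
  by apply: le_trans; rewrite ler_wpM2l// lerDl.
have H4 : 2 * d0 / 2 ^+ k.+1 * E i = 2 * d0 / 2 ^+ k / 2 * E i.
  by rewrite exprS invfM; ring.
have := ler_normD (Phi Z i - Phi (Zs k) i) (Phi (Zs k) i - Z i).
rewrite addrA subrK [`|Phi Z i - Phi _ i|]distrC.
move: H1 H2; rewrite H4 -[Zs k.+1]/(Phi (Zs k)).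
set a := 2 * d0 / _ * _ in H3; have -> : 2 * d0 / 2 ^+ k / 2 * E i = a / 2.
  by rewrite /a; ring.
lra.
Qed.

End FixedPoint.

(** * The Hamiltonian on compact boxes *)

Section Hamiltonian.
Context {R : realType} {n : nat}.
Notation V := 'rV[R]_n.
Notation Z := (R * V * V)%type.

Lemma diffw_derive (W : normedModType R) (f : W -> R) (z v : W) (L : W -> R)
    (D : set W) : nbhs z D ->
  linb L -> diffw D f z L -> 'D_v f z = L v.
Proof.
move=> /near_iff[r r0 rD] lL df; apply: cvg_lim => //.
have [C C0 vC] : exists2 C : R, 0 < C & `|v| <= C.
  by exists (`|v| + 1); rewrite ?lerDl// ltr_wpDl.
apply/cvgrPdist_le => e e0.
have [d d0 dP] := df _ (divr_gt0 e0 C0).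
apply/near_dnbhs0; exists (Num.min d r / C).
  by rewrite divr_gt0// lt_min d0.
move=> h; rewrite ltr_pdivlMr// lt_min => /andP[hd hr] h0.
have hC : `|h *: v| <= `|h| * C by rewrite normrZ ler_wpM2l.
have := dP (h *: v + z); rewrite addrK.
move=> /(_ (le_lt_trans hC hd) (rD _ _)); rewrite addrK.
move=> /(_ (le_lt_trans hC hr)); rewrite linbZ// => H.
have -> : L v - h^-1 *: (f (h *: v + z) - f z) =
    - (h^-1 * (f (h *: v + z) - f z - h *: L v)).
  rewrite -[h *: L v]/(h * L v) mulrBr [h^-1 * (h * _)]mulrA mulVf// mul1r.
  by rewrite opprB.
rewrite normrN normrM normfV mulrC ler_pdivrMr ?normr_gt0// (le_trans H)//.
by rewrite -mulrA ler_pM2l// mulrC ler_pdivrMr.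
Qed.

Lemma row_delta (p : V) : p = \sum_(i < n) p 0 i *: delta_mx 0 i.
Proof. exact: row_sum_delta. Qed.

Definition dirt : Z := ((1, 0), 0).
Definition dirx (i : 'I_n) : Z := ((0, delta_mx 0 i), 0).
Definition dirp (i : 'I_n) : Z := ((0, 0), delta_mx 0 i).

Lemma row_linear_dot (F : V -> R) : (forall a x y, F (a *: x + y) = a * F x + F y) ->
  forall x, F x = dot (\row_i F (delta_mx 0 i)) x.
Proof.
move=> Flin x.
have F0 : F 0 = 0 by have := Flin (-1) 0 0; rewrite scaler0 addr0; lra.
have FD y z : F (y + z) = F y + F z.
  by have := Flin 1 y z; rewrite scale1r mul1r.
rewrite {1}(row_delta x) (big_morph F FD F0); apply: eq_bigr => i _.
by rewrite mxE -[_ *: _]addr0 Flin F0 addr0 mulrC.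
Qed.

Lemma lin_Z (L : {linear Z -> R}) (h : Z) :
  L h = L dirt * h.1.1 + dot (\row_i L (dirx i)) h.1.2
        + dot (\row_i L (dirp i)) h.2.
Proof.
case: h => [[t x] p] /=.
have -> : (t, x, p) = t *: dirt + (0, x, 0) + (0, 0, p) :> Z.
  congr (_, _, _) => /=; rewrite ?scaler0 ?add0r ?addr0//.
  by rewrite -[_ *: _]/(t * 1) mulr1.
rewrite !linearD linearZ; congr (_ + _ + _); first exact: mulrC.
  rewrite (row_linear_dot (F := fun x => L (0, x, 0)))// => a y z.
  have -> : (0, a *: y + z, 0) = a *: (0, y, 0) + (0, z, 0) :> Z.
    by congr (_, _, _); rewrite /= ?scaler0 ?addr0.
  exact: linearP.
rewrite (row_linear_dot (F := fun x => L (0, 0, x)))// => a y z.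
have -> : (0, 0, a *: y + z) = a *: (0, 0, y) + (0, 0, z) :> Z.
  by congr (_, _, _); rewrite /= ?scaler0 ?addr0.
exact: linearP.
Qed.

Lemma lin_Z_linb (L : {linear Z -> R}) : linb L.
Proof.
split=> [a x y|]; first exact: linearP.
exists (`|L dirt| + n%:R * `|\row_i L (dirx i)| + n%:R * `|\row_i L (dirp i)|).
move=> h; rewrite lin_Z.
have h11 : `|h.1.1| <= `|h| by rewrite !prod_normE !le_max lexx.
have h12 : `|h.1.2| <= `|h| by rewrite !prod_normE !le_max lexx orbT.
have h2 : `|h.2| <= `|h| by rewrite prod_normE le_max lexx orbT.
rewrite (le_trans (ler_normD _ _))// 2!mulrDl lerD//; last first.
  by rewrite (le_trans (dot_le_norm _ _))// mulrA ler_wpM2l// mulr_ge0.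
rewrite (le_trans (ler_normD _ _))// lerD//.
  by rewrite normrM ler_wpM2l.
by rewrite (le_trans (dot_le_norm _ _))// mulrA ler_wpM2l// mulr_ge0.
Qed.

Lemma norm_row_le (F : 'I_n -> R) (c : R) : 0 <= c -> (forall i, `|F i| <= c) ->
  `|\row_i F i| <= c.
Proof. by move=> c0 Fc; apply: norm_le_coord => // i; rewrite mxE. Qed.

Lemma Zseg_abs (D : set Z) (f : Z -> R) (df : Z -> {linear Z -> R})
    (z z' : Z) (g : R) :
  (forall z, D z -> diff_within D f z (df z)) ->
  (forall q : R, 0 <= q <= 1 -> D (z + q *: (z' - z))) ->
  (forall q : R, 0 <= q <= 1 -> `|df (z + q *: (z' - z)) (z' - z)| <= g) ->
  `|f z' - f z| <= g.
Proof.
move=> dfP Dseg dg; apply: (@seg_abs _ _ D f (fun y h => df y h)) => // q q01 y.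
split; [exact: lin_Z_linb|by apply/diffwP/dfP/Dseg|exact: dg].
Qed.

(** Continuity of the differential is known only in each fixed direction, so it is bounded on [K]
    along the basis directions and the bounds are added up; convexity of [K] provides the segments
    for the mean value inequality. *)
Lemma C1_lip (D K : set Z) (f : Z -> R) : C1_on D f -> compact K -> K `<=` D ->
  (forall z z' (q : R), K z -> K z' -> 0 <= q <= 1 -> K (z + q *: (z' - z))) ->
  exists2 C : R, 0 < C & forall z z', K z -> K z' -> `|f z' - f z| <= C * `|z' - z|.
Proof.
move=> [df [dfP dfc]] cK KD Kcvx.
have bd v : exists2 C : R, 0 < C & forall z, K z -> `|df z v| <= C.
  apply: compact_bdd => // z Kz; apply: (contw_sub KD).
  by have /contwP H := dfc v; exact: H (KD _ Kz).
have [Ct Ct0 CtP] := bd dirt.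
have /choice[cx cxP] : forall i, exists C : R, 0 < C /\ forall z, K z -> `|df z (dirx i)| <= C.
  by move=> i; have [C C0 CP] := bd (dirx i); exists C.
have /choice[cp cpP] : forall i, exists C : R, 0 < C /\ forall z, K z -> `|df z (dirp i)| <= C.
  by move=> i; have [C C0 CP] := bd (dirp i); exists C.
pose Cx := \sum_i cx i; pose Cp := \sum_i cp i.
have Cx0 : 0 <= Cx by apply: sumr_ge0 => i _; apply/ltW; case: (cxP i).
have Cp0 : 0 <= Cp by apply: sumr_ge0 => i _; apply/ltW; case: (cpP i).
have Cxi i : cx i <= Cx.
  rewrite /Cx (bigD1 i)//= lerDl sumr_ge0// => j _.
  by apply/ltW; case: (cxP j).
have Cpi i : cp i <= Cp.
  rewrite /Cp (bigD1 i)//= lerDl sumr_ge0// => j _.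
  by apply/ltW; case: (cpP j).
exists (Ct + n%:R * Cx + n%:R * Cp).
  by rewrite !ltr_wpDr// mulr_ge0.
move=> z z' Kz Kz'; apply: (Zseg_abs dfP) => q q01.
  by apply: KD; exact: Kcvx.
have Ky := Kcvx _ _ _ Kz Kz' q01; move: (z + _) Ky => y Ky; set h := z' - z.
rewrite lin_Z.
have h11 : `|h.1.1| <= `|h| by rewrite !prod_normE !le_max lexx.
have h12 : `|h.1.2| <= `|h| by rewrite !prod_normE !le_max lexx orbT.
have h2 : `|h.2| <= `|h| by rewrite prod_normE le_max lexx orbT.
rewrite (le_trans (ler_normD _ _))// 2!mulrDl lerD//; last first.
  rewrite (le_trans (dot_le_norm _ _))// -mulrA ler_wpM2l// ler_pM//.
  by apply: norm_row_le => // i; rewrite (le_trans _ (Cpi i))//; apply (cpP i).2.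
rewrite (le_trans (ler_normD _ _))// lerD//.
  by rewrite normrM ler_pM// CtP.
rewrite (le_trans (dot_le_norm _ _))// -mulrA ler_wpM2l// ler_pM//.
by apply: norm_row_le => // i; rewrite (le_trans _ (Cxi i))//; apply (cxP i).2.
Qed.

End Hamiltonian.

Section HamiltonianBounds.
Context {R : realType} {n : nat}.
Notation V := 'rV[R]_n.
Notation Z := (R * V * V)%type.

Definition Hbox (T r M : R) (y0 : V) : set Z :=
  [set z | [/\ 0 <= z.1.1 <= T, `|z.1.2 - y0| <= r & `|z.2| <= M]].

Lemma contw_cvg (W W' : normedModType R) (D : set W) (f : W -> W') z :
  contw D f z <-> f y @[y --> within D (nbhs z)] --> f z.
Proof.
split=> [cf|/cvgrPdist_le cf e e0].
  apply/cvgrPdist_le => e e0; rewrite near_withinE; apply/near_iff.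
  have [d d0 dP] := cf e e0.
  by exists d => // y yz Dy; rewrite distrC; exact: dP.
have := cf e e0; rewrite near_withinE => /near_iff[d d0 dP].
by exists d => // y yz Dy; rewrite distrC; exact: dP.
Qed.

Lemma contwM (W : normedModType R) (D : set W) (f g : W -> R) z :
  contw D f z -> contw D g z -> contw D (fun y => f y * g y) z.
Proof. by move=> /contw_cvg cf /contw_cvg cg; apply/contw_cvg; exact: cvgM. Qed.

Lemma contwD (W W' : normedModType R) (D : set W) (f g : W -> W') z :
  contw D f z -> contw D g z -> contw D (fun y => f y + g y) z.
Proof. by move=> /contw_cvg cf /contw_cvg cg; apply/contw_cvg; exact: cvgD. Qed.

Lemma contwN (W W' : normedModType R) (D : set W) (f : W -> W') z :
  contw D f z -> contw D (fun y => - f y) z.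
Proof. by move=> /contw_cvg cf; apply/contw_cvg; exact: cvgN. Qed.

Lemma contw_cst (W W' : normedModType R) (D : set W) (c : W') z :
  contw D (fun=> c) z.
Proof. by move=> e e0; exists 1 => // y _ _; rewrite subrr normr0 ltW. Qed.

Lemma contw_sum (W W' : normedModType R) (D : set W) m (f : 'I_m -> W -> W') z :
  (forall i, contw D (f i) z) -> contw D (fun y => \sum_i f i y) z.
Proof.
move=> cf; elim: (index_enum _) => [|i s IH].
  by under eq_fun do rewrite big_nil; exact: contw_cst.
by under eq_fun do rewrite big_cons; exact: contwD.
Qed.

Lemma contw_comp (W W' W'' : normedModType R) (D : set W) (E : set W')
    (f : W -> W') (g : W' -> W'') z :
  (forall y, D y -> E (f y)) -> contw D f z -> contw E g (f z) ->
  contw D (g \o f) z.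
Proof.
move=> DE cf cg e e0; have [d d0 dP] := cg e e0.
have [r r0 rP] := cf _ (divr_gt0 d0 (ltr0Sn R 1)); exists r => // y yr Dy /=.
apply: dP; last exact: DE.
by rewrite (le_lt_trans (rP y yr Dy))// ltr_pdivrMr// ltr_pMr// ltr1n.
Qed.

Lemma contw_linb (W W' : normedModType R) (D : set W) (L : W -> W') z :
  linb L -> contw D L z.
Proof. by move=> lL; exact: diffw_contw lL (diffw_linb _ _ lL). Qed.

Lemma der_sum (W : normedModType R) (D : set R) m (f : 'I_m -> R -> W) s d :
  (forall i, der D (f i) s (d i)) -> der D (fun y => \sum_i f i y) s (\sum_i d i).
Proof.
move=> df; elim: (index_enum _) => [|i l IH].
  by under eq_fun do rewrite big_nil; rewrite big_nil; exact: der_cst.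
by under eq_fun do rewrite big_cons; rewrite big_cons; exact: derD.
Qed.

(** All that the sequel uses of the smoothness and convexity of [H], free of second derivatives: one
    constant [C] for bounds, Lipschitz estimates and Taylor remainder, and a convexity modulus
    [lam]. [C >= 1] lets lower order terms be absorbed. *)
Record Hbounds (T r M : R) (y0 : V) (H : Z -> R) (Hx Hp : Z -> V)
    (C lam : R) : Prop := {
  Hb_C : 1 <= C;
  Hb_lam : 0 < lam;
  Hb_bdd : forall z, Hbox T r M y0 z -> [/\ `|H z| <= C, `|Hx z| <= C & `|Hp z| <= C];
  Hb_lip : forall z z' d, Hbox T r M y0 z -> Hbox T r M y0 z' -> `|z' - z| <= d ->
    [/\ `|H z' - H z| <= C * d, `|Hx z' - Hx z| <= C * d & `|Hp z' - Hp z| <= C * d];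
  Hb_taylor : forall t x p x' p' d, Hbox T r M y0 (t, x, p) ->
    Hbox T r M y0 (t, x', p') -> `|x' - x| <= d -> `|p' - p| <= d ->
    `|H (t, x', p') - H (t, x, p) - dot (Hx (t, x, p)) (x' - x)
      - dot (Hp (t, x, p)) (p' - p)| <= C * d ^+ 2;
  Hb_convex : forall t x p p', Hbox T r M y0 (t, x, p) ->
    Hbox T r M y0 (t, x, p') ->
    H (t, x, p) + dot (Hp (t, x, p)) (p' - p) + lam / 2 * dot (p' - p) (p' - p)
      <= H (t, x, p') }.

Lemma Hbox_compact T r M y0 : compact (Hbox T r M y0).
Proof.
have -> : Hbox T r M y0 = (`[0, T] `*` [set x | `|x - y0| <= r])
   `*` [set p : V | `|p - 0| <= M].
  rewrite eqEsubset; split=> -[[t x] p] /=; rewrite in_itv /= subr0.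
    by move=> [].
  by move=> [[]].
apply: compact_setX; last exact: box_compact.
by apply: compact_setX; [exact: segment_compact|exact: box_compact].
Qed.

Lemma Hbox_convex T r M y0 (z z' : Z) (q : R) : Hbox T r M y0 z -> Hbox T r M y0 z' ->
  0 <= q <= 1 -> Hbox T r M y0 (z + q *: (z' - z)).
Proof.
move: z z' => [[t x] p] [[t' x'] p'] [/= tT xr pM] [/= tT' xr' pM'] q01; split => /=.
- by move: q01 tT tT' => /andP[q0 q1] /andP[t0 tT] /andP[t'0 tT'];
    rewrite -[q *: _]/(q * (t' - t)); nra.
- exact: box_convex.
- by rewrite -[X in `|X|]subr0 box_convex// subr0.
Qed.

Lemma Hbounds_exist (T : R) (Omega : set V) (H : Z -> R) :
  C2_on ((`[0, T] `*` Omega) `*` setT) H ->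
  (forall (t : R) (x p : V), 0 <= t <= T -> Omega x ->
       posdefmx (hessian (fun q => H (t, x, q)) p)) ->
  exists Hx Hp : Z -> V, forall y0 r M, (forall x, `|x - y0| <= r -> Omega x) ->
  exists C lam, Hbounds T r M y0 H Hx Hp C lam.
Proof.
set D := _ `*` setT => -[df [dfP dfC1]] Hpos.
pose Hx z := \row_i df z (dirx i); pose Hp z := \row_i df z (dirp i).
exists Hx, Hp => y0 r M rO; set K := Hbox T r M y0.
have KD : K `<=` D.
  by move=> [[t x] p] [/= tT xr _]; split=> //=; split; rewrite //= ?in_itv//; exact: rO.
have cK : compact K := @Hbox_compact _ _ _ _.
have Kcvx z z' q : K z -> K z' -> 0 <= q <= 1 -> K (z + q *: (z' - z)).
  exact: Hbox_convex.
have row_lip (dir : 'I_n -> Z) : exists2 C : R, 0 < C & forall z z', K z -> K z' ->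
    `|(\row_i df z' (dir i)) - (\row_i df z (dir i))| <= C * `|z' - z|.
  have /choice[c cP] : forall i, exists C : R, 0 < C /\ forall z z', K z -> K z' ->
      `|df z' (dir i) - df z (dir i)| <= C * `|z' - z|.
    by move=> i; have [C C0 CP] := C1_lip (dfC1 (dir i)) cK KD Kcvx; exists C.
  exists (\sum_i c i + 1).
    by rewrite ltr_wpDl// sumr_ge0// => i _; apply/ltW; case: (cP i).
  have cs i : c i <= \sum_i c i + 1.
    rewrite (bigD1 i)//= -addrA lerDl addr_ge0// sumr_ge0// => j _.
    by apply/ltW; case: (cP j).
  move=> z z' Kz Kz'; apply: norm_le_coord => [|i].
    rewrite mulr_ge0// (le_trans _ (lexx _))// addr_ge0// sumr_ge0// => i _.
    by apply/ltW; case: (cP i).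
  rewrite !mxE (le_trans ((cP i).2 _ _ Kz Kz'))// ler_wpM2r//.
have [Cx Cx0 CxP] := row_lip dirx; have [Cp Cp0 CpP] := row_lip dirp.
have HC1 : C1_on D H.
  exists df; split=> // v; apply/contwP => z Dz.
  have [dd [ddP _]] := dfC1 v.
  by apply: (diffw_contw (L := dd z)); [exact: lin_Z_linb|exact/diffwP/ddP].
have [CH CH0 CHP] := C1_lip HC1 cK KD Kcvx.
have [BH BH0 BHP] : exists2 C : R, 0 < C & forall z, K z -> `|H z| <= C.
  apply: compact_bdd => // z Kz; apply: (contw_lip (C := CH)) => y Ky.
  exact: CHP.
have [Bx Bx0 BxP] : exists2 C : R, 0 < C & forall z, K z -> `|Hx z| <= C.
  apply: compact_bdd => // z Kz; apply: (contw_lip (C := Cx)) => y Ky.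
  exact: CxP.
have [Bp Bp0 BpP] : exists2 C : R, 0 < C & forall z, K z -> `|Hp z| <= C.
  apply: compact_bdd => // z Kz; apply: (contw_lip (C := Cp)) => y Ky.
  exact: CpP.
pose C1 := n%:R * (Cx + Cp).
have C10 : 0 <= C1 by rewrite mulr_ge0// addr_ge0// ltW.
have taylor t x p x' p' d : K (t, x, p) -> K (t, x', p') ->
    `|x' - x| <= d -> `|p' - p| <= d ->
    `|H (t, x', p') - H (t, x, p) - dot (Hx (t, x, p)) (x' - x)
      - dot (Hp (t, x, p)) (p' - p)| <= C1 * d ^+ 2.
  move=> Kz Kz' xd pd; set z := (t, x, p) in Kz *; set z' := (t, x', p') in Kz' *.
  have zz' : `|z' - z| <= d.
    by rewrite !prod_normE /= subrr normr0 !ge_max xd pd (le_trans _ xd).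
  (* The derivative of [G] is [df y - df z], of size [d], taken in a direction of size [d]: the mean
     value inequality already gives a quadratic remainder. *)
  pose G (y : Z) := H y - df z y.
  have -> : H z' - H z - dot (Hx z) (x' - x) - dot (Hp z) (p' - p) = G z' - G z.
    have := lin_Z (df z) (z' - z); rewrite /= subrr mulr0 add0r linearB /G /Hx /Hp.
    lra.
  apply: (@seg_abs _ _ D G (fun y h => df y h - df z h)) => q q01.
    by apply: KD; exact: Kcvx.
  have Ky := Kcvx _ _ _ Kz Kz' q01; have yz : `|z + q *: (z' - z) - z| <= d.
    rewrite addrAC subrr add0r normrZ; case/andP: q01 => q0 q1.
    by rewrite ger0_norm// (le_trans _ zz')// ler_piMl.
  move: (z + _) Ky yz => y Ky yz; split.
  - by apply: linb_sub; exact: lin_Z_linb.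
  - apply: diffwB; first by apply/diffwP/dfP/KD.
    by apply: diffw_linb; exact: lin_Z_linb.
  - rewrite (lin_Z (df y) (z' - z)) (lin_Z (df z) (z' - z)) /= subrr !mulr0 !add0r.
    have -> : forall a b c d : R, a + b - (c + d) = (a - c) + (b - d) by move=> *; lra.
    rewrite -!dotBl (le_trans (ler_normD _ _))// /C1 mulrDr mulrDl expr2 lerD//.
      rewrite (le_trans (dot_le_norm _ _))// -mulrA ler_wpM2l// mulrA ler_pM//.
      by rewrite (le_trans (CxP _ _ Kz Ky))// ler_wpM2l// ltW.
    rewrite (le_trans (dot_le_norm _ _))// -mulrA ler_wpM2l// mulrA ler_pM//.
    by rewrite (le_trans (CpP _ _ Kz Ky))// ler_wpM2l// ltW.
have /choice[d2 d2P] : forall j, exists d2 : Z -> {linear Z -> R},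
    (forall z, D z -> diff_within D (fun z => df z (dirp j)) z (d2 z)) /\
    (forall v, {within D, continuous (fun z => d2 z v)}).
  by move=> j; exact: dfC1.
pose quad (z : Z) (q : V) := \sum_j q 0 j * d2 j z (0, 0, q).
have d2E j z q : d2 j z (0, 0, q) = \sum_i d2 j z (dirp i) * q 0 i.
  rewrite lin_Z /= mulr0 add0r dot0r add0r; apply: eq_bigr => i _.
  by rewrite mxE.
have D_fiber t x p p' : D (t, x, p) -> D (t, x, p') by move=> [/= tx _].
(* In [p] the domain is the whole space, so derivatives in [p] are two-sided even at the end times
   and agree with the directional derivatives that define [hessian]. *)
have fib t x p L (f : Z -> R) : D (t, x, p) -> linb L -> diffw D f (t, x, p) L ->
    linb (fun h => L (0, 0, h)) /\
    diffw setT (fun q => f (t, x, q)) p (fun h => L (0, 0, h)).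
  move=> Dz lL dL.
  have emb0 : linb (fun h : V => (0, 0, h) : Z).
    split=> [a y z|]; first by congr (_, _, _); rewrite /= ?scaler0 ?addr0.
    by exists 1 => h; rewrite !prod_normE /= !normr0 mul1r !ge_max lexx normr_ge0.
  have dc : diffw setT (fun q : V => (t, x, q) : Z) p (fun h => (0, 0, h)).
    have H0 := diffwD (diffw_cst setT ((t, x, 0) : Z) p) (diffw_linb setT p emb0).
    apply: (diffw_eqL _ (diffw_ext _ H0)) => [h|q]; first by rewrite add0r.
    by congr (_, _, _); rewrite /= ?addr0 ?add0r.
  split; first exact: (linb_comp emb0 lL).
  by apply: (diffw_comp _ emb0 lL _ dL).
have hessE t x p i j : D (t, x, p) ->
    hessian (fun q => H (t, x, q)) p i j = d2 j (t, x, p) (dirp i).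
  move=> Dz; rewrite mxE.
  have -> : (fun y : V => 'D_(delta_mx 0 j) (fun q => H (t, x, q)) y) =
      fun y => df (t, x, y) (dirp j).
    apply/funext => y; have Dy : D (t, x, y) := D_fiber _ _ _ _ Dz.
    have [l1 l2] := fib t x y _ _ Dy (lin_Z_linb _) (iffLR (diffwP _ _ _ _) (dfP _ Dy)).
    by rewrite (diffw_derive _ filterT l1 l2).
  have [l1 l2] := fib t x p _ _ Dz (lin_Z_linb _) (iffLR (diffwP _ _ _ _) ((d2P j).1 _ Dz)).
  by rewrite (diffw_derive _ filterT l1 l2).
have quad_pos z q : D z -> q != 0 -> 0 < quad z q.
  move: z => [[t x] p] Dz q0; have [[/=]] := Dz; rewrite in_itv /= => tT Ox _.
  have := Hpos t x p tT Ox q q0; congr (_ < _).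
  rewrite mxE; apply: eq_bigr => j _; rewrite d2E mxE mulrC mxE; congr (_ * _).
  by apply: eq_bigr => i _; rewrite hessE// mulrC.
(* The unit sphere of the sup norm: its product with the box is compact and [quad] is jointly
   continuous there, so the minimum of [quad] is positive. *)
pose S := [set q : V | `|q| <= 1] `&` [set q : V | 1 <= `|q|].
have cS : compact S.
  apply: (subclosed_compact _ (@box_compact R n 0 1)).
    apply: closedI.
      have -> : [set q : V | `|q| <= 1] = closed_ball_ Num.norm 0 1.
        by rewrite eqEsubset; split=> x /=; rewrite /closed_ball_ /= sub0r normrN.
      exact: closed_closed_ball_.
    rewrite (_ : [set q : V | _] = Num.norm @^-1` [set x : R | 1 <= x]).
      by apply: preimage_closed => [x _|]; [exact: norm_continuous|exact: closed_ge].
    by [].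
  by move=> q [q1 _] /=; rewrite subr0.
have quadc (w : Z * V) : (K `*` S) w -> contw (K `*` S) (fun w => - quad w.1 w.2) w.
  move=> [Kw1 Sw2]; apply: contwN; apply: contw_sum => j; apply: contwM.
    apply: contw_linb; apply: (linb_comp (linb_snd _ _) (coord_linb j)).
  have -> : (fun y : Z * V => d2 j y.1 (0, 0, y.2)) =
      fun y => \sum_i d2 j y.1 (dirp i) * y.2 0 i.
    by apply/funext => y; exact: d2E.
  apply: contw_sum => i; apply: contwM.
    apply: (contw_comp (E := K) (f := fst) (g := fun z => d2 j z (dirp i))).
    - by move=> y [].
    - exact/contw_linb/linb_fst.
    - apply: (contw_sub KD).
      by have /contwP cc := (d2P j).2 (dirp i); exact: cc (KD _ Kw1).
  apply: contw_linb; apply: (linb_comp (linb_snd _ _) (coord_linb i)).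
have [lam lam0 lamP] : exists2 lam : R, 0 < lam & forall z q, K z -> S q -> lam <= quad z q.
  have [KS0|/set0P[w0 Kw0]] := eqVneq (K `*` S) set0.
    exists 1 => // z q Kz Sq; suff : (K `*` S) (z, q) by rewrite KS0.
    by [].
  have [|c [Kc Sc] cP] := compact_max Kw0 _ quadc; first exact: compact_setX.
  exists (quad c.1 c.2).
    apply: quad_pos; first exact: KD.
    by rewrite -normr_eq0 gt_eqF// (lt_le_trans ltr01)//; case: Sc.
  by move=> z q Kz Sq; have := cP (z, q) (conj Kz Sq) => /=; clear; lra.
(* Homogeneity extends the bound from the sphere to all [q]; passing from the squared sup norm to
   [dot q q] costs [n], and the [+ 1] avoids a division by zero when [n = 0]. *)
pose lam' := lam / (n%:R + 1).
have n1 : 0 < n%:R + 1 :> R by rewrite ltr_wpDl.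
have lam'0 : 0 < lam' by rewrite divr_gt0.
have quad_ge z q : K z -> lam' * dot q q <= quad z q.
  move=> Kz; have [->|q0] := eqVneq q 0.
    by rewrite dot0l mulr0 /quad big1// => j _; rewrite mxE mul0r.
  have qn0 : 0 < `|q| by rewrite normr_gt0.
  have Sq : S (`|q|^-1 *: q).
    by split=> /=; rewrite normrZ normfV normr_id mulVf ?gt_eqF.
  have := lamP _ _ Kz Sq.
  have -> : quad z (`|q|^-1 *: q) = `|q|^-1 ^+ 2 * quad z q.
    rewrite /quad mulr_sumr; apply: eq_bigr => j _.
    by rewrite !d2E !mxE !mulr_sumr; apply: eq_bigr => i _; rewrite !mxE; ring.
  rewrite exprVn mulrC ler_pdivlMr ?exprn_gt0// => H1.
  apply: le_trans H1; rewrite /lam' mulrAC ler_pdivrMr// -mulrA ler_wpM2l ?(ltW lam0)//.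
  by rewrite (le_trans (dot_le_sqr_norm q))// mulrC ler_wpM2l ?sqr_ge0// lerDl.
pose C := 1 + CH + Cx + Cp + BH + Bx + Bp + C1.
have [[C_1 CHC CxC CpC] [BHC BxC BpC C1C]] : [/\ 1 <= C, CH <= C, Cx <= C & Cp <= C] /\
    [/\ BH <= C, Bx <= C, Bp <= C & C1 <= C].
  by move: CH0 Cx0 Cp0 BH0 Bx0 Bp0 C10; rewrite /C; clear; split; split; lra.
exists C, lam'; split => //.
- move=> z Kz; split; [exact: le_trans (BHP z Kz) BHC|exact: le_trans (BxP z Kz) BxC|].
  exact: le_trans (BpP z Kz) BpC.
- move=> z z' d Kz Kz' zd.
  have mon c : 0 < c -> c <= C -> c * `|z' - z| <= C * d.
    by move=> c0 cC; rewrite ler_pM// ltW.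
  split.
  + exact: le_trans (CHP _ _ Kz Kz') (mon _ CH0 CHC).
  + exact: le_trans (CxP _ _ Kz Kz') (mon _ Cx0 CxC).
  + exact: le_trans (CpP _ _ Kz Kz') (mon _ Cp0 CpC).
- move=> t x p x' p' d Kz Kz' xd pd; rewrite (le_trans (taylor _ _ _ _ _ _ Kz Kz' xd pd))//.
  by rewrite ler_wpM2r ?sqr_ge0.
- move=> t x p p' Kz Kz'; set dl := p' - p.
  pose c (q : R) : Z := (t, x, p) + q *: (0, 0, dl).
  have cE q : c q = (t, x, p) + q *: ((t, x, p') - (t, x, p)).
    by congr (_ + _ *: _); rewrite /dl; congr (_, _, _); rewrite /= subrr.
  have Kc q : 0 <= q <= 1 -> K (c q) by move=> q01; rewrite cE; exact: Kcvx.
  have dc E q : der E c q (0, 0, dl).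
    apply: der_eqd (derD (der_cst _ (t, x, p) _) (derZ _ (der_id _ _))).
    by rewrite add0r scale1r.
  have dfc (f : Z -> R) (L : Z -> {linear Z -> R}) a b q : 0 <= a -> b <= 1 ->
      (forall z, D z -> diff_within D f z (L z)) -> a <= q <= b ->
      der `[a, b] (f \o c) q (L (c q) (0, 0, dl)).
    move=> a0 b1 fL /andP[aq qb].
    have Kq s : a <= s <= b -> K (c s).
      by move=> /andP[as_ sb]; apply: Kc; rewrite (le_trans a0)// (le_trans sb).
    apply: (der_comp (D := D) _ (lin_Z_linb _) (dc _ _)).
      by move=> s /=; rewrite in_itv /= => sab; apply/KD/Kq.
    by apply/diffwP/fL/KD/Kq; rewrite aq.
  have dfp q : df (c q) (0, 0, dl) = \sum_j dl 0 j * df (c q) (dirp j).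
    rewrite lin_Z /= mulr0 add0r dot0r add0r; apply: eq_bigr => j _.
    by rewrite mxE mulrC.
  have mono q : 0 <= q <= 1 ->
      lam' * dot dl dl * q <= df (c q) (0, 0, dl) - df (c 0) (0, 0, dl).
    move=> /andP[q0 q1]; rewrite -[X in _ * X <= _]subr0.
    apply: (der_ge (f := fun s => df (c s) (0, 0, dl))
      (d := fun s => quad (c s) dl) q0) => s s0q; last first.
      by apply/quad_ge/Kc; move: s0q => /andP[-> /le_trans]; apply.
    have -> : (fun s => df (c s) (0, 0, dl)) =
        fun s => \sum_j dl 0 j * df (c s) (dirp j).
      by apply/funext => r'; exact: dfp.
    apply: der_sum => j.
    apply: der_eqd (derM (der_cst _ (dl 0 j) _)
      (dfc _ (d2 j) _ _ _ _ _ (d2P j).1 s0q)) => //.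
    by rewrite mul0r add0r.
  have c0 : c 0 = (t, x, p) by rewrite /c scale0r addr0.
  have c1 : c 1 = (t, x, p') by rewrite cE scale1r addrC subrK.
  (* [F] measures the convexity defect along the segment: [mono] says that its derivative is
     nonnegative, and [F 0 <= F 1] is the claim. *)
  pose F (q : R) := H (c q) - q * df (c 0) (0, 0, dl) - lam' / 2 * dot dl dl * (q * q).
  have hp : df (c 0) (0, 0, dl) = dot (Hp (t, x, p)) dl.
    by rewrite lin_Z /= mulr0 add0r dot0r add0r c0.
  have : 0 * (1 - 0) <= F 1 - F 0.
    apply: (der_ge (d := fun q => df (c q) (0, 0, dl) - df (c 0) (0, 0, dl)
       - lam' * dot dl dl * q)) => // q q01; last first.
      by rewrite subr_ge0; exact: mono.
    have d1 := dfc H df 0 1 q (lexx _) (lexx _) dfP q01.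
    have d3 := derM (der_id `[0, 1] q) (der_cst `[0, 1] (df (c 0) (0, 0, dl)) q).
    have d4 := derM (der_cst `[0, 1] (lam' / 2 * dot dl dl) q)
      (derM (der_id `[0, 1] q) (der_id `[0, 1] q)).
    by apply: der_eqd (derB (derB d1 d3) d4) => /=; clear; lra.
  by rewrite /F c0 c1 -c0 hp c0; clear; lra.
Qed.

End HamiltonianBounds.

(** * Characteristics and the Hopf formula *)

Section Clamp.
Context {R : realType}.

Definition clamp (a b v : R) : R := Num.max a (Num.min b v).

Lemma clamp_in a b v : a <= b -> a <= clamp a b v <= b.
Proof. by move=> ab; rewrite /clamp le_max lexx /= ge_max ab ge_min lexx. Qed.

Lemma clamp_id a b v : a <= v <= b -> clamp a b v = v.
Proof. by move=> /andP[av vb]; rewrite /clamp min_r// max_r. Qed.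

Lemma clamp_lip a b v w : `|clamp a b v - clamp a b w| <= `|v - w|.
Proof.
rewrite /clamp; case: (leP b v) => bv; case: (leP b w) => bw;
  [case: (leP a b) => ab|case: (leP a b) => ab; case: (leP a w) => aw
  |case: (leP a v) => av; case: (leP a b) => ab
  |case: (leP a v) => av; case: (leP a w) => aw];
  rewrite ?subrr ?normr0//; rewrite ler_norml; apply/andP; split;
  have := ler_norm (v - w); have := ler_norm (w - v); rewrite (distrC w v); lra.
Qed.

(** Coordinatewise truncation is a 1-Lipschitz retraction onto a ball of the sup norm; composed with
    it, a field controlled on a box becomes bounded and Lipschitz on the whole space. *)
Definition clampv {n} (c : 'rV[R]_n) (r : R) (x : 'rV[R]_n) : 'rV[R]_n :=
  \row_i clamp (c 0 i - r) (c 0 i + r) (x 0 i).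

Lemma clampv_in n (c : 'rV[R]_n) r x : 0 <= r -> `|clampv c r x - c| <= r.
Proof.
move=> r0; apply: norm_le_coord => // i; rewrite !mxE.
have /(clamp_in (x 0 i)) : c 0 i - r <= c 0 i + r by lra.
by rewrite ler_norml; lra.
Qed.

Lemma clampv_id n (c : 'rV[R]_n) r x : `|x - c| <= r -> clampv c r x = x.
Proof.
move=> xr; apply/rowP => i; rewrite !mxE clamp_id//.
have := le_trans (coord_le_norm (x - c) i) xr.
by rewrite !mxE ler_norml; lra.
Qed.

Lemma clampv_lip n (c : 'rV[R]_n) r x y : `|clampv c r x - clampv c r y| <= `|x - y|.
Proof.
apply: norm_le_coord => // i; rewrite !mxE (le_trans (clamp_lip _ _ _ _))//.
by have := coord_le_norm (x - y) i; rewrite !mxE.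
Qed.

Lemma contw_pair (U V W : normedModType R) (D : set U) (f : U -> V) (g : U -> W) z :
  contw D f z -> contw D g z -> contw D (fun s => (f s, g s)) z.
Proof.
move=> cf cg e e0; have [d d0 dP] := cf e e0; have [r r0 rP] := cg e e0.
exists (Num.min d r); first by rewrite lt_min d0.
move=> y; rewrite lt_min => /andP[yd yr] Dy.
by rewrite prod_normE /= ge_max dP// rP.
Qed.

Lemma contw_lip_comp (U V W : normedModType R) (D : set U) (f : U -> V)
    (g : V -> W) (C : R) z :
  (forall y, D y -> `|g (f y) - g (f z)| <= C * `|f y - f z|) ->
  contw D f z -> contw D (fun s => g (f s)) z.
Proof.
move=> gC cf; apply: (contw_comp (E := [set v | exists2 y, D y & v = f y])) cf _.
  by move=> y Dy; exists y.
by apply: (contw_lip (C := C)) => _ [y Dy ->]; exact: gC.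
Qed.

Lemma prim_diff_le (f g : R -> R) (c a b : R) : 0 <= a <= b ->
  (forall s, contw setT f s) -> (forall s, contw setT g s) ->
  (forall s, a <= s <= b -> `|f s - g s| <= c) ->
  `|(prim 0 f b - prim 0 f a) - (prim 0 g b - prim 0 g a)| <= c * (b - a).
Proof.
move=> /andP[a0 ab] cf cg fg.
have := @der_abs R (fun s => prim 0 f s - prim 0 g s) (fun s => f s - g s) a b c ab.
have -> : (prim 0 f b - prim 0 f a) - (prim 0 g b - prim 0 g a) =
  prim 0 f b - prim 0 g b - (prim 0 f a - prim 0 g a) by ring.
apply => // s /andP[as_ sb].
by apply: derB; apply: (der_sub (subsetT _)); apply: prim_der => //; exact: le_trans as_.
Qed.

Lemma prim_le (f : R -> R) (c a b : R) : 0 <= a <= b ->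
  (forall s, contw setT f s) ->
  (forall s, a <= s <= b -> `|f s| <= c) ->
  `|prim 0 f b - prim 0 f a| <= c * (b - a).
Proof.
move=> /andP[a0 ab] cf fc; apply: (der_abs (d := f)) => // s /andP[as_ sb].
by apply: (der_sub (subsetT _)); apply: prim_der => //; exact: le_trans as_.
Qed.

End Clamp.

(** * Existence of characteristics for short times *)

Section Characteristics.
Context {R : realType} {n : nat}.
Notation V := 'rV[R]_n.
Notation Z := (R * V * V)%type.
Variables (T r M : R) (y0 : V) (H : Z -> R) (Hx Hp : Z -> V) (C lam : R).
Variables (K : R).

(** [P 0] and [a 0] are the gradient and the value at [X 0] of the initial datum
    [p.x - K |x|^2 / 2], and [a] integrates the Lagrangian [P.H_p - H] along the curve. Membership
    in the box is part of the notion, since [H] is controlled only there. *)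
Record ischar (t : R) (p : V) (X P : R -> V) (a : R -> R) : Prop := {
  ch_box : forall s, 0 <= s <= t -> Hbox T r M y0 (s, X s, P s);
  ch_P0 : P 0 = p - K *: X 0;
  ch_a0 : a 0 = dot p (X 0) - K / 2 * dot (X 0) (X 0);
  ch_X : forall s, 0 <= s <= t -> der `[0, t] X s (Hp (s, X s, P s));
  ch_P : forall s, 0 <= s <= t -> der `[0, t] P s (- Hx (s, X s, P s));
  ch_a : forall s, 0 <= s <= t ->
    der `[0, t] a s (dot (P s) (Hp (s, X s, P s)) - H (s, X s, P s)) }.

Hypothesis HB : Hbounds T r M y0 H Hx Hp C lam.
Hypothesis K_ge0 : 0 <= K.

(** The conditions are mixed: [X] is prescribed at time [t], [P] at time [0]. Integrating [X]
    backwards and [P] forwards gives an operator that contracts for short times. The bound by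
    [1 / 2] is the contraction factor, the one by [r / 2] keeps [X] in the box, and the [+ 1] next
    to [|p|] leaves room for the drift of [P]. *)
Lemma char_exist (t : R) (x p : V) : 0 <= t <= T -> 0 < r ->
  C * t * (1 + K) <= 1 / 2 -> C * t <= r / 2 ->
  `|x - y0| <= r / 2 -> `|p| + K * (`|y0| + r) + 1 <= M ->
  exists X P a, ischar t p X P a /\ X t = x.
Proof.
move=> /andP[t0 tT] r0 Ct1 Ctr xr pM.
have C1 := Hb_C HB; have C0 : 0 <= C by rewrite (le_trans ler01).
have Ct0 : 0 <= C * t by rewrite mulr_ge0.
have Kr : 0 <= K * (`|y0| + r) by rewrite mulr_ge0// addr_ge0// ltW.
have M0 : 0 <= M by apply: le_trans pM; rewrite !addr_ge0.
pose I := (bool * 'I_n * R)%type.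
pose Xof (z : I -> R) s : V := \row_i z (true, i, s).
pose Pof (z : I -> R) s : V := \row_i z (false, i, s).
(* Clamping makes the right-hand side bounded and Lipschitz for arbitrary paths and all real times;
   the solution found turns out not to feel the clamps. *)
pose arg (z : I -> R) s : Z := (clamp 0 t s, clampv y0 r (Xof z s), clampv 0 M (Pof z s)).
have argB z s : Hbox T r M y0 (arg z s).
  split=> /=; [|by rewrite clampv_in// ltW|].
    by have /andP[-> /le_trans] := clamp_in s t0; apply.
  by have := @clampv_in R n 0 M (Pof z s) M0; rewrite subr0.
pose F z s := Hp (arg z s); pose G z s := Hx (arg z s).
have FG z z' s d : (forall b i, `|z (b, i, s) - z' (b, i, s)| <= d) -> 0 <= d ->
    `|F z s - F z' s| <= C * d /\ `|G z s - G z' s| <= C * d.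
  move=> zd d0; suff zz : `|arg z s - arg z' s| <= d.
    by have [_ G1 F1] := Hb_lip HB (argB z' s) (argB z s) zz.
  rewrite !prod_normE /= subrr normr0 !ge_max d0 /=.
  by rewrite !(le_trans (clampv_lip _ _ _ _))//; apply: norm_le_coord => // i; rewrite !mxE.
pose Adm (z : I -> R) := forall b i s, contw setT (fun s => z (b, i, s)) s.
have argc z : Adm z -> forall s, contw setT (arg z) s.
  move=> az s; apply: contw_pair; first apply: contw_pair.
  - by apply: (contw_lip (C := 1)) => y _; rewrite mul1r clamp_lip.
  - apply: (contw_lip_comp (f := Xof z) (C := 1)).
      by move=> y _; rewrite mul1r clampv_lip.
    apply: contw_row => i; have := az true i s.
    by under [X in _ -> contw _ X _]eq_fun do rewrite mxE.
  - apply: (contw_lip_comp (f := Pof z) (C := 1)).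
      by move=> y _; rewrite mul1r clampv_lip.
    apply: contw_row => i; have := az false i s.
    by under [X in _ -> contw _ X _]eq_fun do rewrite mxE.
have Fc z i : Adm z -> forall s, contw setT (fun s => F z s 0 i) s.
  move=> az s; apply: (contw_lip_comp (f := arg z) (g := fun w => Hp w 0 i) (C := C)); last exact: argc.
  move=> y _; have [_ _] := Hb_lip HB (argB z s) (argB z y) (lexx _).
  by apply: le_trans; have := coord_le_norm (Hp (arg z y) - Hp (arg z s)) i; rewrite !mxE.
have Gc z i : Adm z -> forall s, contw setT (fun s => G z s 0 i) s.
  move=> az s; apply: (contw_lip_comp (f := arg z) (g := fun w => Hx w 0 i) (C := C)); last exact: argc.
  move=> y _; have [_ + _] := Hb_lip HB (argB z s) (argB z y) (lexx _).
  by apply: le_trans; have := coord_le_norm (Hx (arg z y) - Hx (arg z s)) i; rewrite !mxE.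
have Fb z s i : `|F z s 0 i| <= C.
  by apply: (le_trans (coord_le_norm _ _)); have [] := Hb_bdd HB (argB z s).
have Gb z s i : `|G z s 0 i| <= C.
  by apply: (le_trans (coord_le_norm _ _)); have [] := Hb_bdd HB (argB z s).
pose IF z i u v := prim 0 (fun s => F z s 0 i) v - prim 0 (fun s => F z s 0 i) u.
pose IG z i u v := prim 0 (fun s => G z s 0 i) v - prim 0 (fun s => G z s 0 i) u.
(* The boolean separates [X] (true) from [P] (false). In the second branch [x 0 i - IF z i 0 t] is
   the new value of [X 0], inserted into [P 0 = p - K X 0]; this is where the factor [1 + K] comes
   from. *)
pose Phi (z : I -> R) (w : I) := let: (b, i, s) := w in
  if b then x 0 i - IF z i (clamp 0 t s) t
  else p 0 i - K * (x 0 i - IF z i 0 t) - IG z i 0 (clamp 0 t s).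
have sub_t s u : 0 <= s -> s <= u -> u <= t -> C * (u - s) <= C * t.
  by move=> s0 su ut; rewrite ler_wpM2l// lerBlDr (le_trans ut)// lerDl.
have IFb z i s u : Adm z -> 0 <= s -> s <= u -> u <= t -> `|IF z i s u| <= C * t.
  move=> az s0 su ut; apply: le_trans (sub_t _ _ s0 su ut).
  by apply: prim_le => [|v|v _]; [rewrite s0|exact: Fc|exact: Fb].
have IGb z i s u : Adm z -> 0 <= s -> s <= u -> u <= t -> `|IG z i s u| <= C * t.
  move=> az s0 su ut; apply: le_trans (sub_t _ _ s0 su ut).
  by apply: prim_le => [|v|v _]; [rewrite s0|exact: Gc|exact: Gb].
have IFd z z' i s u d : Adm z -> Adm z' -> 0 <= s -> s <= u -> u <= t -> 0 <= d ->
    (forall w, `|z w - z' w| <= d) -> `|IF z i s u - IF z' i s u| <= C * t * d.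
  move=> az az' s0 su ut d0 zd.
  have : C * d * (u - s) <= C * t * d.
    by rewrite mulrAC ler_wpM2r// sub_t.
  apply: le_trans; apply: prim_diff_le; [by rewrite s0|exact: Fc|exact: Fc|].
  move=> v _; have [+ _] := FG z z' v d (fun b i => zd (b, i, v)) d0.
  by apply: le_trans; have := coord_le_norm (F z v - F z' v) i; rewrite !mxE.
have IGd z z' i s u d : Adm z -> Adm z' -> 0 <= s -> s <= u -> u <= t -> 0 <= d ->
    (forall w, `|z w - z' w| <= d) -> `|IG z i s u - IG z' i s u| <= C * t * d.
  move=> az az' s0 su ut d0 zd.
  have : C * d * (u - s) <= C * t * d.
    by rewrite mulrAC ler_wpM2r// sub_t.
  apply: le_trans; apply: prim_diff_le; [by rewrite s0|exact: Gc|exact: Gc|].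
  move=> v _; have [_ +] := FG z z' v d (fun b i => zd (b, i, v)) d0.
  by apply: le_trans; have := coord_le_norm (G z v - G z' v) i; rewrite !mxE.
have primc (f : R -> R) s : (forall s, contw setT f s) ->
    contw setT (fun s => prim 0 f (clamp 0 t s)) s.
  move=> cf; apply: (contw_comp (E := `[0, t]) (f := clamp 0 t) (g := prim 0 f)).
  - by move=> y _; rewrite /= in_itv clamp_in.
  - by apply: (contw_lip (C := 1)) => y _; rewrite mul1r clamp_lip.
  - have /andP[c0 ct] := clamp_in s t0.
    by apply: (contw_sub (subsetT _)); apply: (der_contw (prim_der cf c0)).
have APhi z : Adm z -> Adm (Phi z).
  move=> az [] i s; rewrite /Phi.
    apply: contwD; first exact: contw_cst.
    apply: contwN; apply: contwD; first exact: contw_cst.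
    by apply/contwN/primc => s'; exact: Fc.
  apply: contwD; first exact: contw_cst.
  apply: contwN; apply: contwD; last exact: contw_cst.
  by apply/primc => s'; exact: Gc.
have cl s : 0 <= clamp 0 t s /\ clamp 0 t s <= t by apply/andP/clamp_in.
have [|||||||z Az zP] := @fixpoint R I Adm (fun=> 1) Phi (fun=> 0)
    (`|x| + 1 + `|p| + K * (`|x| + 1) + 1).
- by [].
- by move=> b i s; exact: contw_cst.
- exact: APhi.
- move=> z z' d az az' d0 zd [[[] i] s]; rewrite mulr1 /Phi.
    have hd : C * t * (1 + K) * d <= d / 2.
      by have := ler_wpM2r d0 Ct1; clear - HB K_ge0; lra.
    have Ctd : 0 <= C * t * d by rewrite mulr_ge0.
    have KCtd : 0 <= K * (C * t * d) by rewrite mulr_ge0.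
    have [c1 c2] := cl s.
    have zd' w : `|z w - z' w| <= d by rewrite -[d]mulr1.
    have h1 := IFd z z' i _ t d az az' c1 c2 (lexx _) d0 zd'.
    have -> : forall k u v : R, k - u - (k - v) = - (u - v) by move=> *; ring.
    by rewrite normrN; move: h1 KCtd hd; clear - HB K_ge0; lra.
  have [c1 c2] := cl s.
  have zd' w : `|z w - z' w| <= d by rewrite -[d]mulr1.
  have h1 := IFd z z' i 0 t d az az' (lexx _) t0 (lexx _) d0 zd'.
  have h2 := IGd z z' i 0 _ d az az' (lexx _) c1 c2 d0 zd'.
  have -> : forall a k u v u' v' : R,
    a - K * (k - u) - v - (a - K * (k - u') - v') = K * (u - u') - (v - v').
    by move=> *; ring.
  have hd : C * t * (1 + K) * d <= d / 2.
    by have := ler_wpM2r d0 Ct1; clear - HB K_ge0; lra.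
  have h3 := ler_wpM2l K_ge0 h1.
  by rewrite (le_trans (ler_normB _ _))// normrM (ger0_norm K_ge0); move: h2 h3 hd; clear - HB K_ge0; lra.
- by rewrite !addr_ge0// mulr_ge0// addr_ge0.
- have az0 : Adm (fun=> 0) by move=> b i s; exact: contw_cst.
  have xi i := coord_le_norm x i; have pi i := coord_le_norm p i.
  have Ct1' : C * t <= 1.
    by have := mulr_ge0 Ct0 K_ge0; move: Ct1; clear - HB K_ge0; lra.
  move=> [[[] i] s]; rewrite mulr1 subr0 /Phi; have [c1 c2] := cl s.
    rewrite (le_trans (ler_normB _ _))//.
    have := IFb _ i _ _ az0 c1 c2 (lexx _).
    have := xi i; have := normr_ge0 p; have : 0 <= K * (`|x| + 1) by rewrite mulr_ge0// addr_ge0.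
    by move: Ct1'; clear - HB K_ge0; lra.
  rewrite (le_trans (ler_normB _ _))// lerD//; last first.
    by have := IGb _ i _ _ az0 (lexx _) c1 c2; move: Ct1'; clear - HB K_ge0; lra.
  rewrite (le_trans (ler_normB _ _))//.
  have : `|K * (x 0 i - IF (fun=> 0) i 0 t)| <= K * (`|x| + 1).
    rewrite normrM ger0_norm// ler_wpM2l// (le_trans (ler_normB _ _))//.
    by have := IFb _ i _ _ az0 (lexx _) t0 (lexx _); have := xi i; move: Ct1'; clear - HB K_ge0; lra.
  by have := pi i; have := normr_ge0 x; clear - HB K_ge0; lra.
- move=> z zlim b i s e e0.
  have [z' az' z'P] := zlim _ (divr_gt0 e0 (ltr0Sn R 2)).
  have [d d0 dP] := az' b i s _ (divr_gt0 e0 (ltr0Sn R 2)).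
  exists d => // y yd _; have := dP y yd Logic.I.
  have := z'P (b, i, y); have := z'P (b, i, s); rewrite !mulr1.
  by rewrite !ler_norml; clear - HB K_ge0; lra.
have ct s : 0 <= s <= t -> clamp 0 t s = s by exact: clamp_id.
pose X s : V := \row_i (x 0 i - IF z i s t).
pose P s : V := \row_i (p 0 i - K * X 0 0 i - IG z i 0 s).
have XE s : 0 <= s <= t -> Xof z s = X s.
  move=> s0t; apply/rowP => i; rewrite !mxE.
  by rewrite -zP /Phi ct.
have PE s : 0 <= s <= t -> Pof z s = P s.
  move=> s0t; apply/rowP => i; rewrite !mxE.
  by rewrite -zP /Phi ct.
have Xx s : 0 <= s <= t -> `|X s - x| <= C * t.
  move=> /andP[s0 st]; apply: norm_le_coord => // i; rewrite !mxE addrAC subrr.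
  by rewrite add0r normrN; exact: IFb.
have Xy s : 0 <= s <= t -> `|X s - y0| <= r.
  move=> s0t; have := ler_normD (X s - x) (x - y0); have := Xx s s0t.
  by rewrite addrA subrK; lra.
have t00 : (0 : R) <= 0 <= t by rewrite lexx.
have X0n : `|X 0| <= `|y0| + r.
  by have := Xy 0 t00; have := ler_normD (X 0 - y0) y0; rewrite subrK; lra.
have Ct1' : C * t <= 1.
    by have := mulr_ge0 Ct0 K_ge0; move: Ct1; clear - HB K_ge0; lra.
have PM s : 0 <= s <= t -> `|P s| <= M.
  move=> /andP[s0 st]; apply: norm_le_coord => // i; rewrite mxE.
  have h1 := IGb z i 0 s Az (lexx _) s0 st.
  have h2 : `|p 0 i - K * X 0 0 i| <= `|p| + K * (`|y0| + r).
    rewrite (le_trans (ler_normB _ _))// lerD ?coord_le_norm// normrM ger0_norm//.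
    by rewrite ler_wpM2l// (le_trans (coord_le_norm _ _)).
  by rewrite (le_trans (ler_normB _ _))//; lra.
(* The bounds on [X] and [P] show that all clamps are inactive, so the fixed point solves the true
   system. *)
have argE s : 0 <= s <= t -> arg z s = (s, X s, P s).
  move=> s0t; rewrite /arg ct// XE// PE// clampv_id ?Xy// clampv_id// subr0.
  exact: PM.
pose l s := dot (clampv 0 M (Pof z s)) (F z s) - H (arg z s).
have lc s : contw setT l s.
  apply: contwD; last first.
    apply/contwN/(contw_lip_comp (f := arg z) (g := H) (C := C)); last exact: argc.
    by move=> y _; have [] := Hb_lip HB (argB z s) (argB z y) (lexx _).
  apply: contw_sum => i; apply: contwM; last exact: Fc.
  apply: (contw_lip_comp (f := arg z) (g := fun w => w.2 0 i) (C := 1)); last exact: argc.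
  move=> y _; rewrite mul1r [X in _ <= X]prod_normE le_max; apply/orP; right.
  by have := coord_le_norm (arg z y - arg z s).2 i; rewrite !mxE.
pose a s := dot p (X 0) - K / 2 * dot (X 0) (X 0) + (prim 0 l s - prim 0 l 0).
exists X, P, a; split; last first.
  by apply/rowP => i; rewrite mxE /IF subrr subr0.
split.
- by move=> s s0t; rewrite -argE.
- by apply/rowP => i; rewrite !mxE /IG subrr subr0.
- by rewrite /a subrr addr0.
- move=> s s0t; rewrite -argE//; apply: der_row => i.
  have /andP[s0 _] := s0t.
  have := derB (der_cst `[0, t] (x 0 i) s) (derB (der_cst `[0, t]
    (prim 0 (fun s => F z s 0 i) t) s) (der_sub (@subsetT _ `[0, t])
    (prim_der (fun s => Fc z i Az s) s0))).
  rewrite !sub0r opprK; apply: diffw_ext => y; by rewrite mxE.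
- move=> s s0t; rewrite -argE//; apply: der_row => i.
  have /andP[s0 _] := s0t.
  have h := derB (der_cst `[0, t] (p 0 i - K * X 0 0 i) s) (derB (der_sub (@subsetT _ `[0, t])
    (prim_der (fun s => Gc z i Az s) s0)) (der_cst `[0, t]
    (prim 0 (fun s => G z s 0 i) 0) s)).
  have -> : (- Hx (arg z s)) 0 i = 0 - (G z s 0 i - 0) by rewrite mxE sub0r subr0.
  by apply: (diffw_ext _ h) => y; rewrite [RHS]mxE.
- move=> s s0t; have /andP[s0 _] := s0t.
  have h := derD (der_cst `[0, t] (dot p (X 0) - K / 2 * dot (X 0) (X 0)) s)
    (derB (der_sub (@subsetT _ `[0, t]) (prim_der lc s0))
    (der_cst `[0, t] (prim 0 l 0) s)).
  apply: (der_eqd _ h).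
  by rewrite add0r subr0 /l PE// clampv_id ?subr0 ?PM// /F argE.
Qed.

End Characteristics.

(** * Stability of characteristics in the end point and the slope *)

Section CharacteristicEstimates.
Context {R : realType} {n : nat}.
Notation V := 'rV[R]_n.
Notation Z := (R * V * V)%type.
Variables (T r M : R) (y0 : V) (H : Z -> R) (Hx Hp : Z -> V) (C lam K : R).
Hypothesis HB : Hbounds T r M y0 H Hx Hp C lam.
Hypothesis K_ge0 : 0 <= K.
Local Notation ischar := (ischar T r M y0 H Hx Hp K).

Let C_ge1 : 1 <= C := Hb_C HB.
Let C_ge0 : 0 <= C := le_trans ler01 C_ge1.

Lemma char_restrict t t' p X P a : t' <= t -> ischar t p X P a -> ischar t' p X P a.
Proof.
move=> t't [cB cP0 ca0 cX cP ca].
have sub s : 0 <= s <= t' -> 0 <= s <= t by move=> /andP[-> /le_trans]; apply.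
have ssub : `[0, t'] `<=` `[0, t] by move=> s /=; rewrite !in_itv; exact: sub.
split=> // s /sub s0t; [exact: cB| | |].
- exact: (der_sub ssub (cX s s0t)).
- exact: (der_sub ssub (cP s s0t)).
- exact: (der_sub ssub (ca s s0t)).
Qed.

Lemma char_speed t p X P a s s' : ischar t p X P a -> 0 <= s -> s <= s' -> s' <= t ->
  `|X s' - X s| <= C * (s' - s) /\ `|P s' - P s| <= C * (s' - s).
Proof.
move=> [cB _ _ cX cP _] s0 ss' s't.
have sub u : s <= u <= s' -> 0 <= u <= t.
  by move=> /andP[su us]; rewrite (le_trans s0)// (le_trans us).
have ssub : `[s, s'] `<=` `[0, t] by move=> u /=; rewrite !in_itv; exact: sub.
split.
  apply: (der_norm (d := fun s => Hp (s, X s, P s))) => // u /sub ut.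
    exact: (der_sub ssub (cX u ut)).
  by have [] := Hb_bdd HB (cB u ut).
apply: (der_norm (d := fun s => - Hx (s, X s, P s))) => // u /sub ut.
  exact: (der_sub ssub (cP u ut)).
by rewrite normrN; have [] := Hb_bdd HB (cB u ut).
Qed.

Section Pair.
Variables (t : R) (p p' : V) (X P X' P' : R -> V) (a a' : R -> R).
Hypotheses (c : ischar t p X P a) (c' : ischar t p' X' P' a') (t_ge0 : 0 <= t).

Let dZ s : R := `|(X' s - X s, P' s - P s)|.

Let dX_le s : `|X' s - X s| <= dZ s.
Proof. by rewrite /dZ prod_normE le_max lexx. Qed.

Let dP_le s : `|P' s - P s| <= dZ s.
Proof. by rewrite /dZ prod_normE le_max lexx orbT. Qed.

Let zz_le s : `|(s, X' s, P' s) - (s, X s, P s)| <= dZ s.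
Proof.
by rewrite /dZ !prod_normE /= subrr normr0 !ge_max !le_max !lexx normr_ge0 orbT.
Qed.

(** Each difference is integrated from the time at which its boundary condition sits: [t] for
    positions, [0] for momenta. *)
Lemma char_pair_growth (D : R) : (forall s, 0 <= s <= t -> dZ s <= D) ->
  forall s, 0 <= s <= t ->
  `|(X' s - X s) - (X' t - X t)| <= C * D * (t - s) /\
  `|(P' s - P s) - (P' 0 - P 0)| <= C * D * s.
Proof.
move=> dD s /andP[s0 st].
have D0 : 0 <= D by apply: le_trans (normr_ge0 _) (dD 0 _); rewrite lexx.
have CD : 0 <= C * D by rewrite mulr_ge0.
have lip u : 0 <= u <= t ->
    `|Hp (u, X' u, P' u) - Hp (u, X u, P u)| <= C * D /\
    `|Hx (u, X' u, P' u) - Hx (u, X u, P u)| <= C * D.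
  move=> ut; have [_ h1 h2] := Hb_lip HB (ch_box c ut) (ch_box c' ut) (le_trans (zz_le u) (dD u ut)).
  by split.
split.
  rewrite distrC.
  apply: (der_norm (X := fun s => X' s - X s)
    (d := fun s => Hp (s, X' s, P' s) - Hp (s, X s, P s))) => // u /andP[su ut].
    have u0t : 0 <= u <= t by rewrite (le_trans s0).
    apply: (@der_sub _ _ `[0, t]); last by apply: derB; [exact: (ch_X c')|exact: (ch_X c)].
    by move=> v /=; rewrite !in_itv /= => /andP[/(le_trans s0) -> ->].
  by have [] := lip u; rewrite ?(le_trans s0).
have := @der_norm R n (fun s => P' s - P s)
  (fun s => - Hx (s, X' s, P' s) - - Hx (s, X s, P s)) 0 s (C * D) s0 CD.
rewrite subr0; apply => u /andP[u0 us].
  have u0t : 0 <= u <= t by rewrite u0 (le_trans us).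
  apply: (@der_sub _ _ `[0, t]); last by apply: derB; [exact: (ch_P c')|exact: (ch_P c)].
  by move=> v /=; rewrite !in_itv /= => /andP[-> /le_trans]; apply.
have [|_] := lip u; first by rewrite u0 (le_trans us).
by rewrite -opprD normrN.
Qed.

(** With boundary conditions at both ends there is no time from which to run Gronwall's lemma.
    Instead the maximum [D] of the distance satisfies [D <= data + (1 + K) C t D], whose last term
    is at most [D / 2]. *)
Lemma char_pair_sup : C * t * (1 + K) <= 1 / 2 ->
  forall s, 0 <= s <= t ->
  dZ s <= 2 * ((1 + K) * `|X' t - X t| + `|p' - p|).
Proof.
move=> Ct.
have [||s1 /= s1t s1P] := @compact_max R R `[0, t] dZ 0 _ (@segment_compact _ 0 t).
- by rewrite /= in_itv /= lexx.
- move=> s /=; rewrite in_itv /= => s0t.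
  apply: (contw_lip_comp (g := fun v : V * V => `|v|) (C := 1)).
    by move=> y _; rewrite mul1r ler_dist_dist.
  by apply: contw_pair; [apply: der_contw (derB (ch_X c' s0t) (ch_X c s0t))
    |apply: der_contw (derB (ch_P c' s0t) (ch_P c s0t))].
have {}s1P s : 0 <= s <= t -> dZ s <= dZ s1.
  by move=> s0t; apply: s1P; rewrite /= in_itv.
move: s1t; rewrite in_itv /= => s1t; have G := char_pair_growth s1P.
set D := dZ s1 in s1P G *.
have D0 : 0 <= D by exact: normr_ge0.
have DE : D = Num.max `|X' s1 - X s1| `|P' s1 - P s1| by rewrite /D /dZ prod_normE.
clearbody D.
have CtD : 0 <= C * D * t by rewrite !mulr_ge0.
have aux u : 0 <= u -> u <= t -> C * D * u <= C * D * t.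
  by move=> u0 ut; rewrite ler_wpM2l// mulr_ge0.
have X1 s : 0 <= s <= t -> `|X' s - X s| <= `|X' t - X t| + C * D * t.
  move=> s0t; have [+ _] := G s s0t; have /andP[s0 st] := s0t.
  have := ler_normD ((X' s - X s) - (X' t - X t)) (X' t - X t); rewrite subrK.
  have := aux (t - s); rewrite subr_ge0 => /(_ st); rewrite lerBlDr lerDl => /(_ s0).
  lra.
have P0E : P' 0 - P 0 = (p' - p) - K *: (X' 0 - X 0).
  by rewrite (ch_P0 c) (ch_P0 c') scalerBr; apply/rowP => i; rewrite !mxE; ring.
have P1 s : 0 <= s <= t ->
    `|P' s - P s| <= `|p' - p| + K * (`|X' t - X t| + C * D * t) + C * D * t.
  move=> s0t; have [_ +] := G s s0t; have /andP[s0 st] := s0t.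
  have := ler_normD ((P' s - P s) - (P' 0 - P 0)) (P' 0 - P 0); rewrite subrK.
  have := aux s s0 st.
  have : `|P' 0 - P 0| <= `|p' - p| + K * (`|X' t - X t| + C * D * t).
    rewrite P0E (le_trans (ler_normB _ _))// lerD2l normrZ ger0_norm// ler_wpM2l//.
    by apply: X1; rewrite lexx.
  lra.
have KX : 0 <= K * `|X' t - X t| by rewrite mulr_ge0.
have KCtD : 0 <= K * (C * D * t) by rewrite mulr_ge0.
have DD : D <= `|p' - p| + (1 + K) * `|X' t - X t| + (1 + K) * (C * D * t).
  rewrite {1}DE ge_max; apply/andP; split.
    by have := X1 s1 s1t; have := normr_ge0 (p' - p); lra.
  by have := P1 s1 s1t; have := normr_ge0 (X' t - X t); lra.
have : (1 + K) * (C * D * t) <= D / 2.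
  by have := ler_wpM2r D0 Ct; lra.
by move=> h s /s1P; lra.
Qed.

(** The difference of the actions minus its first order prediction. By Hamilton's equations the
    first order terms cancel in its derivative, which is quadratic in the distance of the two
    characteristics. *)
Let E s := a' s - a s - dot (P s) (X' s - X s).

Let dE s : 0 <= s <= t -> der `[0, t] E s
  (dot (P' s - P s) (Hp (s, X' s, P' s)) + H (s, X s, P s) - H (s, X' s, P' s)
   + dot (Hx (s, X s, P s)) (X' s - X s)).
Proof.
move=> st; have := derB (derB (ch_a c' st) (ch_a c st))
  (der_dot (ch_P c st) (derB (ch_X c' st) (ch_X c st))).
apply: der_eqd; rewrite !dotBl !dotBr !dotNl; ring.
Qed.

(** This is [D_x S = P t] with a quadratic remainder. For equal slopes [E 0] is
    [- K / 2 |X' 0 - X 0|^2], [E] then changes by Taylor remainders, and [char_pair_sup] bounds all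
    of this by the distance of the end points. *)
Lemma char_pair_action : p = p' -> C * t * (1 + K) <= 1 / 2 ->
  `|a' t - a t - dot (P t) (X' t - X t)|
    <= (K * n%:R + (1 + n%:R)) * 4 * (1 + K) ^+ 2 * `|X' t - X t| ^+ 2.
Proof.
move=> pp' Ct; have sup := char_pair_sup Ct.
set d := 2 * ((1 + K) * `|X' t - X t| + `|p' - p|) in sup.
have dE' : d = 2 * ((1 + K) * `|X' t - X t|) by rewrite /d pp' subrr normr0 addr0.
have d0 : 0 <= d by rewrite dE' !mulr_ge0// addr_ge0.
have Ct1 : C * t <= 1 by have := mulr_ge0 (mulr_ge0 C_ge0 t_ge0) K_ge0; lra.
have E0 : E 0 = - (K / 2) * dot (X' 0 - X 0) (X' 0 - X 0).
  rewrite /E (ch_a0 c) (ch_a0 c') (ch_P0 c) -pp' !dotBl !dotBr !dotZl.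
  by rewrite (dotC (X' 0) (X 0)); field.
have t00 : (0 : R) <= 0 <= t by rewrite lexx.
have E0b : `|E 0| <= K * n%:R * d ^+ 2.
  rewrite E0 mulNr normrN normrM ger0_norm ?divr_ge0//.
  have := dot_le_norm (X' 0 - X 0) (X' 0 - X 0).
  have h : `|X' 0 - X 0| * `|X' 0 - X 0| <= d ^+ 2.
    by rewrite expr2 ler_pM// (le_trans (dX_le 0))// sup.
  move=> /le_trans/(_ (ler_wpM2l (ler0n _ n) h)) h2.
  have := ler_wpM2l K_ge0 h2; have := mulr_ge0 K_ge0 (normr_ge0 (dot (X' 0 - X 0) (X' 0 - X 0))).
  lra.
have Et : `|E t - E 0| <= (1 + n%:R) * C * d ^+ 2 * (t - 0).
  apply: (der_abs t_ge0 dE) => s st.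
  have Xd := le_trans (dX_le s) (sup s st); have Pd := le_trans (dP_le s) (sup s st).
  have tay := Hb_taylor HB (ch_box c' st) (ch_box c st)
    (d := d); rewrite distrC (distrC (P s)) in tay; have {}tay := tay Xd Pd.
  have [_ hx _] := Hb_lip HB (ch_box c st) (ch_box c' st) (le_trans (zz_le s) (sup s st)).
  have h := dot_le_norm (Hx (s, X' s, P' s) - Hx (s, X s, P s)) (X' s - X s).
  have h2 : `|Hx (s, X' s, P' s) - Hx (s, X s, P s)| * `|X' s - X s| <= C * d * d.
    by rewrite ler_pM.
  have {}h := le_trans h (ler_wpM2l (ler0n _ n) h2).
  have -> : (1 + n%:R) * C * d ^+ 2 = C * d ^+ 2 + n%:R * (C * d * d) by ring.
  apply: le_trans (lerD tay h); apply: le_trans (ler_normB _ _).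
  rewrite le_eqVlt; apply/orP; left; apply/eqP; congr `|_|.
  rewrite !dotBl !dotBr (dotC (P' s)) (dotC (P s)); ring.
have EtE : a' t - a t - dot (P t) (X' t - X t) = (E t - E 0) + E 0 by rewrite subrK.
rewrite EtE (le_trans (ler_normD _ _))//.
have -> : (K * n%:R + (1 + n%:R)) * 4 * (1 + K) ^+ 2 * `|X' t - X t| ^+ 2 =
  (1 + n%:R) * d ^+ 2 + K * n%:R * d ^+ 2 by rewrite dE'; ring.
apply: lerD => //; apply: (le_trans Et); rewrite subr0.
have := ler_wpM2l (mulr_ge0 (addr_ge0 ler01 (ler0n _ n)) (sqr_ge0 d)) Ct1.
by rewrite mulr1; lra.
Qed.

(** Strong concavity of the action in the slope, with supergradient [X 0]. During the time [t] the
    momenta differ by about [p' - p], so uniform convexity of [H] costs the action about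
    [t |p' - p|^2]; all errors carry an additional factor [t] and are absorbed by the condition
    involving [lam / 16]. *)
Lemma char_pair_concave : X t = X' t -> C * t * (1 + K) <= 1 / 4 ->
  t * (4 * C ^+ 2 * (1 + n%:R + n%:R * (1 + K))) <= lam / 16 ->
  a' t <= a t + dot (p' - p) (X 0) - lam / 16 * t * `|p' - p| ^+ 2.
Proof.
move=> xx' Ct4 tB.
have Ct2 : C * t * (1 + K) <= 1 / 2 by lra.
have sup := char_pair_sup Ct2; rewrite xx' subrr normr0 mulr0 add0r in sup.
set q := `|p' - p| in sup *; have q0 : 0 <= q := normr_ge0 _.
have grow := char_pair_growth sup; rewrite xx' subrr in grow.
have Ct0 := mulr_ge0 C_ge0 t_ge0; have CtK := mulr_ge0 Ct0 K_ge0.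
have t00 : (0 : R) <= 0 <= t by rewrite lexx.
have dXs s : 0 <= s <= t -> `|X' s - X s| <= C * t * (2 * q).
  move=> st; have [+ _] := grow s st; rewrite subr0 => /le_trans; apply.
  have -> : C * t * (2 * q) = C * (2 * q) * t by ring.
  rewrite ler_wpM2l ?mulr_ge0//; case/andP: st; lra.
have P0E : P' 0 - P 0 = (p' - p) - K *: (X' 0 - X 0).
  by rewrite (ch_P0 c) (ch_P0 c') scalerBr; apply/rowP => i; rewrite !mxE; ring.
have dPs s : 0 <= s <= t -> `|(P' s - P s) - (p' - p)| <= C * t * (1 + K) * (2 * q).
  move=> st; have [_ +] := grow s st; rewrite P0E => h1.
  have -> : (P' s - P s) - (p' - p) = (P' s - P s) - (p' - p - K *: (X' 0 - X 0))
     - K *: (X' 0 - X 0) by apply/rowP => i; rewrite !mxE; ring.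
  rewrite (le_trans (ler_normB _ _))// normrZ ger0_norm//.
  have h2 := ler_wpM2l K_ge0 (dXs 0 t00).
  have h3 : C * (2 * q) * s <= C * (2 * q) * t.
    by rewrite ler_wpM2l ?mulr_ge0//; case/andP: st.
  lra.
(* Up to [O(t |p' - p|^2)] the added term replaces, in the derivative, the velocity of the second
   characteristic by that of the first, where convexity in [p] is applied; at time [0] it turns
   [dot (p' - p) (X' 0)] into [dot (p' - p) (X 0)]. *)
pose F s := E s - dot (p' - p) (X' s - X s).
have F0 : F 0 <= dot (p' - p) (X 0).
  have -> : F 0 = dot (p' - p) (X 0) - K / 2 * dot (X' 0 - X 0) (X' 0 - X 0).
    rewrite /F /E (ch_a0 c) (ch_a0 c') (ch_P0 c) !dotBl !dotBr !dotZl.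
    by rewrite (dotC (X' 0) (X 0)); field.
  by rewrite gerBl mulr_ge0 ?divr_ge0// dot_ge0.
have Ft : F t = a' t - a t by rewrite /F /E xx' subrr !dot0r !subr0.
suff : F t - F 0 <= - (lam / 16 * q ^+ 2) * (t - 0) by rewrite Ft; lra.
have dF s : 0 <= s <= t -> der `[0, t] F s
    (dot (P' s - P s) (Hp (s, X' s, P' s)) + H (s, X s, P s) - H (s, X' s, P' s)
   + dot (Hx (s, X s, P s)) (X' s - X s) -
   dot (p' - p) (Hp (s, X' s, P' s) - Hp (s, X s, P s))).
  move=> st; have h := derB (dE st) (der_dot (der_cst `[0, t] (p' - p) s)
     (derB (ch_X c' st) (ch_X c st))).
  by apply: der_eqd h; rewrite dot0l add0r.
apply: (der_le t_ge0 dF) => s st.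
have Bs := ch_box c st; have Bs' := ch_box c' st.
have Bm : Hbox T r M y0 (s, X s, P' s) by case: Bs => ? ? ?; case: Bs' => ? ? ?; split.
set eps := C * t * (2 * q) in dXs.
have eps0 : 0 <= eps by rewrite mulr_ge0// mulr_ge0.
have cvx := Hb_convex HB Bs Bm.
have P00 : `|P' s - P' s| <= eps by rewrite subrr normr0.
have tay := Hb_taylor HB Bm Bs' (dXs s st) P00.
have {}tay : H (s, X s, P' s) + dot (Hx (s, X s, P' s)) (X' s - X s) - C * eps ^+ 2 <= H (s, X' s, P' s).
  move: tay; rewrite subrr dot0r subr0 ler_norml; lra.
have mz : `|(s, X s, P' s) - (s, X s, P s)| <= 2 * q.
  rewrite !prod_normE /= !subrr !normr0 !ge_max mulr_ge0//=.
  exact: le_trans (dP_le s) (sup s st).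
have [_ hx _] := Hb_lip HB Bs Bm mz.
have hxd : `|dot (Hx (s, X s, P' s) - Hx (s, X s, P s)) (X' s - X s)| <= n%:R * (C * (2 * q) * eps).
  by rewrite (le_trans (dot_le_norm _ _))// ler_wpM2l// ler_pM// dXs.
have [_ _ hp] := Hb_lip HB Bs Bs' (le_trans (zz_le s) (sup s st)).
have hpd : `|dot ((P' s - P s) - (p' - p)) (Hp (s, X' s, P' s) - Hp (s, X s, P s))|
    <= n%:R * (C * t * (1 + K) * (2 * q) * (C * (2 * q))).
  by rewrite (le_trans (dot_le_norm _ _))// ler_wpM2l// ler_pM// dPs.
have dPge : q / 2 <= `|P' s - P s|.
  have := ler_normB (P' s - P s) ((P' s - P s) - (p' - p)); rewrite subKr -/q.
  have := dPs s st; have := ler_wpM2r q0 Ct4; lra.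
have dP2 : q ^+ 2 / 4 <= dot (P' s - P s) (P' s - P s).
  apply: le_trans (sqr_norm_le_dot _).
  have -> : q ^+ 2 / 4 = (q / 2) ^+ 2 by field.
  by rewrite lerXn2r ?nnegrE ?divr_ge0.
have lam0 := Hb_lam HB.
have hlam : lam / 8 * q ^+ 2 <= lam / 2 * dot (P' s - P s) (P' s - P s).
  have := ler_wpM2l (ltW lam0) dP2; lra.
have hB : t * (4 * C ^+ 2 * (1 + n%:R + n%:R * (1 + K))) * q ^+ 2 <= lam / 16 * q ^+ 2.
  by rewrite ler_wpM2r// sqr_ge0.
have Ct1 : C * t <= 1 by lra.
have heps : C * eps ^+ 2 <= 4 * C ^+ 2 * t * q ^+ 2.
  have -> : C * eps ^+ 2 = (4 * C ^+ 2 * t * q ^+ 2) * (C * t) by rewrite /eps; ring.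
  by rewrite ler_piMr// !mulr_ge0// sqr_ge0.
have hsum : n%:R * (C * (2 * q) * eps) + n%:R * (C * t * (1 + K) * (2 * q) * (C * (2 * q)))
   + 4 * C ^+ 2 * t * q ^+ 2 = t * (4 * C ^+ 2 * (1 + n%:R + n%:R * (1 + K))) * q ^+ 2.
  by rewrite /eps; ring.
move: hxd hpd; rewrite !ler_norml => /andP[hx1 hx2] /andP[hp1 hp2].
set qq := dot (P' s - P s) (P' s - P s) in dP2 hlam cvx; clearbody qq.
move: hx1 hx2 hp1 hp2 cvx tay; rewrite !dotBl !dotBr.
rewrite (dotC (P' s) (Hp (s, X' s, P' s))) (dotC (P s) (Hp (s, X' s, P' s))).
rewrite (dotC (P' s) (Hp (s, X s, P s))) (dotC (P s) (Hp (s, X s, P s))).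
lra.
Qed.

End Pair.
End CharacteristicEstimates.

(** * The action as a function of end point and slope *)

Section GeneratingFunction.
Context {R : realType} {n : nat}.
Notation V := 'rV[R]_n.
Notation Z := (R * V * V)%type.

(** The second characteristic is cut at the earlier time [t], where the estimates at a fixed time
    apply, and then followed up to [t']; along it the action grows at the rate [P.H_p - H], which
    gives [D_t S = - H]. *)
Lemma char_time (T r M : R) (y0 : V) (H : Z -> R) (Hx Hp : Z -> V) (C lam K : R)
    (t t' : R) (p p' : V) (X P X' P' : R -> V) (a a' : R -> R) (d : R) :
  Hbounds T r M y0 H Hx Hp C lam -> 0 <= K ->
  ischar T r M y0 H Hx Hp K t p X P a -> ischar T r M y0 H Hx Hp K t' p' X' P' a' ->
  0 <= t -> t <= t' -> C * t' * (1 + K) <= 1 / 2 ->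
  t' - t <= d -> `|X' t' - X t| <= d ->
  `|P' t' - P t| <= (C + 4 * (1 + K) * C) * d + 2 * `|p' - p| /\
  (p = p' -> `|a' t' - a t - dot (P t) (X' t' - X t) + H (t, X t, P t) * (t' - t)|
    <= ((K * n%:R + (1 + n%:R)) * 4 * (1 + K) ^+ 2 * (2 * C) ^+ 2 +
        (n%:R + 1) * C * (3 * C + 4 * (1 + K) * C)) * d ^+ 2).
Proof.
move=> HB K0 c c' t0 tt' Ct' td Xd.
have C1 := Hb_C HB; have C0 : 0 <= C := le_trans ler01 C1.
have t'0 : 0 <= t' := le_trans t0 tt'.
have d0 : 0 <= d := le_trans (normr_ge0 _) Xd.
have K10 : 0 <= 1 + K by rewrite addr_ge0.
have Ct : C * t * (1 + K) <= 1 / 2.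
  by apply: le_trans Ct'; rewrite ler_wpM2r// ler_wpM2l.
have cr := char_restrict tt' c'.
have sp s : t <= s <= t' -> `|X' s - X' t| <= C * d /\ `|P' s - P' t| <= C * d.
  move=> /andP[ts st]; have [h1 h2] := char_speed HB c' t0 ts st.
  have : C * (s - t) <= C * d by rewrite ler_wpM2l//; lra.
  by split; lra.
have [spX spP] := sp t' (introT andP (conj tt' (lexx _))).
have Xt : `|X' t - X t| <= 2 * C * d.
  have := ler_normB (X' t' - X t) (X' t' - X' t).
  have -> : X' t' - X t - (X' t' - X' t) = X' t - X t.
    by apply/rowP => i; rewrite !mxE; ring.
  by have := ler_wpM2r d0 C1; move: spX Xd; clear; lra.
have sup := char_pair_sup HB K0 c cr t0 Ct.
have tt : 0 <= t <= t by rewrite t0 lexx.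
have Pt : `|P' t - P t| <= 4 * (1 + K) * C * d + 2 * `|p' - p|.
  have h : `|P' t - P t| <= `|(X' t - X t, P' t - P t)|.
    by rewrite prod_normE le_max lexx orbT.
  apply: (le_trans (le_trans h (sup t tt))).
  by have := ler_wpM2l K10 Xt; clear; lra.
split.
  rewrite -(subrK (P' t) (P' t')) -addrA (le_trans (ler_normD _ _))//.
  by move: spP Pt; clear; lra.
move=> pp'; move: Pt; rewrite pp' subrr normr0 mulr0 addr0 => Pt.
have act := char_pair_action HB K0 c cr t0 pp' Ct.
set c1 := (K * _ + _) * 4 * _ in act *.
have c10 : 0 <= c1 by rewrite !mulr_ge0// ?sqr_ge0// !addr_ge0// mulr_ge0.
have act2 : c1 * `|X' t - X t| ^+ 2 <= c1 * (2 * C) ^+ 2 * d ^+ 2.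
  by rewrite -mulrA -exprMn ler_wpM2l// lerXn2r ?nnegrE ?mulr_ge0.
(* [e] removes from the action its first order growth with momentum frozen at [P t]; its derivative
   is [O(d)], on an interval of length at most [d]. *)
pose e s := a' s - dot (P t) (X' s) + H (t, X t, P t) * s.
have de s : t <= s <= t' -> der `[t, t'] e s
   (dot (P' s) (Hp (s, X' s, P' s)) - H (s, X' s, P' s)
     - dot (P t) (Hp (s, X' s, P' s)) + H (t, X t, P t)).
  move=> /andP[ts st]; have s0t : 0 <= s <= t' by rewrite (le_trans t0).
  have sub : `[t, t'] `<=` `[0, t'].
    by move=> u /=; rewrite !in_itv /= => /andP[/(le_trans t0) -> ->].
  have h := der_sub sub (derD (derB (ch_a c' s0t) (der_dot (der_cst `[0, t'] (P t) s)
     (ch_X c' s0t))) (derM (der_cst `[0, t'] (H (t, X t, P t)) s) (der_id `[0, t'] s))).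
  by apply: der_eqd h; rewrite dot0l mul0r; ring.
set k := 4 * (1 + K) * C in Pt *.
have k0 : 0 <= k by rewrite !mulr_ge0.
have ee : `|e t' - e t| <= (n%:R + 1) * C * (3 * C + k) * d * (t' - t).
  apply: (der_abs tt' de) => s /andP[ts st].
  have [Xs Ps] := sp s (introT andP (conj ts st)).
  have s0t : 0 <= s <= t' by rewrite (le_trans t0).
  have PP : `|P' s - P t| <= (C + k) * d.
    rewrite -(subrK (P' t) (P' s)) -addrA (le_trans (ler_normD _ _))//.
    by move: Ps Pt; clear; lra.
  have XX : `|X' s - X t| <= 3 * C * d.
    rewrite -(subrK (X' t) (X' s)) -addrA (le_trans (ler_normD _ _))//.
    by move: Xs Xt; clear; lra.
  have Cd : d <= C * d by rewrite ler_peMl.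
  have kd : 0 <= k * d by rewrite mulr_ge0.
  have Cd0 : 0 <= C * d by rewrite mulr_ge0.
  have zz : `|(t, X t, P t) - (s, X' s, P' s)| <= (3 * C + k) * d.
    rewrite distrC !prod_normE /= !ge_max ger0_norm ?subr_ge0//.
    have e1 : (3 * C + k) * d = C * d + (C * d + (C * d + k * d)) by ring.
    rewrite e1 (le_trans (_ : s - t <= C * d)) ?lerDl ?addr_ge0//=; last first.
      by move: td Cd st ts; clear; lra.
    rewrite (le_trans XX)/=; last by move: kd; clear; lra.
    by rewrite (le_trans PP)//; move: Cd0; clear; lra.
  have Bt := ch_box c tt; have Bs := ch_box c' s0t.
  have [hH _ _] := Hb_lip HB Bs Bt zz.
  have [_ _ hp] := Hb_bdd HB Bs.
  have -> : dot (P' s) (Hp (s, X' s, P' s)) - H (s, X' s, P' s) -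
     dot (P t) (Hp (s, X' s, P' s)) + H (t, X t, P t) =
     dot (P' s - P t) (Hp (s, X' s, P' s)) + (H (t, X t, P t) - H (s, X' s, P' s)).
    by rewrite dotBl; ring.
  rewrite (le_trans (ler_normD _ _))//.
  have h2 : `|dot (P' s - P t) (Hp (s, X' s, P' s))| <= n%:R * ((3 * C + k) * d * C).
    rewrite (le_trans (dot_le_norm _ _))// ler_wpM2l// ler_pM//.
    by rewrite (le_trans PP)//; move: Cd0; clear; lra.
  by move: h2 hH; clear; lra.
have -> : a' t' - a t - dot (P t) (X' t' - X t) + H (t, X t, P t) * (t' - t) =
   (a' t - a t - dot (P t) (X' t - X t)) + (e t' - e t).
  by rewrite /e !dotBr; ring.
rewrite (le_trans (ler_normD _ _))// mulrDl lerD//; first exact: le_trans act2.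
apply: (le_trans ee); rewrite expr2 mulrA ler_wpM2l//.
by rewrite !mulr_ge0// ?addr_ge0// mulr_ge0.
Qed.

(* [S] is the action, [Q] its gradient in [x] (the final momentum) and [Y] a
   supergradient in [p] (the foot of the characteristic). *)
Record genfun (tau rho M0 K A mu : R) (y0 : V) (H : Z -> R)
    (S : R -> V -> V -> R) (Q Y : R -> V -> V -> V) : Prop := {
  gf_diff : forall t t' x x' p d, 0 <= t <= tau -> 0 <= t' <= tau ->
    `|x - y0| <= rho -> `|x' - y0| <= rho -> `|p| <= M0 ->
    `|t' - t| <= d -> `|x' - x| <= d ->
    `|S t' x' p - S t x p - dot (Q t x p) (x' - x) + H (t, x, Q t x p) * (t' - t)|
      <= A * d ^+ 2;
  gf_lip : forall t t' x x' p p' d, 0 <= t <= tau -> 0 <= t' <= tau ->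
    `|x - y0| <= rho -> `|x' - y0| <= rho -> `|p| <= M0 -> `|p'| <= M0 ->
    `|t' - t| <= d -> `|x' - x| <= d -> `|p' - p| <= d ->
    `|Q t' x' p' - Q t x p| <= A * d /\
    `|H (t', x', Q t' x' p') - H (t, x, Q t x p)| <= A * d;
  gf_concave : forall t x p p', 0 <= t <= tau -> `|x - y0| <= rho ->
    `|p| <= M0 -> `|p'| <= M0 ->
    S t x p' <= S t x p + dot (p' - p) (Y t x p) - mu * t * `|p' - p| ^+ 2;
  gf_init : forall x p, `|x - y0| <= rho -> `|p| <= M0 ->
    S 0 x p = dot p x - K / 2 * dot x x;
  gf_bdd : forall t x p, 0 <= t <= tau -> `|x - y0| <= rho -> `|p| <= M0 ->
    [/\ `|Q t x p| <= A, `|H (t, x, Q t x p)| <= A & `|Y t x p| <= A] }.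

(** One characteristic is chosen for each end point and slope; every property of [S] then results
    from comparing two characteristics. *)
Lemma genfun_exist (T r M M0 : R) (y0 : V) (H : Z -> R) (Hx Hp : Z -> V) (C lam K : R) :
  Hbounds T r M y0 H Hx Hp C lam -> 0 <= K -> 0 < T -> 0 < r ->
  M0 + K * (`|y0| + r) + 1 <= M ->
  exists tau A mu S Q Y, [/\ 0 < tau, tau <= T, 0 < A, 0 < mu &
    genfun tau (r / 2) M0 K A mu y0 H S Q Y].
Proof.
move=> HB K0 T0 r0 MM.
have C1 := Hb_C HB; have C0 : 0 < C := lt_le_trans ltr01 C1.
have lam0 := Hb_lam HB.
have K10 : 0 < 1 + K by rewrite ltr_pwDl.
pose B := 4 * C ^+ 2 * (1 + n%:R + n%:R * (1 + K)).
have B0 : 0 < B.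
  by rewrite !mulr_gt0// ?exprn_gt0// -addrA ltr_pwDl// addr_ge0// mulr_ge0// ltW.
(* The four bounds stand for the time range of [H], the contraction (with the [1 / 4] of the
   concavity estimate), the stay of [X] in the box, and the absorption of the errors in the
   concavity estimate. *)
pose tau := Num.min T (Num.min (1 / 4 / (C * (1 + K))) (Num.min (r / 2 / C) (lam / 16 / B))).
have tau0 : 0 < tau by rewrite !lt_min T0 !divr_gt0// mulr_gt0.
have tauT : tau <= T by rewrite ge_min lexx.
have tau1 : C * tau * (1 + K) <= 1 / 4.
  rewrite mulrAC mulrC -ler_pdivlMr ?mulr_gt0//.
  by rewrite 2!ge_min lexx orbT.
have tau2 : C * tau <= r / 2.
  by rewrite mulrC -ler_pdivlMr// 3!ge_min lexx !orbT.
have tau3 : tau * B <= lam / 16.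
  by rewrite -ler_pdivlMr// 3!ge_min lexx !orbT.
have small t : 0 <= t <= tau -> [/\ C * t * (1 + K) <= 1 / 4, C * t <= r / 2 & t * B <= lam / 16].
  move=> /andP[t0 tt]; split.
  - by apply: le_trans tau1; rewrite ler_wpM2r ?(ltW K10)// ler_wpM2l// ltW.
  - by apply: le_trans tau2; rewrite ler_wpM2l// ltW.
  - by apply: le_trans tau3; rewrite ler_wpM2r// ltW.
pose ch := ischar T r M y0 H Hx Hp K.
pose dom (w : Z) := [/\ 0 <= w.1.1 <= tau, `|w.1.2 - y0| <= r / 2 & `|w.2| <= M0].
have /choice[f fP] : forall w : Z, exists f : (R -> V) * (R -> V) * (R -> R),
    dom w -> ch w.1.1 w.2 f.1.1 f.1.2 f.2 /\ f.1.1 w.1.1 = w.1.2.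
  move=> [[t x] p]; have [[/= tt xr pM]|nd] := pselect (dom (t, x, p)); last first.
    by exists (fun=> 0, fun=> 0, fun=> 0).
  have [s1 s2 s3] := small t tt.
  have [||||||X [P [a [c Xx]]]] := @char_exist R n T r M y0 H Hx Hp C lam K HB K0 t x p.
  - by case/andP: tt => -> /le_trans; apply.
  - by [].
  - by lra.
  - by [].
  - by [].
  - by apply: le_trans MM; rewrite -!addrA lerD2r.
  - by exists (X, P, a).
have fP' t x p : 0 <= t <= tau -> `|x - y0| <= r / 2 -> `|p| <= M0 ->
    let g := f (t, x, p) in ch t p g.1.1 g.1.2 g.2 /\ g.1.1 t = x.
  by move=> tt xr pM; exact: (fP (t, x, p)).
pose S t x p := (f (t, x, p)).2 t.
pose Q t x p := (f (t, x, p)).1.2 t.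
pose Y t x p := (f (t, x, p)).1.1 0.
pose c4 := ((K * n%:R + (1 + n%:R)) * 4 * (1 + K) ^+ 2 * (2 * C) ^+ 2 +
        (n%:R + 1) * C * (3 * C + 4 * (1 + K) * C)).
pose c5 := C + 4 * (1 + K) * C + 2.
have c50 : 0 <= c5 by rewrite !addr_ge0// ?mulr_ge0// ltW.
have n0 : 0 <= n%:R :> R by [].
have c40 : 0 <= c4.
  have a1 : 0 <= K * n%:R + (1 + n%:R) by rewrite addr_ge0 ?mulr_ge0 ?addr_ge0.
  have a2 : 0 <= 3 * C + 4 * (1 + K) * C.
    by rewrite addr_ge0 ?mulr_ge0// ltW.
  have Cw := ltW C0.
  have b1 := mulr_ge0 (mulr_ge0 (mulr_ge0 a1 (ler0n R 4)) (sqr_ge0 (1 + K)))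
    (sqr_ge0 (2 * C)).
  have b2 := mulr_ge0 (mulr_ge0 (addr_ge0 n0 ler01) Cw) a2.
  exact: (addr_ge0 b1 b2).
have nc5 : 0 <= n%:R * c5 by rewrite mulr_ge0.
have cc5 : 0 <= C * (c5 + 1) := mulr_ge0 (ltW C0) (addr_ge0 c50 ler01).
pose A := c4 + (n%:R + 1) * c5 + C * (c5 + 1) + `|M| + `|y0| + r + 1 + C.
have [A0 A1 A2 A3] : [/\ 0 < A, c4 + n%:R * c5 + C * (c5 + 1) <= A,
    `|M| + C <= A & `|y0| + r <= A].
  have := normr_ge0 M; have := normr_ge0 y0.
  by move: c40 c50 nc5 cc5 C0 r0; rewrite /A; clearbody c4 c5; clear; split; lra.
have A4 : c5 <= A.
  have : c5 <= C * (c5 + 1).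
    by have := ler_wpM2r (addr_ge0 c50 ler01) C1; rewrite mul1r; clearbody c5; lra.
  by move: A1 c40 nc5; clearbody A c4 c5; clear; lra.
clearbody A.
have time t t' x x' p p' d : 0 <= t <= tau -> 0 <= t' <= tau -> t <= t' ->
    `|x - y0| <= r / 2 -> `|x' - y0| <= r / 2 -> `|p| <= M0 -> `|p'| <= M0 ->
    `|t' - t| <= d -> `|x' - x| <= d ->
    `|Q t' x' p' - Q t x p| <= (c5 - 2) * d + 2 * `|p' - p| /\
    (p = p' -> `|S t' x' p' - S t x p - dot (Q t x p) (x' - x) + H (t, x, Q t x p) * (t' - t)|
      <= c4 * d ^+ 2).
  move=> tt tt' t_t' xr xr' pM pM' td xd.
  have [c cx] := fP' t x p tt xr pM; have [c' cx'] := fP' t' x' p' tt' xr' pM'.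
  have [s1 _ _] := small t' tt'; have /andP[t0 _] := tt.
  have := char_time (d := d) HB K0 c c' t0 t_t'; rewrite cx cx'.
  move=> [|||h1 h2]; [by move: s1; clear; lra|exact: le_trans (ler_norm _) td|exact: xd|].
  by split=> //; rewrite /c5 addrK.
clearbody c4 c5.
have bdd t x p : 0 <= t <= tau -> `|x - y0| <= r / 2 -> `|p| <= M0 ->
    Hbox T r M y0 (t, x, Q t x p).
  move=> tt xr pM; have [c cx] := fP' t x p tt xr pM; have /andP[t0 _] := tt.
  by have := ch_box c (s := t); rewrite cx; apply; rewrite t0 lexx.
have lipQ t t' x x' p p' d : 0 <= t <= tau -> 0 <= t' <= tau ->
    `|x - y0| <= r / 2 -> `|x' - y0| <= r / 2 -> `|p| <= M0 -> `|p'| <= M0 ->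
    `|t' - t| <= d -> `|x' - x| <= d -> `|p' - p| <= d ->
    `|Q t' x' p' - Q t x p| <= c5 * d.
  move=> tt tt' xr xr' pM pM' td xd pd.
  have [t_t'|/ltW t't] := leP t t'.
    have [h _] := time _ _ _ _ _ _ _ tt tt' t_t' xr xr' pM pM' td xd.
    by move: h pd; clear; lra.
  rewrite distrC in td; rewrite distrC in xd; rewrite distrC in pd; rewrite distrC.
  have [h _] := time _ _ _ _ _ _ _ tt' tt t't xr' xr pM' pM td xd.
  by move: h pd; clear; lra.
have lipH t t' x x' p p' d : 0 <= t <= tau -> 0 <= t' <= tau ->
    `|x - y0| <= r / 2 -> `|x' - y0| <= r / 2 -> `|p| <= M0 -> `|p'| <= M0 ->
    `|t' - t| <= d -> `|x' - x| <= d -> `|p' - p| <= d ->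
    `|H (t', x', Q t' x' p') - H (t, x, Q t x p)| <= C * (c5 + 1) * d.
  move=> tt tt' xr xr' pM pM' td xd pd.
  have qd := lipQ _ _ _ _ _ _ _ tt tt' xr xr' pM pM' td xd pd.
  have d0 : 0 <= d := le_trans (normr_ge0 _) td.
  have c5d : 0 <= c5 * d by rewrite mulr_ge0.
  have [|h _ _] := Hb_lip HB (bdd t x p tt xr pM) (bdd t' x' p' tt' xr' pM') (d := (c5 + 1) * d).
    have e1 : (c5 + 1) * d = c5 * d + d by rewrite mulrDl mul1r.
    rewrite !prod_normE /= !ge_max e1 (le_trans td) ?lerDr// (le_trans xd) ?lerDr//=.
    by rewrite (le_trans qd)// lerDl.
  by rewrite -mulrA.
exists tau, A, (lam / 16), S, Q, Y; split => //; first by rewrite divr_gt0.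
split.
- move=> t t' x x' p d tt tt' xr xr' pM td xd.
  have d0 : 0 <= d := le_trans (normr_ge0 _) td.
  have d20 : 0 <= d ^+ 2 := sqr_ge0 d.
  have [t_t'|/ltW t't] := leP t t'.
    have [_ /(_ erefl) h] := time _ _ _ _ _ _ _ tt tt' t_t' xr xr' pM pM td xd.
    by apply: (le_trans h); rewrite ler_wpM2r//; move: A1 nc5 cc5; clear; lra.
  have pd : `|p - p| <= d by rewrite subrr normr0.
  have hQ := lipQ _ _ _ _ _ _ _ tt tt' xr xr' pM pM td xd pd.
  have hH := lipH _ _ _ _ _ _ _ tt tt' xr xr' pM pM td xd pd.
  have td' := td; have xd' := xd; rewrite distrC in td'; rewrite distrC in xd'.
  have [_ /(_ erefl) h] := time _ _ _ _ _ _ _ tt' tt t't xr' xr pM pM td' xd'.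
  have hQ2 : `|dot (Q t' x' p - Q t x p) (x' - x)| <= n%:R * (c5 * d * d).
    by rewrite (le_trans (dot_le_norm _ _))// ler_wpM2l// ler_pM.
  have hH2 : `|(H (t', x', Q t' x' p) - H (t, x, Q t x p)) * (t' - t)| <= C * (c5 + 1) * d * d.
    by rewrite normrM ler_pM.
  (* For [t' <= t] the expansion is made at the earlier point [(t', x')] and transferred to
     [(t, x)]; the Lipschitz bounds of [Q] and of [H] along [Q] make the change of base point
     quadratic. *)
  have -> : S t' x' p - S t x p - dot (Q t x p) (x' - x) + H (t, x, Q t x p) * (t' - t) =
    - (S t x p - S t' x' p - dot (Q t' x' p) (x - x') + H (t', x', Q t' x' p) * (t - t'))
    + dot (Q t' x' p - Q t x p) (x' - x)
    - (H (t', x', Q t' x' p) - H (t, x, Q t x p)) * (t' - t).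
    by rewrite !dotBr !dotBl; ring.
  rewrite (le_trans (ler_normB _ _))//.
  have h3 := ler_normD (- (S t x p - S t' x' p - dot (Q t' x' p) (x - x') +
    H (t', x', Q t' x' p) * (t - t'))) (dot (Q t' x' p - Q t x p) (x' - x)).
  rewrite normrN in h3.
  have hA : c4 * d ^+ 2 + n%:R * (c5 * d * d) + C * (c5 + 1) * d * d <= A * d ^+ 2.
    have -> : c4 * d ^+ 2 + n%:R * (c5 * d * d) + C * (c5 + 1) * d * d =
      (c4 + n%:R * c5 + C * (c5 + 1)) * d ^+ 2 by ring.
    by rewrite ler_wpM2r.
  by move: h h3 hQ2 hH2 hA; clear; lra.
- move=> t t' x x' p p' d tt tt' xr xr' pM pM' td xd pd.
  have d0 : 0 <= d := le_trans (normr_ge0 _) td.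
  split.
    apply: (le_trans (lipQ _ _ _ _ _ _ _ tt tt' xr xr' pM pM' td xd pd)).
    by rewrite ler_wpM2r.
  apply: (le_trans (lipH _ _ _ _ _ _ _ tt tt' xr xr' pM pM' td xd pd)).
  by rewrite ler_wpM2r//; move: A1 c40 nc5; clear; lra.
- move=> t x p p' tt xr pM pM'.
  have [c cx] := fP' t x p tt xr pM; have [c' cx'] := fP' t x p' tt xr pM'.
  have [s1 _ s3] := small t tt; have /andP[t0 _] := tt.
  by apply: (char_pair_concave HB K0 c c' t0) => //; rewrite cx cx'.
- move=> x p xr pM.
  have tt : (0 : R) <= 0 <= tau by rewrite lexx ltW.
  have [c cx] := fP' 0 x p tt xr pM.
  by rewrite /S (ch_a0 c) cx.
- move=> t x p tt xr pM.
  have bx := bdd t x p tt xr pM; have [hH _ _] := Hb_bdd HB bx.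
  have [_ _ /= qM] := bx; have [c cx] := fP' t x p tt xr pM.
  have /andP[t0 _] := tt.
  have [_ /= Yr _] := ch_box c (s := 0) (introT andP (conj (lexx _) t0)).
  have M1 := ler_norm M; have M3 := normr_ge0 M.
  have MA : M <= A by move: M1 A2 C0; clear; lra.
  have CA : C <= A by move: M3 A2; clear; lra.
  split; [exact: le_trans qM MA|exact: le_trans hH CA|].
  have := ler_normD (Y t x p - y0) y0; rewrite subrK -/(Y t x p) in Yr *.
  by move/le_trans; apply; rewrite (le_trans _ A3)// addrC lerD2l.
Qed.

End GeneratingFunction.

(** * The generalised Hopf formula *)

Section HopfFormula.
Context {R : realType} {n : nat}.
Notation V := 'rV[R]_n.
Notation Z := (R * V * V)%type.

Definition cyl (t0 t1 : R) (y0 : V) (rho : R) : set (R * V) :=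
  [set z | t0 <= z.1 <= t1 /\ `|z.2 - y0| <= rho].

Lemma cyl_compact t0 t1 y0 rho : compact (cyl t0 t1 y0 rho).
Proof.
have -> : cyl t0 t1 y0 rho = `[t0, t1] `*` [set x | `|x - y0| <= rho].
  by rewrite eqEsubset; split=> -[t x] /=; rewrite in_itv.
by apply: compact_setX; [exact: segment_compact|exact: box_compact].
Qed.

Lemma cyl_convex t0 t1 y0 rho z z' (q : R) : cyl t0 t1 y0 rho z ->
  cyl t0 t1 y0 rho z' -> 0 <= q <= 1 -> cyl t0 t1 y0 rho (z + q *: (z' - z)).
Proof.
move: z z' => [t x] [t' x'] [/= tT xr] [/= tT' xr'] q01; split => /=.
- by move: q01 tT tT' => /andP[q0 q1] /andP[t0' tT] /andP[t'0 tT'];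
    rewrite -[q *: _]/(q * (t' - t)); nra.
- exact: box_convex.
Qed.

Lemma linb_tx (c : R) (v : V) : linb (fun h : R * V => dot v h.2 - c * h.1).
Proof.
apply: linb_sub.
  exact: (linb_comp (linb_snd _ _) (dot_linbr v)).
exact: (linb_scale c (linb_fst _ _)).
Qed.

Lemma tx_bound (c : R) (v : V) (b d : R) (h : R * V) : `|c| <= b -> `|v| <= b ->
  `|h| <= d -> `|dot v h.2 - c * h.1| <= (n%:R + 1) * (b * d).
Proof.
move=> cb vb hd; have b0 := le_trans (normr_ge0 _) cb.
have h1 : `|h.1| <= d by apply: le_trans hd; rewrite prod_normE le_max lexx.
have h2 : `|h.2| <= d by apply: le_trans hd; rewrite prod_normE le_max lexx orbT.
rewrite (le_trans (ler_normB _ _))// mulrDl mul1r lerD//.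
  by rewrite (le_trans (dot_le_norm _ _))// ler_wpM2l// ler_pM.
by rewrite normrM ler_pM.
Qed.

(* For [k]-semiconvex data, [w (t, x) = max_p (S t x p - fstar p)] where
   [fstar] is the convex conjugate of [u0 + k |.|^2 / 2]. *)
Lemma hopf_solution (tau rho M0 K A mu : R) (y0 : V) (H : Z -> R)
    (S : R -> V -> V -> R) (Q Y : R -> V -> V -> V) (u0 : V -> R) :
  genfun tau rho M0 K A mu y0 H S Q Y -> 0 < tau -> 0 < rho -> 0 < A -> 0 < mu ->
  (forall x, `|x - y0| <= rho -> exists p, `|p| <= M0 /\
     forall y, `|y - y0| <= rho ->
       u0 x + K / 2 * dot x x + dot p (y - x) <= u0 y + K / 2 * dot y y) ->
  exists (w : R * V -> R) (q : R * V -> V),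
  [/\ forall x, `|x - y0| <= rho -> w (0, x) = u0 x,
      exists L, forall z z', cyl 0 tau y0 rho z -> cyl 0 tau y0 rho z' ->
        `|w z' - w z| <= L * `|z' - z|,
      forall z, cyl 0 tau y0 rho z -> `|q z| <= A &
      forall t0, 0 < t0 -> exists L, forall z z',
        cyl t0 tau y0 rho z -> cyl t0 tau y0 rho z' ->
        [/\ `|q z' - q z| <= L * `|z' - z|,
            `|H (z'.1, z'.2, q z') - H (z.1, z.2, q z)| <= L * `|z' - z| &
            `|w z' - w z - (dot (q z) (z' - z).2 - H (z.1, z.2, q z) * (z' - z).1)|
              <= L * `|z' - z| ^+ 2]].
Proof.
move=> gf tau0 rho0 A0 mu0 supp.
pose f y := u0 y + K / 2 * dot y y.
have y0r : `|y0 - y0| <= rho by rewrite subrr normr0 ltW.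
have [p0 [p0M p0P]] := supp y0 y0r.
have M00 : 0 <= M0 := le_trans (normr_ge0 _) p0M.
have y_bd y : `|y - y0| <= rho -> `|y| <= `|y0| + rho.
  by move=> yr; have := ler_normD (y - y0) y0; rewrite subrK; lra.
(* The conjugate is taken over the closed sup norm ball only, where supports are available; it is
   finite because [p0] supports [f] at [y0]. *)
pose Sf p := [set dot p y - f y | y in [set y | `|y - y0| <= rho]].
have Sf0 p : Sf p !=set0 by exists (dot p y0 - f y0); exists y0.
have fbelow y : `|y - y0| <= rho -> f y0 - n%:R * (M0 * rho) <= f y.
  move=> yr; have := p0P y yr; rewrite -/(f y0) -/(f y).
  have := dot_le_norm p0 (y - y0).
  have : n%:R * (`|p0| * `|y - y0|) <= n%:R * (M0 * rho) by rewrite ler_wpM2l// ler_pM.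
  by move=> h1 h2; have := le_trans h2 h1; rewrite ler_norml; lra.
have Sfub p : ubound (Sf p) (n%:R * (`|p| * (`|y0| + rho)) - (f y0 - n%:R * (M0 * rho))).
  move=> _ [y yr <-]; have := fbelow y yr; have := dot_le_norm p y.
  have : n%:R * (`|p| * `|y|) <= n%:R * (`|p| * (`|y0| + rho)).
    by rewrite ler_wpM2l// ler_wpM2l// y_bd.
  by move=> h1 h2; have := le_trans (ler_norm _) (le_trans h2 h1); lra.
pose fs p := sup (Sf p).
have fs1 p y : `|y - y0| <= rho -> dot p y - f y <= fs p.
  by move=> yr; apply: ub_le_sup; [eexists; exact: Sfub|exists y].
have fs_le p c : (forall y, `|y - y0| <= rho -> dot p y - f y <= c) -> fs p <= c.
  by move=> h; apply: ge_sup => // _ [y yr <-]; exact: h.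
have fsmid p p' : fs (2^-1 *: (p + p')) <= (fs p + fs p') / 2.
  apply: fs_le => y yr; rewrite dotZl dotDl.
  by have := fs1 p y yr; have := fs1 p' y yr; lra.
have fslip p p' : fs p' <= fs p + n%:R * (`|y0| + rho) * `|p' - p|.
  apply: fs_le => y yr; have := fs1 p y yr.
  have : dot (p' - p) y <= n%:R * (`|y0| + rho) * `|p' - p|.
    rewrite (le_trans (ler_norm _))// (le_trans (dot_le_norm _ _))//.
    by rewrite -mulrA ler_wpM2l// mulrC ler_wpM2r// y_bd.
  by rewrite dotBl; lra.
have Slip t x p p' : 0 <= t <= tau -> `|x - y0| <= rho -> `|p| <= M0 -> `|p'| <= M0 ->
    S t x p' - S t x p <= n%:R * A * `|p' - p|.
  move=> tt xr pM pM'; have := gf_concave gf tt xr pM pM'.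
  have [_ _ YA] := gf_bdd gf tt xr pM.
  have : 0 <= mu * t * `|p' - p| ^+ 2.
    by rewrite !mulr_ge0 ?sqr_ge0// ?(ltW mu0)//; case/andP: tt.
  have : dot (p' - p) (Y t x p) <= n%:R * A * `|p' - p|.
    rewrite (le_trans (ler_norm _))// (le_trans (dot_le_norm _ _))//.
    by rewrite -mulrA ler_wpM2l// mulrC ler_wpM2r.
  lra.
pose B := [set p : V | `|p - 0| <= M0].
have cB : compact B := @box_compact R n 0 M0.
have BE p : B p = (`|p| <= M0) :> Prop by rewrite /B /= subr0.
(* Slopes range over a compact ball; its radius [M0] also bounds the supporting slopes of [f], so
   that at time [0] the formula still returns [u0]. *)
have /choice[ph phP] : forall z : R * V, exists p, cyl 0 tau y0 rho z ->
    `|p| <= M0 /\ forall p', `|p'| <= M0 ->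
      S z.1 z.2 p' - fs p' <= S z.1 z.2 p - fs p.
  move=> z; have [[tt xr]|nz] := pselect (cyl 0 tau y0 rho z); last by exists 0.
  have [|||p] := @compact_max R V B (fun p => S z.1 z.2 p - fs p) 0.
  - by rewrite BE normr0.
  - exact: cB.
  - move=> p; rewrite BE => pM.
    apply: (contw_lip (C := n%:R * A + n%:R * (`|y0| + rho))) => p'; rewrite BE => pM'.
    have h1 := Slip _ _ _ _ tt xr pM pM'; have h2 := Slip _ _ _ _ tt xr pM' pM.
    have h3 := fslip p p'; have h4 := fslip p' p.
    rewrite (distrC p p') in h2 h4; rewrite ler_norml.
    by move: h1 h2 h3 h4; clear; lra.
  - by rewrite BE => pM pP; exists p => _; split=> // p' p'M; apply: pP; rewrite BE.
pose g z p := S z.1 z.2 p - fs p.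
pose w z := g z (ph z).
pose q z := Q z.1 z.2 (ph z).
have phM z : cyl 0 tau y0 rho z -> `|ph z| <= M0 by move=> /phP[].
have wmax z p : cyl 0 tau y0 rho z -> `|p| <= M0 -> g z p <= w z.
  by move=> /phP[_ h] /h.
(* [p] and the maximiser are compared with their midpoint: the supergradient terms cancel, [fsmid]
   handles the conjugate, and the concavity modulus leaves a quadratic loss proportional to time. *)
have wstrong z p : cyl 0 tau y0 rho z -> `|p| <= M0 ->
    g z p <= w z - mu * z.1 / 2 * `|p - ph z| ^+ 2.
  move=> zc pM; have [tt xr] := zc; have phz := phM z zc.
  pose m := 2^-1 *: (p + ph z).
  have mM : `|m| <= M0.
    rewrite normrZ ger0_norm ?invr_ge0//.
    by have := ler_normD p (ph z); move: pM phz; clear; lra.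
  have h1 := gf_concave gf tt xr mM pM; have h2 := gf_concave gf tt xr mM phz.
  have e1 : p - m = 2^-1 *: (p - ph z) by apply/rowP => i; rewrite !mxE; field.
  have e2 : ph z - m = - (2^-1 *: (p - ph z)) by apply/rowP => i; rewrite !mxE; field.
  have h3 := wmax z m zc mM; have h4 := fsmid p (ph z).
  move: h1 h2; rewrite e1 e2 dotNl normrN normrZ ger0_norm ?invr_ge0// exprMn.
  by move: h3; rewrite /w /g -/m in h4 *; move: h4; clear; lra.
have diffS t x p : 0 <= t <= tau -> `|x - y0| <= rho -> `|p| <= M0 ->
   diffw (cyl 0 tau y0 rho) (fun z => S z.1 z.2 p) (t, x)
     (fun h => dot (Q t x p) h.2 - H (t, x, Q t x p) * h.1).
  move=> tt xr pM e e0; exists (e / A); first by rewrite divr_gt0.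
  move=> [t' x'] yd [/= tt' xr'].
  have d1 : `|t' - t| <= `|(t', x') - (t, x)| by rewrite prod_normE le_max lexx.
  have d2 : `|x' - x| <= `|(t', x') - (t, x)| by rewrite prod_normE le_max lexx orbT.
  have := gf_diff gf tt tt' xr xr' pM d1 d2; set d := `|_ - (t, x)| in yd *.
  have -> : S t' x' p - S t x p - dot (Q t x p) (x' - x) + H (t, x, Q t x p) * (t' - t) =
    S t' x' p - S t x p - (dot (Q t x p) (x' - x) - H (t, x, Q t x p) * (t' - t)) by ring.
  have d0 : 0 <= d := normr_ge0 _.
  move/le_trans; apply; rewrite expr2 mulrA ler_wpM2r//.
  by rewrite mulrC -ler_pdivlMr// ltW.
(* The gradient of [S] in [(t, x)] is Lipschitz in [p], so the increment of [S] in [p] is Lipschitz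
   in [(t, x)], with constant [O(|p' - p|)]. *)
have mixed z z' p p' : cyl 0 tau y0 rho z -> cyl 0 tau y0 rho z' ->
    `|p| <= M0 -> `|p'| <= M0 ->
    `|(S z'.1 z'.2 p' - S z'.1 z'.2 p) - (S z.1 z.2 p' - S z.1 z.2 p)| <=
      (n%:R + 1) * (A * `|p' - p| * `|z' - z|).
  move=> zc zc' pM pM'.
  apply: (@seg_abs _ _ (cyl 0 tau y0 rho) (fun z => S z.1 z.2 p' - S z.1 z.2 p)
    (fun y h => (dot (Q y.1 y.2 p') h.2 - H (y.1, y.2, Q y.1 y.2 p') * h.1) -
                (dot (Q y.1 y.2 p) h.2 - H (y.1, y.2, Q y.1 y.2 p) * h.1))) => s s01.
    exact: cyl_convex.
  have := cyl_convex zc zc' s01; move: (z + _) => [t x] [/= tt xr]; split.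
  - by apply: linb_sub; exact: linb_tx.
  - by apply: diffwB; exact: diffS.
  - have z0 : `|t - t| <= `|p' - p| by rewrite subrr normr0.
    have z1 : `|x - x| <= `|p' - p| by rewrite subrr normr0.
    have [h1 h2] := gf_lip gf tt tt xr xr pM pM' z0 z1 (lexx _).
    have -> : forall a b c d e : R, a - b * e - (c - d * e) = (a - c) - (b - d) * e.
      by move=> *; ring.
    by rewrite -dotBl; exact: (tx_bound (h := z' - z) h2 h1 (lexx _)).
exists w, q; split.
- move=> x xr; have tt0 : (0 : R) <= 0 <= tau by rewrite lexx ltW.
  have zc : cyl 0 tau y0 rho (0, x) by [].
  apply/eqP; rewrite eq_le; apply/andP; split.
    rewrite /w /g /= gf.(gf_init)// ?phM//.
    by have := fs1 (ph (0, x)) x xr; rewrite /f; clear; lra.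
  have [p [pM pP]] := supp x xr.
  have := wmax (0, x) p zc pM; rewrite /g /= gf.(gf_init)//.
  have : fs p <= dot p x - f x.
    by apply: fs_le => y yr; have := pP y yr; rewrite dotBr /f; clear; lra.
  by rewrite /f; clear; lra.
(* Down to [t = 0], [w] is Lipschitz as a maximum of uniformly Lipschitz functions, whatever the
   maximiser does; [tau + 2 * rho] bounds the diameter and makes the quadratic remainder linear. *)
- exists ((n%:R + 1) * A + A * (tau + 2 * rho)).
  have half z z' : cyl 0 tau y0 rho z -> cyl 0 tau y0 rho z' ->
      w z' - w z <= ((n%:R + 1) * A + A * (tau + 2 * rho)) * `|z' - z|.
    move=> zc zc'; have [tt xr] := zc; have [tt' xr'] := zc'.
    have phM' := phM z' zc'; have := wmax z (ph z') zc phM'.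
    have d1 : `|z'.1 - z.1| <= `|z' - z| by rewrite [leRHS]prod_normE le_max lexx.
    have d2 : `|z'.2 - z.2| <= `|z' - z| by rewrite [leRHS]prod_normE le_max lexx orbT.
    have := gf_diff gf tt tt' xr xr' phM' d1 d2.
    have [h1 h2 _] := gf_bdd gf tt xr phM'.
    have := tx_bound h2 h1 (lexx `|z' - z|).
    have dd : `|z' - z| <= tau + 2 * rho.
      rewrite [leLHS]prod_normE ge_max; apply/andP; split.
        rewrite /= ler_norml; move: tt tt' rho0 => /andP[+ +] /andP[].
        by clear; lra.
      have -> : (z' - z).2 = (z'.2 - y0) - (z.2 - y0) by rewrite /= opprB addrA subrK.
      by rewrite (le_trans (ler_normB _ _))//; move: xr xr' tau0; clear; lra.
    have := ler_wpM2l (ltW A0) (ler_wpM2r (normr_ge0 (z' - z)) dd).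
    by rewrite /w /g /= !ler_norml expr2; clear; lra.
  move=> z z' zc zc'; rewrite ler_norml half// andbT.
  by have := half z' z zc' zc; rewrite (distrC z z'); clear; lra.
- by move=> z zc; have [tt xr] := zc; have [] := gf_bdd gf tt xr (phM z zc).
- move=> t0 t00.
  have sub z : cyl t0 tau y0 rho z -> cyl 0 tau y0 rho z.
    by move=> [/andP[t0z zt] xr]; split=> //; rewrite zt (le_trans (ltW t00)).
  pose Lp := (n%:R + 1) * A / (mu * t0) + 1.
  have Lp0 : 0 <= (n%:R + 1) * A / (mu * t0).
    by rewrite divr_ge0// ?mulr_ge0// ?addr_ge0// ltW.
  (* The quadratic losses at [z] and at [z'], added and compared with the mixed difference, give
     [mu t0 D^2 <= const D |z' - z|] for the distance [D] of the maximisers; the resulting constant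
     blows up like [1 / t0]. *)
  have plip z z' : cyl t0 tau y0 rho z -> cyl t0 tau y0 rho z' ->
      `|ph z' - ph z| <= Lp * `|z' - z|.
    move=> zc zc'; have sz := sub z zc; have sz' := sub z' zc'.
    have pM := phM z sz; have pM' := phM z' sz'.
    have h1 := wstrong z _ sz pM'; have h2 := wstrong z' _ sz' pM.
    have h3 := mixed z z' _ _ sz sz' pM pM'.
    rewrite (distrC (ph z)) in h2; set D := `|ph z' - ph z| in h1 h2 h3 *.
    have D0 : 0 <= D := normr_ge0 _.
    have hh : mu * t0 * D ^+ 2 <= (n%:R + 1) * (A * D * `|z' - z|).
      have m1 : mu * t0 * D ^+ 2 <= mu * z.1 * D ^+ 2.
        rewrite ler_wpM2r ?sqr_ge0// ler_wpM2l// ?(ltW mu0)//.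
        by have [/andP[]] := zc.
      have m2 : mu * t0 * D ^+ 2 <= mu * z'.1 * D ^+ 2.
        rewrite ler_wpM2r ?sqr_ge0// ler_wpM2l// ?(ltW mu0)//.
        by have [/andP[]] := zc'.
      move: h1 h2 h3; rewrite /w /g ler_norml => h1 h2 /andP[h3 h4].
      by move: h1 h2 h4 m1 m2; clear; lra.
    have [->|Dn0] := eqVneq D 0.
      by rewrite mulr_ge0// addr_ge0.
    have Dp : 0 < D by rewrite lt_neqAle eq_sym Dn0.
    have mt : 0 < mu * t0 by rewrite mulr_gt0.
    have : D <= (n%:R + 1) * A / (mu * t0) * `|z' - z|.
      rewrite mulrAC ler_pdivlMr// -(ler_pM2r Dp).
      have -> : D * (mu * t0) * D = mu * t0 * D ^+ 2 by ring.
      by apply: (le_trans hh); rewrite le_eqVlt; apply/orP; left; apply/eqP; ring.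
    by move/le_trans; apply; rewrite ler_wpM2r// lerDl.
  have Lp1 : 1 <= Lp by rewrite lerDr.
  have d1 (z z' : R * V) : `|z'.1 - z.1| <= `|z' - z| by rewrite [leRHS]prod_normE le_max lexx.
  have d2 (z z' : R * V) : `|z'.2 - z.2| <= `|z' - z| by rewrite [leRHS]prod_normE le_max lexx orbT.
  have up (z z' : R * V) : `|z' - z| <= Lp * `|z' - z| by rewrite ler_peMl.
  have QH z z' : cyl t0 tau y0 rho z -> cyl t0 tau y0 rho z' ->
      `|q z' - q z| <= A * (Lp * `|z' - z|) /\
      `|H (z'.1, z'.2, q z') - H (z.1, z.2, q z)| <= A * (Lp * `|z' - z|).
    move=> zc zc'; have sz := sub z zc; have sz' := sub z' zc'.
    have [tt xr] := sz; have [tt' xr'] := sz'.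
    by apply: (gf_lip gf tt tt' xr xr' (phM _ sz) (phM _ sz')
      (le_trans (d1 _ _) (up _ _)) (le_trans (d2 _ _) (up _ _)) (plip _ _ zc zc')).
  exists (A * Lp + (n%:R + 1) * (A * Lp) + A) => z z' zc zc'.
  have [q1 q2] := QH z z' zc zc'.
  have sz := sub z zc; have sz' := sub z' zc'.
  have [tt xr] := sz; have [tt' xr'] := sz'.
  set d := `|z' - z| in q1 q2 *.
  have d0 : 0 <= d := normr_ge0 _.
  have n10 : 0 <= (n%:R + 1) * (A * Lp) by rewrite !mulr_ge0// ?addr_ge0// ltW.
  have nd : 0 <= (n%:R + 1) * (A * Lp) * d by rewrite mulr_ge0.
  have Ad : 0 <= A * d by rewrite mulr_ge0// ltW.
  have ALd' : A * (Lp * d) <= (A * Lp + (n%:R + 1) * (A * Lp) + A) * d.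
    by move: nd Ad; clear; lra.
  split; [exact: le_trans q1 ALd'|exact: le_trans q2 ALd'|].
  have pM := phM z sz; have pM' := phM z' sz'.
  (* Envelope argument: the maximiser at [z] used at [z'] bounds the increment of [w] from below,
     the maximiser at [z'] used at [z] bounds it from above, and the two bounds differ by a
     quadratic term. *)
  have k1 := wmax z' (ph z) sz' pM; have k2 := wmax z (ph z') sz pM'.
  have g1 := gf_diff gf tt tt' xr xr' pM (d1 z z') (d2 z z').
  have d1' := d1 z z'; have d2' := d2 z z'; rewrite distrC in d1'; rewrite distrC in d2'.
  have g2 := gf_diff gf tt' tt xr' xr pM' d1' d2'.
  have tb := tx_bound q2 q1 (lexx d).
  move: g1 g2 tb k1 k2; rewrite /w /g -/(q z) -/(q z') /= !dotBl !dotBr.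
  rewrite -/d !ler_norml.
  have e : (A * Lp + (n%:R + 1) * (A * Lp) + A) * d ^+ 2 =
    A * Lp * d ^+ 2 + (n%:R + 1) * (A * (Lp * d) * d) + A * d ^+ 2 by ring.
  have ALd : 0 <= A * Lp * d ^+ 2.
    by rewrite mulr_ge0 ?sqr_ge0// mulr_ge0// ?(ltW A0)// (le_trans ler01).
  by rewrite e; move: ALd; clear; lra.
Qed.

End HopfFormula.

(** * From proximal subgradients to supporting slopes *)

Section SemiconvexSupport.
Context {R : realType} {n : nat}.
Notation V := 'rV[R]_n.

Lemma dot_delta (p : V) i : dot p (delta_mx 0 i) = p 0 i.
Proof.
rewrite /dot (bigD1 i)//= mxE !eqxx mulr1 big1 ?addr0// => j ji.
by rewrite mxE (negbTE ji) andbF mulr0.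
Qed.

Lemma norm_delta_le (i : 'I_n) : `|delta_mx 0 i : V| <= 1.
Proof.
apply: norm_le_coord => // j; rewrite mxE.
by case: (_ && _); rewrite ?normr1 ?normr0.
Qed.

(** The test point is a small step along the [i]-th axis, in the direction of the sign of [p 0 i];
    the step has length at most [1], so the quadratic term costs at most [K] times that length. The
    bound does not depend on the neighbourhood in the proximal inequality, hence is uniform in
    [x]. *)
Lemma proximal_slope_bound (u0 : V -> R) (K L : R) (x p : V) (r : R) : 0 <= K -> 0 < r ->
  (forall y, `|y - x| < r -> u0 y - u0 x <= L * `|y - x|) -> 0 <= L ->
  proximal_subgradient K u0 x p -> `|p| <= L + K.
Proof.
move=> K0 r0 uL L0 /near_iff[d d0 dP]; apply: norm_le_coord => [|i].
  by rewrite addr_ge0.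
pose e := Num.min 1 (Num.min d r / 2).
have e0 : 0 < e by rewrite lt_min ltr01 divr_gt0// lt_min d0.
have e1 : e <= 1 by rewrite ge_min lexx.
have edr : e < Num.min d r.
  have : e <= Num.min d r / 2 by rewrite ge_min lexx orbT.
  have : 0 < Num.min d r by rewrite lt_min d0.
  lra.
move: edr; rewrite lt_min => /andP[ed er].
pose v : V := (e * Num.sg (p 0 i)) *: delta_mx 0 i.
have sg1 : `|Num.sg (p 0 i)| <= 1 by rewrite normr_sg lern1 leq_b1.
have ve : `|v| <= e.
  rewrite normrZ normrM (ger0_norm (ltW e0)) -mulrA ler_piMr ?(ltW e0)//.
  by rewrite mulr_ile1// norm_delta_le.
have h1 := dP (x + v); rewrite [x + v]addrC addrK in h1.
have {}h1 := h1 (le_lt_trans ve ed).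
have h2 := uL (v + x); rewrite addrK in h2; have {}h2 := h2 (le_lt_trans ve er).
have pv : dot p v = e * `|p 0 i|.
  by rewrite dotZr dot_delta -mulrA -normrEsg.
have vv : dot v v <= e ^+ 2.
  rewrite dotZr dotZl dot_delta mxE !eqxx mulr1 -expr2 exprMn ler_piMr ?sqr_ge0//.
  by rewrite -real_normK ?num_real// exprn_ile1.
rewrite enorm_sqr pv in h1.
have h3 : L * `|v| <= L * e by rewrite ler_wpM2l.
have h4 : K / 2 * dot v v <= K / 2 * e ^+ 2 by rewrite ler_wpM2l// divr_ge0.
have h5 : K * e ^+ 2 <= K * e by rewrite expr2 ler_wpM2l// ler_piMl// ltW.
have h6 : 0 <= K * e by rewrite mulr_ge0// ltW.
rewrite -(ler_pM2l e0); lra.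
Qed.

(** Chord argument: if the support failed at [y], then [f] minus its chord would have a positive
    maximum inside the segment from [x] to [y], and the strict local support at that point excludes
    a maximum. The neighbourhoods of the local supports may shrink from point to point. *)
Lemma strict_local_support_global (f : V -> R) (y0 : V) (rho : R) :
  (forall x, `|x - y0| <= rho -> contw [set x | `|x - y0| <= rho] f x) ->
  (forall x, `|x - y0| <= rho -> exists q, exists2 d, 0 < d & forall y, `|y - x| < d ->
      f x + dot q (y - x) + dot (y - x) (y - x) / 2 <= f y) ->
  forall x q d, `|x - y0| <= rho -> 0 < d -> (forall y, `|y - x| < d ->
      f x + dot q (y - x) + dot (y - x) (y - x) / 2 <= f y) ->
  forall y, `|y - y0| <= rho -> f x + dot q (y - x) <= f y.
Proof.
move=> fc supp x q d xr d0 dP y yr.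
have [->|yx] := eqVneq y x; first by rewrite subrr dot0r addr0.
rewrite leNgt; apply/negP => neg.
pose h := y - x; pose c s := x + s *: h.
have h0 : 0 < `|h| by rewrite normr_gt0 subr_eq0.
have hh : 0 < dot h h.
  by apply: lt_le_trans (sqr_norm_le_dot h); rewrite exprn_gt0.
(* [m] is [f y - f x], so that [psi] is [f] along the segment minus the chord and vanishes at both
   ends. *)
pose m := dot q h + (f y - f x - dot q h).
pose psi s := f (c s) - f x - s * m.
have c0 : c 0 = x by rewrite /c scale0r addr0.
have c1 : c 1 = y by rewrite /c scale1r /h addrC subrK.
have cc s s' : c s' - c s = (s' - s) *: h.
  by rewrite /c scalerBl opprD addrACA subrr add0r.
have cr s : 0 <= s <= 1 -> `|c s - y0| <= rho by move=> s01; exact: box_convex.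
have psi0 : psi 0 = 0 by rewrite /psi c0; lra.
have psi1 : psi 1 = 0 by rewrite /psi c1 /m; lra.
have ext s : exists q, exists2 d, 0 < d & forall s', `|s' - s| < d -> 0 <= s <= 1 ->
    f (c s) + (s' - s) * dot q h + (s' - s) ^+ 2 * dot h h / 2 <= f (c s').
  have [s01|s01] := boolP (0 <= s <= 1); last by exists 0, 1.
  have [q' [d' d'0 d'P]] := supp _ (cr s s01); exists q', (d' / `|h|).
    by rewrite divr_gt0.
  move=> s'; rewrite ltr_pdivlMr// -normrZ -cc => /d'P + _.
  by rewrite cc !dotZr dotZl expr2 !mulrA.
have [||s0 s01 s0P] := @compact_max R R `[0, 1] psi 0 _ (@segment_compact _ 0 1).
- by rewrite /= in_itv /= lexx ler01.
- move=> s /=; rewrite in_itv /= => s01; apply: contwD; last first.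
    apply/contwN/contwM; last exact: contw_cst.
    exact/contw_linb/linb_id.
  apply: contwD; last exact: contw_cst.
  apply: (contw_comp (E := [set x | `|x - y0| <= rho])).
  + by move=> s' /=; rewrite in_itv /=; exact: cr.
  + apply: contwD; first exact: contw_cst.
    exact/contw_linb/linb_line.
  + exact/fc/cr.
have {}s0P s : 0 <= s <= 1 -> psi s <= psi s0.
  by move=> s01'; apply: s0P; rewrite /= in_itv.
move: s01; rewrite /= in_itv /= => s01.
have pos : 0 < psi s0.
  pose e := Num.min 1 (d / `|h| / 2).
  have e0 : 0 < e by rewrite lt_min ltr01 !divr_gt0.
  have e1 : e <= 1 by rewrite ge_min lexx.
  have ed : e * `|h| < d.
    have : e <= d / `|h| / 2 by rewrite ge_min lexx orbT.
    have : d / `|h| / 2 < d / `|h| by rewrite ltr_pdivrMr// ltr_pMr ?divr_gt0// ltr1n.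
    by move=> a b; rewrite -ltr_pdivlMr//; exact: le_lt_trans a.
  have e01 : 0 <= e <= 1 by rewrite e1 ltW.
  apply: lt_le_trans (s0P e e01); rewrite /psi.
  have ce : c e - x = e *: h by rewrite /c addrAC subrr add0r.
  have := dP (c e); rewrite ce normrZ gtr0_norm// => /(_ ed).
  rewrite !dotZr dotZl.
  have e2 : 0 <= e * (e * dot h h) by rewrite !mulr_ge0// ltW.
  have : e * (f x + dot q h - f y) > 0 by rewrite mulr_gt0// subr_gt0.
  by rewrite /m; move: e2; clear; lra.
have s0n0 : s0 != 0 by apply: contraTneq pos => ->; rewrite psi0 ltxx.
have s0n1 : s0 != 1 by apply: contraTneq pos => ->; rewrite psi1 ltxx.
have /andP[s0_ge s0_le] := s01.
have s0_gt : 0 < s0 by rewrite lt_neqAle eq_sym s0n0.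
have s0_lt : s0 < 1 by rewrite lt_neqAle s0n1.
have [q' [r r0 rP]] := ext s0.
pose e := Num.min r (Num.min s0 (1 - s0)) / 2.
have mm : 0 < Num.min r (Num.min s0 (1 - s0)) by rewrite !lt_min r0 s0_gt subr_gt0.
have e0 : 0 < e by rewrite divr_gt0.
have : e < Num.min r (Num.min s0 (1 - s0)) by rewrite /e; move: mm; clear; lra.
rewrite !lt_min => /and3P[er es e1s].
have e2 : 0 < e ^+ 2 * dot h h by rewrite mulr_gt0// exprn_gt0.
(* One moves from [s0] in the direction in which the supporting line minus the chord does not
   decrease; the quadratic term then pushes [psi] above its maximum. *)
have [mpos|mneg] := leP 0 (dot q' h - m).
  have := rP (s0 + e); rewrite addrAC subrr add0r gtr0_norm// => /(_ er s01).
  have G : psi (s0 + e) <= psi s0.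
    by apply: s0P; move: s0_gt e0 es e1s; clear; lra.
  by move: G; rewrite /psi; nra.
have := rP (s0 - e); rewrite addrAC subrr add0r normrN gtr0_norm// => /(_ er s01).
have G : psi (s0 - e) <= psi s0.
  by apply: s0P; move: s01 e0 es e1s; clear; lra.
by move: G; rewrite /psi sqrrN; nra.
Qed.

(** The origin of [K + 1]: adding [(K + 1) / 2 |x|^2] turns a proximal inequality at [x] into a
    local support with [|y - x|^2 / 2] to spare, and shifts the slope by [(K + 1) x]. *)
Lemma semiconvex_support (u0 : V -> R) (K L rho r0 : R) (y0 : V) :
  0 <= K -> 0 <= L -> 0 < rho -> rho < r0 ->
  (forall y, `|y - y0| < r0 -> exists p, proximal_subgradient K u0 y p) ->
  (forall x y, `|x - y0| < r0 -> `|y - y0| < r0 -> `|u0 y - u0 x| <= L * `|y - x|) ->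
  forall x, `|x - y0| <= rho -> exists p, `|p| <= L + K + (K + 1) * (`|y0| + rho) /\
    forall y, `|y - y0| <= rho ->
      u0 x + (K + 1) / 2 * dot x x + dot p (y - x) <= u0 y + (K + 1) / 2 * dot y y.
Proof.
move=> K0 L0 rho0 rr0 prox lip.
pose f y := u0 y + (K + 1) / 2 * dot y y.
have in_r0 x : `|x - y0| <= rho -> `|x - y0| < r0 by move=> /le_lt_trans; apply.
have fc x : `|x - y0| <= rho -> contw [set x | `|x - y0| <= rho] f x.
  move=> xr; apply: contwD.
    by apply: (contw_lip (C := L)) => y yr; apply: lip; exact: in_r0.
  apply: contwM; first exact: contw_cst.
  by apply: contw_sum => i; apply: contwM; exact/contw_linb/coord_linb.
have loc x p : proximal_subgradient K u0 x p -> exists2 d : R, 0 < d &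
    forall y, `|y - x| < d ->
      f x + dot (p + (K + 1) *: x) (y - x) + dot (y - x) (y - x) / 2 <= f y.
  move=> /near_iff[d d0 dP]; exists d => // y /dP; rewrite enorm_sqr /f.
  rewrite dotDl dotZl !dotBl !dotBr (dotC y x); lra.
move=> x xr; have [p px] := prox x (in_r0 x xr).
have [d d0 dP] := loc x p px.
exists (p + (K + 1) *: x); split.
  have r1 : 0 < r0 - `|x - y0| by rewrite subr_gt0 in_r0.
  have pb : `|p| <= L + K.
    apply: (proximal_slope_bound K0 r1 _ L0 px) => y yx.
    apply: (le_trans (ler_norm _)); apply: lip; first exact: in_r0.
    by have := ler_normD (y - x) (x - y0); rewrite addrA subrK; lra.
  rewrite (le_trans (ler_normD _ _))// lerD// normrZ ger0_norm ?addr_ge0//.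
  rewrite ler_wpM2l ?addr_ge0//.
  by have := ler_normD (x - y0) y0; rewrite subrK; lra.
move=> y yr; apply: (strict_local_support_global fc _ xr d0 dP) => // z zr.
have [p' p'z] := prox z (in_r0 z zr); have [d' d'0 d'P] := loc z p' p'z.
by exists (p' + (K + 1) *: z), d'.
Qed.

End SemiconvexSupport.

(** * Comparison *)

Section Gradients.
Context {R : realType} {n : nat}.
Notation V := 'rV[R]_n.
Notation Z := (R * V * V)%type.

Definition lin (g : R * V) (h : R * V) : R := g.1 * h.1 + dot g.2 h.2.

Lemma lin_linb g : linb (lin g).
Proof.
apply: linb_add.
  exact: (linb_scale g.1 (linb_fst _ _)).
exact: (linb_comp (linb_snd _ _) (dot_linbr g.2)).
Qed.

Lemma lin_linear g : linear (lin g).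
Proof. by case: (lin_linb g). Qed.

(** [C1_on] requires bundled linear maps as differentials. *)
HB.instance Definition _ g :=
  GRing.isLinear.Build R (R * V)%type R *:%R (lin g) (lin_linear g).

Definition grad (f : R * V -> R) (z g : R * V) : Prop := diffw setT f z (lin g).

Lemma gradD f f' z g g' : grad f z g -> grad f' z g' ->
  grad (fun z => f z + f' z) z (g + g').
Proof.
move=> df df'; apply: (diffw_eqL _ (diffwD df df')) => h.
by rewrite /lin /= dotDl; ring.
Qed.

Lemma gradN f z g : grad f z g -> grad (fun z => - f z) z (- g).
Proof.
move=> df; apply: (diffw_eqL _ (diffwN df)) => h.
by rewrite /lin /= dotNl; ring.
Qed.

Lemma gradB f f' z g g' : grad f z g -> grad f' z g' ->
  grad (fun z => f z - f' z) z (g - g').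
Proof. by move=> df df'; apply: gradD => //; exact: gradN. Qed.

Lemma grad_cst c z : grad (fun=> c) z 0.
Proof.
by apply: (diffw_eqL _ (diffw_cst _ _ _)) => h; rewrite /lin /= mul0r dot0l addr0.
Qed.

Lemma gradM f f' z g g' : grad f z g -> grad f' z g' ->
  grad (fun z => f z * f' z) z (f' z *: g + f z *: g').
Proof.
move=> df df'; apply: (diffw_eqL _ (diffwM (lin_linb g) (lin_linb g') df df')) => h.
rewrite /lin /= dotDl !dotZl -[f' z *: g.1]/(f' z * g.1) -[f z *: g'.1]/(f z * g'.1).
ring.
Qed.

Lemma gradZ c f z g : grad f z g -> grad (fun z => c * f z) z (c *: g).
Proof.
move=> df; have := gradM (grad_cst c z) df.
by rewrite scaler0 add0r.
Qed.

Lemma grad_eqg f z g g' : g = g' -> grad f z g -> grad f z g'.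
Proof. by move=> ->. Qed.

Lemma grad_comp (F : R -> R) f z g d : der setT F (f z) d -> grad f z g ->
  grad (fun z => F (f z)) z (d *: g).
Proof.
move=> dF df.
apply: (diffw_eqL _ (diffw_comp (E := setT) _ (lin_linb g) (linb_line d) df dF)) => // h.
by rewrite /lin /= dotZl -[d *: g.1]/(d * g.1) -[_ *: d]/(_ * d); ring.
Qed.

Lemma grad_time z : grad (fun z => z.1) z (1, 0).
Proof.
apply: (diffw_eqL _ (diffw_linb _ _ (linb_fst _ _))) => h.
by rewrite /lin /= dot0l mul1r addr0.
Qed.

Lemma grad_sq (y0 : V) z : grad (fun z => dot (z.2 - y0) (z.2 - y0)) z (0, 2 *: (z.2 - y0)).
Proof.
have d2 : diffw setT (fun z : R * V => z.2 - y0) z (fun h => h.2 - 0).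
  by apply: diffwB; [apply: diffw_linb; exact: linb_snd|exact: diffw_cst].
have l2 : linb (fun h : R * V => h.2 - 0).
  by apply: linb_sub; [exact: linb_snd|exact: linb_zero].
apply: (diffw_eqL _ (diffw_bilin dot_bilinb l2 l2 d2 d2)) => h.
by rewrite /lin /= subr0 mul0r dotZl (dotC h.2) add0r mulr_natl mulr2n.
Qed.

(** The squared positive part [sp] is of class C^1 and vanishes on a half line; the cutoffs, the
    barriers and the penalization are all built from it. *)
Definition pp (s : R) : R := Num.max s 0.
Definition sp (s : R) : R := pp s ^+ 2.

Lemma pp_ge0 s : 0 <= pp s. Proof. by rewrite /pp le_max lexx orbT. Qed.
Lemma pp_id s : 0 <= s -> pp s = s. Proof. by move=> s0; rewrite /pp max_l. Qed.
Lemma pp_0 s : s <= 0 -> pp s = 0. Proof. by move=> s0; rewrite /pp max_r. Qed.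
Lemma sp_0 s : s <= 0 -> sp s = 0. Proof. by move=> s0; rewrite /sp pp_0// expr0n. Qed.
Lemma sp_ge0 s : 0 <= sp s. Proof. exact: sqr_ge0. Qed.

Lemma pp_lip s s' : `|pp s' - pp s| <= `|s' - s|.
Proof.
have := ler_norm (s' - s); have := ler_norm (s - s'); rewrite (distrC s s').
by rewrite /pp; case: (leP s 0) => ?; case: (leP s' 0) => ?; rewrite ler_norml; lra.
Qed.

Lemma pp_le s c : s <= c -> 0 <= c -> pp s <= c.
Proof. by move=> sc c0; rewrite /pp ge_max sc. Qed.

Lemma sp_der s : der setT sp s (2 * pp s).
Proof.
move=> e e0; exists e => // y ye _.
have h : `|sp y - sp s - (y - s) *: (2 * pp s)| <= (y - s) ^+ 2.
  rewrite -[_ *: _]/((y - s) * (2 * pp s)) /sp /pp.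
  have ys : 0 <= s ^+ 2 /\ 0 <= y ^+ 2 by rewrite !sqr_ge0.
  case: (leP s 0) => hs; case: (leP y 0) => hy; rewrite ler_norml; apply/andP.
  - by have := sqr_ge0 (y - s); split; lra.
  - by have := mulr_ge0 (ltW hy) (_ : 0 <= - s); rewrite oppr_ge0 => /(_ hs); split; lra.
  - by have := mulr_ge0 (ltW hs) (_ : 0 <= - y); rewrite oppr_ge0 => /(_ hy); split; lra.
  - by have := sqr_ge0 (y - s); split; lra.
apply: (le_trans h); rewrite -real_normK ?num_real// expr2 ler_wpM2r//.
exact: ltW.
Qed.

Lemma contw_pp (W : normedModType R) (D : set W) (f : W -> R) z :
  contw D f z -> contw D (fun y => pp (f y)) z.
Proof.
move=> cf; apply: (contw_lip_comp (f := f) (g := pp) (C := 1)) => //.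
by move=> y _; rewrite mul1r pp_lip.
Qed.

Lemma contwZ (W W' : normedModType R) (D : set W) (s : W -> R) (f : W -> W') z :
  contw D s z -> contw D f z -> contw D (fun y => s y *: f y) z.
Proof. by move=> /contw_cvg cs /contw_cvg cf; apply/contw_cvg; exact: cvgZ. Qed.

Lemma contwB (W W' : normedModType R) (D : set W) (f g : W -> W') z :
  contw D f z -> contw D g z -> contw D (fun y => f y - g y) z.
Proof. by move=> cf cg; apply: contwD => //; exact: contwN. Qed.

Lemma contw_dot (W : normedModType R) (D : set W) (f g : W -> V) z :
  contw D f z -> contw D g z -> contw D (fun y => dot (f y) (g y)) z.
Proof.
move=> cf cg; apply: contw_sum => i; apply: contwM.
  apply: (contw_comp (E := setT) (f := f) (g := fun x : V => x 0 i)) => //.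
  exact/contw_linb/coord_linb.
apply: (contw_comp (E := setT) (f := g) (g := fun x : V => x 0 i)) => //.
exact/contw_linb/coord_linb.
Qed.

Definition C1_near (f : R * V -> R) (g : R * V -> R * V) (z0 : R * V) : Prop :=
  exists2 r : R, 0 < r & forall z, `|z - z0| < r -> grad f z (g z) /\ contw setT g z.

(** The viscosity inequalities admit only test functions of class C^1 on the whole domain, while the
    functions to be tested are regular near one point; multiplication by a cutoff bridges the
    gap. *)
Lemma C1_near_global (D : set (R * V)) f g z0 : C1_near f g z0 ->
  exists F : R * V -> R, [/\ C1_on D F, grad F z0 (g z0) &
    exists2 d : R, 0 < d & forall z, `|z - z0| < d -> F z = f z].
Proof.
move=> [r r0 rP].
(* The cutoff is [1] for [s2 <= e] and [0] for [s2 >= 2 e], whereas [s2 >= 4 e] outside the ball of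
   radius [r]; the gap gives each outer point a whole neighbourhood on which the product
   vanishes. *)
pose e := r ^+ 2 / 4; have e0 : 0 < e by rewrite divr_gt0// exprn_gt0.
pose s2 (z : R * V) := (z.1 - z0.1) ^+ 2 + dot (z.2 - z0.2) (z.2 - z0.2).
have s2_big z : r <= `|z - z0| -> 4 * e <= s2 z.
  have -> : 4 * e = r ^+ 2 by rewrite /e; field.
  rewrite [leRHS]prod_normE le_max /= => /orP[h|h].
    apply: (le_trans (_ : _ <= (z.1 - z0.1) ^+ 2)); last by rewrite lerDl dot_ge0.
    by rewrite -[leRHS]real_normK ?num_real// lerXn2r ?nnegrE// ltW.
  apply: (le_trans (_ : _ <= dot (z.2 - z0.2) (z.2 - z0.2))); last first.
    by rewrite lerDr sqr_ge0.
  by apply: le_trans (sqr_norm_le_dot _); rewrite lerXn2r ?nnegrE// ltW.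
have s2c z : contw setT s2 z.
  have c1 : contw setT (fun z : R * V => z.1 - z0.1) z.
    by apply: contwB; [exact/contw_linb/linb_fst|exact: contw_cst].
  have c2 : contw setT (fun z : R * V => z.2 - z0.2) z.
    by apply: contwB; [exact/contw_linb/linb_snd|exact: contw_cst].
  by apply: contwD; [exact: contwM|exact: contw_dot].
pose gs2 (z : R * V) : R * V := (2 * (z.1 - z0.1), 2 *: (z.2 - z0.2)).
have gs2P z : grad s2 z (gs2 z).
  have h1 := gradB (grad_time z) (grad_cst z0.1 z).
  apply: grad_eqg (gradD (gradM h1 h1) (grad_sq z0.2 z)).
  rewrite /gs2 subr0; congr (_, _) => /=; last by rewrite !scaler0 !add0r.
  rewrite -[_ *: (1 : R)]/(_ * 1); ring.
pose F s := sp (1 - sp ((s - e) / e)).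
pose F' s := 2 * pp (1 - sp ((s - e) / e)) * - (2 * pp ((s - e) / e) / e).
have dF s : der setT F s (F' s).
  have h1 : der setT (fun s => (s - e) / e) s (1 / e).
    have := derM (derB (der_id setT s) (der_cst setT e s)) (der_cst setT e^-1 s).
    by apply: der_eqd; rewrite subr0 mulr0 addr0.
  have h2 := der_comp (D := setT) (fun _ _ => Logic.I) (linb_line _) h1 (sp_der ((s - e) / e)).
  have h3 := derB (der_cst setT (1 : R) s) h2.
  have := der_comp (D := setT) (fun _ _ => Logic.I) (linb_line _) h3 (sp_der (1 - sp ((s - e) / e))).
  apply: der_eqd; rewrite /F' -[_ *: (2 * pp (1 - _))]/(_ * (2 * pp (1 - _))).
  rewrite -[_ *: (2 * pp (_ / _))]/(_ * (2 * pp (_ / _))); ring.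
have F0 s : 2 * e <= s -> F s = 0 /\ F' s = 0.
  move=> es; have h : 1 - sp ((s - e) / e) <= 0.
    have : 1 <= (s - e) / e by rewrite ler_pdivlMr// mul1r; lra.
    move=> h1; rewrite /sp pp_id; last exact: le_trans h1.
    by rewrite subr_le0 expr_ge1// (le_trans ler01).
  by rewrite /F /F' sp_0// pp_0// mulr0 mul0r.
have F1 s : s <= e -> F s = 1.
  move=> es; rewrite /F [sp (_ / _)]sp_0; last by rewrite pmulr_lle0 ?invr_gt0// subr_le0.
  by rewrite subr0 /sp pp_id// expr1n.
have F'1 s : s <= e -> F' s = 0.
  move=> es; rewrite /F' [pp (_ / _)]pp_0; last by rewrite pmulr_lle0 ?invr_gt0// subr_le0.
  by rewrite mulr0 mul0r oppr0 mulr0.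
have cF' z : contw setT (fun z => F' (s2 z)) z.
  have c1 : contw setT (fun z => (s2 z - e) / e) z.
    by apply: contwM; [apply: contwB => //; exact: contw_cst|exact: contw_cst].
  have c2 := contw_pp c1.
  apply: contwM.
    apply: contwM; first exact: contw_cst.
    by apply: contw_pp; apply: contwB; [exact: contw_cst|exact: contwM].
  apply: contwN; apply: contwM; last exact: contw_cst.
  by apply: contwM => //; exact: contw_cst.
pose b z := F (s2 z); pose gb z := F' (s2 z) *: gs2 z.
have gbP z : grad b z (gb z) by exact: grad_comp.
have bc z : contw setT b z := diffw_contw (lin_linb _) (gbP z).
have gbc z : contw setT gb z.
  apply: contwZ => //; apply: contw_pair.
    apply: contwM; first exact: contw_cst.
    by apply: contwB; [exact/contw_linb/linb_fst|exact: contw_cst].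
  apply: contwZ; first exact: contw_cst.
  by apply: contwB; [exact/contw_linb/linb_snd|exact: contw_cst].
pose G z := f z *: gb z + b z *: g z.
pose B z := b z * f z.
have BG z : grad B z (G z) /\ contw setT G z.
  have [zr|zr] := ltP `|z - z0| r.
    have [fg cg] := rP z zr; split; first exact: gradM.
    by apply: contwD; apply: contwZ => //; exact: diffw_contw (lin_linb _) fg.
  have [d d0 dP] := s2c z e e0.
  have zero y : `|y - z| < d -> B y = 0 /\ G y = 0.
    move=> /dP/(_ Logic.I); rewrite ler_norml => /andP[h _].
    have [|b0 b'0] := F0 (s2 y); first by have := s2_big z zr; lra.
    by rewrite /B /G /b /gb b0 b'0 mul0r !scale0r scaler0 addr0.
  have zz : `|z - z| < d by rewrite subrr normr0.
  split.
    rewrite /grad (zero z zz).2.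
    apply: (diffw_near (f := fun=> 0) d0 _ _ (grad_cst 0 z)).
      by move=> y /zero[-> _].
    by rewrite (zero z zz).1.
  by move=> e' e'0; exists d => // y /zero[_ ->] _; rewrite (zero z zz).2 subrr normr0 ltW.
exists B; split.
- exists (fun z => lin (G z)); split.
    move=> z _; apply/diffwP; apply: (diffw_sub (@subsetT _ D)); exact: (BG z).1.
  move=> v; apply/contwP => z _; apply: (contw_sub (@subsetT _ D)).
  have [_ cG] := BG z.
  apply: contwD.
    apply: contwM; last exact: contw_cst.
    apply: (contw_comp (E := setT) (f := G) (g := fst)) => //.
    exact/contw_linb/linb_fst.
  apply: contw_dot; last exact: contw_cst.
  apply: (contw_comp (E := setT) (f := G) (g := snd)) => //.
  exact/contw_linb/linb_snd.
- have s20 : s2 z0 = 0 by rewrite /s2 !subrr expr0n dot0l addr0.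
  have [+ _] := BG z0; apply: grad_eqg.
  by rewrite /G /gb /b s20 F'1 ?F1 ?(ltW e0)// scale0r scaler0 add0r scale1r.
- have [d d0 dP] := s2c z0 e e0; exists d => // z /dP/(_ Logic.I).
  rewrite [s2 z0](_ : _ = 0); last by rewrite /s2 !subrr expr0n dot0l addr0.
  rewrite subr0 => /(le_trans (ler_norm _)) h.
  by rewrite /B /b F1// mul1r.
Qed.

Lemma HJ_operatorE (H : Z -> R) f t x g : grad f (t, x) g ->
  HJ_operator H f t x = g.1 + H (t, x, g.2).
Proof.
move=> df; rewrite /HJ_operator; congr (_ + H (_, _)).
  have l : linb (fun h : R => (h, 0) : R * V).
    split=> [a y z|]; first by congr (_, _); rewrite /= scaler0 addr0.
    by exists 1 => h; rewrite prod_normE /= normr0 mul1r ge_max lexx normr_ge0.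
  have d : diffw setT (fun s : R => (s, x) : R * V) t (fun h => (h, 0)).
    apply: (diffw_eqL _ (diffw_ext _ (diffwD (diffw_linb setT t l)
      (diffw_cst setT ((0, x) : R * V) t)))) => [h|s]; first by rewrite addr0.
    by congr (_, _); rewrite /= ?addr0 ?add0r.
  have h := diffw_comp (E := setT) (fun _ _ => Logic.I) l (lin_linb g) d df.
  rewrite derive1E (diffw_derive _ filterT (linb_comp l (lin_linb g)) h).
  by rewrite /lin /= dot0r addr0 mulr1.
have l : linb (fun h : V => (0, h) : R * V).
  split=> [a y z|]; first by congr (_, _); rewrite /= scaler0 addr0.
  by exists 1 => h; rewrite prod_normE /= normr0 mul1r ge_max lexx normr_ge0.
have d : diffw setT (fun y : V => (t, y) : R * V) x (fun h => (0, h)).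
  apply: (diffw_eqL _ (diffw_ext _ (diffwD (diffw_linb setT x l)
    (diffw_cst setT ((t, 0) : R * V) x)))) => [h|s]; first by rewrite addr0.
  by congr (_, _); rewrite /= ?addr0 ?add0r.
have h := diffw_comp (E := setT) (fun _ _ => Logic.I) l (lin_linb g) d df.
apply/rowP => i; rewrite mxE (diffw_derive _ filterT (linb_comp l (lin_linb g)) h).
by rewrite /lin /= mulr0 add0r dot_delta.
Qed.

Lemma supersolution_test (T : R) (Omega : set V) (H : Z -> R) (u : R * V -> R) t x f g :
  viscosity_supersolution T Omega H u -> 0 < t < T -> Omega x ->
  C1_near f g (t, x) ->
  (exists2 d : R, 0 < d & forall z, `|z - (t, x)| < d -> u (t, x) - f (t, x) <= u z - f z) ->
  0 <= (g (t, x)).1 + H (t, x, (g (t, x)).2).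
Proof.
move=> sup tT Ox fg [d d0 dP].
have [F [FC1 Fg [r r0 Ff]]] := C1_near_global (`]0, T[ `*` Omega) fg.
have Fz : F (t, x) = f (t, x) by apply: Ff; rewrite subrr normr0.
rewrite -(HJ_operatorE H Fg); apply: sup => //.
apply/near_iff; exists (Num.min d r); first by rewrite lt_min d0.
by move=> z; rewrite lt_min => /andP[zd zr]; rewrite Fz Ff// dP.
Qed.

Lemma subsolution_test (T : R) (Omega : set V) (H : Z -> R) (u : R * V -> R) t x f g :
  viscosity_subsolution T Omega H u -> 0 < t < T -> Omega x ->
  C1_near f g (t, x) ->
  (exists2 d : R, 0 < d & forall z, `|z - (t, x)| < d -> u z - f z <= u (t, x) - f (t, x)) ->
  (g (t, x)).1 + H (t, x, (g (t, x)).2) <= 0.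
Proof.
move=> sub tT Ox fg [d d0 dP].
have [F [FC1 Fg [r r0 Ff]]] := C1_near_global (`]0, T[ `*` Omega) fg.
have Fz : F (t, x) = f (t, x) by apply: Ff; rewrite subrr normr0.
rewrite -(HJ_operatorE H Fg); apply: sub => //.
apply/near_iff; exists (Num.min d r); first by rewrite lt_min d0.
by move=> z; rewrite lt_min => /andP[zd zr]; rewrite Fz Ff// dP.
Qed.

End Gradients.

(** * Barrier and local comparison *)

Section Comparison.
Context {R : realType} {n : nat}.
Notation V := 'rV[R]_n.
Notation Z := (R * V * V)%type.

Lemma le_gt0_eps (a b c : R) : 0 <= c -> (forall e, 0 < e -> a <= b + c * e) -> a <= b.
Proof.
move=> c0 h; apply/ler_addgt0Pr => e e0.
have c1 : 0 < c + 1 by rewrite ltr_wpDl.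
apply: (le_trans (h (e / (c + 1)) (divr_gt0 e0 c1))).
by rewrite lerD2l mulrA ler_pdivrMr// mulrC ler_pM2l// lerDl.
Qed.

(* The bound [G] on the slope of [chi] does not depend on [C], which may thus
   be a Lipschitz constant of the Hamiltonian for momenta bounded in terms of
   [G]: this is finite speed of propagation. *)
Lemma barrier (rho eta : R) (y0 : V) : 0 < rho -> 0 < eta -> exists2 G : R, 0 <= G &
  forall C tau : R, 0 < C -> 0 < tau -> exists tau1 tau2 rho1 chi dchi,
  [/\ [/\ 0 < tau1, tau1 < tau2, tau2 < tau, 0 < rho1 & rho1 <= rho],
      forall z, grad chi z (dchi z), forall z, contw setT dchi z,
      forall z, cyl 0 tau2 y0 rho z ->
        [/\ 0 <= chi z, `|(dchi z).2| <= G, C * `|(dchi z).2| <= (dchi z).1 &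
            z.1 = tau2 \/ `|z.2 - y0| = rho -> eta <= chi z] &
      forall z, cyl 0 tau1 y0 rho1 z -> chi z = 0].
Proof.
move=> rho0 eta0.
(* On the lateral boundary [|x - y0|^2 >= 2 s0], so at least [s0] remains after subtracting [s0],
   and [A] makes the first part of [chi] reach [eta] there; for small [x - y0] and small [t] that
   part vanishes. *)
pose s0 := rho ^+ 2 / 2.
have r2 : 0 < rho ^+ 2 by rewrite exprn_gt0.
have s00 : 0 < s0 by rewrite divr_gt0.
pose A := eta / s0 ^+ 2.
have A0 : 0 < A by rewrite divr_gt0// exprn_gt0.
pose m := n%:R * rho ^+ 2 + 1.
have m0 : 0 <= m by rewrite addr_ge0// mulr_ge0// ltW.
have As0 : A * s0 ^+ 2 = eta by rewrite /A divfK// gt_eqF// exprn_gt0.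
have rE : rho ^+ 2 = s0 + s0 by rewrite /s0; lra.
have mE : m = n%:R * rho ^+ 2 + 1 by [].
clearbody m A s0.
exists (4 * A * m * rho) => [|C tau C_gt0 tau0].
  by rewrite !mulr_ge0// ltW.
(* The cone speed: [2 * rho] is the size of the space gradient of [sg], so with this [c] the time
   derivative of [chi] dominates [C] times its space gradient. Times with [c t <= 1] keep [sg],
   hence the slope, bounded independently of [C]. *)
pose c := 2 * C * rho.
have c0 : 0 < c by rewrite !mulr_gt0.
pose tau2 := Num.min tau (1 / c) / 2.
have mt : 0 < Num.min tau (1 / c) by rewrite lt_min tau0 divr_gt0.
have tau20 : 0 < tau2 by rewrite divr_gt0.
have tau2t : tau2 < tau.
  by apply: (lt_le_trans (_ : _ < Num.min tau (1 / c))); rewrite ?ge_min ?lexx// /tau2; lra.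
have ctau2 : c * tau2 <= 1.
  rewrite mulrC -ler_pdivlMr// /tau2.
  have : Num.min tau (1 / c) <= 1 / c by rewrite ge_min lexx orbT.
  by lra.
pose tau1 := Num.min tau2 (s0 / 2 / c) / 2.
have mt1 : 0 < Num.min tau2 (s0 / 2 / c) by rewrite lt_min tau20 !divr_gt0.
have tau10 : 0 < tau1 by rewrite divr_gt0.
have tau12 : tau1 < tau2.
  by apply: (lt_le_trans (_ : _ < Num.min tau2 (s0 / 2 / c)));
    rewrite ?ge_min ?lexx// /tau1; lra.
have ctau1 : c * tau1 <= s0 / 2.
  rewrite mulrC -ler_pdivlMr// /tau1.
  have : Num.min tau2 (s0 / 2 / c) <= s0 / 2 / c by rewrite ge_min lexx orbT.
  have : 0 < s0 / 2 / c by rewrite !divr_gt0.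
  lra.
(* The corresponding term depends on time alone: it lifts [chi] to [eta] at the top time [tau2] and
   only increases the time derivative. *)
pose N := eta / (tau2 - tau1) ^+ 2.
have dtau : 0 < tau2 - tau1 by rewrite subr_gt0.
have N0 : 0 < N by rewrite divr_gt0// exprn_gt0.
pose rho1 := rho / (2 * (n%:R + 1)).
have n1 : 0 < n%:R + 1 :> R by rewrite ltr_wpDl.
have rho10 : 0 < rho1 by rewrite divr_gt0// mulr_gt0.
have rho1r : rho1 <= rho.
  rewrite ler_pdivrMr ?mulr_gt0// ler_peMr ?(ltW rho0)//.
  by have := ler0n R n; clear; lra.
have nrho1 : n%:R * rho1 ^+ 2 <= s0 / 2.
  have e : rho = rho1 * (2 * (n%:R + 1)) by rewrite /rho1 divfK// gt_eqF// mulr_gt0.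
  have -> : s0 / 2 = (n%:R + 1) ^+ 2 * rho1 ^+ 2 by move: rE; rewrite e; lra.
  rewrite ler_wpM2r ?sqr_ge0// expr2.
  have : 0 <= n%:R * n%:R :> R by rewrite mulr_ge0.
  by have := ler0n R n; clear; lra.
have NE : N * (tau2 - tau1) ^+ 2 = eta by rewrite /N divfK// gt_eqF// exprn_gt0.
have cE : c = 2 * C * rho by [].
clearbody N c rho1 tau1 tau2.
pose sg (z : R * V) := dot (z.2 - y0) (z.2 - y0) + c * z.1 - s0.
pose chi z := A * sp (sg z) + N * sp (z.1 - tau1).
pose dchi z : R * V :=
  A *: ((2 * pp (sg z)) *: ((0, 2 *: (z.2 - y0)) + c *: (1, 0)))
  + N *: ((2 * pp (z.1 - tau1)) *: (1, 0)).
have sgc D z : contw D sg z.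
  apply: contwB; last exact: contw_cst.
  apply: contwD.
    by apply: contw_dot; apply: contwB; [exact/contw_linb/linb_snd|exact: contw_cst
      |exact/contw_linb/linb_snd|exact: contw_cst].
  by apply: contwM; [exact: contw_cst|exact/contw_linb/linb_fst].
have ptc D z : contw D (fun z : R * V => pp (z.1 - tau1)) z.
  by apply: contw_pp; apply: contwB; [exact/contw_linb/linb_fst|exact: contw_cst].
have dE1 z : (dchi z).1 = A * (2 * pp (sg z) * c) + N * (2 * pp (z.1 - tau1)).
  by rewrite /dchi /= /GRing.scale /= !mulr1 add0r.
have dE2 z : (dchi z).2 = (A * (2 * pp (sg z)) * 2) *: (z.2 - y0).
  by rewrite /dchi /= !scaler0 !addr0 !scalerA.
exists tau1, tau2, rho1, chi, dchi; split => //.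
- move=> z; apply: gradD; apply: gradZ; apply: grad_comp; try exact: sp_der.
    have h1 := gradB (gradD (grad_sq y0 z) (gradZ c (grad_time z))) (grad_cst s0 z).
    by apply: grad_eqg h1; rewrite subr0.
  by apply: grad_eqg (gradB (grad_time z) (grad_cst tau1 z)); rewrite subr0.
- move=> z; have cc (v : R * V) : contw setT (fun=> v) z by exact: contw_cst.
  have ck (k : R) : contw setT (fun=> k) z by exact: contw_cst.
  apply: contwD; apply: contwZ => //; apply: contwZ => //; try by apply: contwM.
    by apply: contwM => //; apply: contw_pp.
  apply: contwD => //; apply: contw_pair => //; apply: contwZ => //.
  by apply: contwB; [exact/contw_linb/linb_snd|exact: contw_cst].
- move=> z [/andP[t0 tt] xr].
  have sp1 : 0 <= A * sp (sg z) by rewrite mulr_ge0 ?sp_ge0// ltW.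
  have sp2 : 0 <= N * sp (z.1 - tau1) by rewrite mulr_ge0 ?sp_ge0// ltW.
  have pp1 := pp_ge0 (sg z); have pp2 := pp_ge0 (z.1 - tau1).
  have sm : pp (sg z) <= m.
    apply: pp_le => //; rewrite /sg mE.
    have h1 := dot_le_sqr_norm (z.2 - y0).
    have h2 : n%:R * `|z.2 - y0| ^+ 2 <= n%:R * rho ^+ 2.
      by rewrite ler_wpM2l// lerXn2r ?nnegrE// ltW.
    have h3 : c * z.1 <= c * tau2 by rewrite ler_pM2l.
    by move: h1 h2 h3 ctau2 s00; clear; lra.
  have Ap : 0 <= A * (2 * pp (sg z)) * 2 by rewrite !mulr_ge0// ltW.
  have vn : `|(dchi z).2| <= A * (2 * pp (sg z)) * 2 * rho.
    by rewrite dE2 normrZ ger0_norm// ler_wpM2l.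
  split.
  + exact: addr_ge0.
  + apply: (le_trans vn).
    have -> : 4 * A * m * rho = A * (2 * m) * 2 * rho by ring.
    by rewrite ler_pM2r// ler_pM2r// ler_pM2l// ler_pM2l.
  + rewrite dE1; apply: (le_trans (ler_wpM2l (ltW C_gt0) vn)).
    have -> : C * (A * (2 * pp (sg z)) * 2 * rho) = A * (2 * pp (sg z) * c) by rewrite cE; ring.
    by rewrite lerDl !mulr_ge0// ltW.
  + case=> [t_eq|x_eq].
      rewrite /chi; have -> : N * sp (z.1 - tau1) = eta.
        by rewrite t_eq /sp pp_id ?(ltW dtau).
      by rewrite lerDr.
    have hs : s0 <= sg z.
      have := sqr_norm_le_dot (z.2 - y0); rewrite x_eq /sg => h1.
      have : 0 <= c * z.1 by rewrite mulr_ge0// ltW.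
      by move: h1 rE; clear; lra.
    have : eta <= A * sp (sg z).
      rewrite -As0 ler_pM2l// /sp pp_id; last exact: le_trans (ltW s00) hs.
      by rewrite lerXn2r ?nnegrE// ltW// (lt_le_trans s00).
    by move/le_trans; apply; rewrite lerDl.
- move=> z [/andP[t0 tt] xr].
  rewrite /chi sp_0 ?mulr0 ?sp_0 ?mulr0 ?addr0 ?subr_le0// /sg.
  have h1 := dot_le_sqr_norm (z.2 - y0).
  have h2 : n%:R * `|z.2 - y0| ^+ 2 <= n%:R * rho1 ^+ 2.
    by rewrite ler_wpM2l// lerXn2r ?nnegrE// ltW.
  have h3 : c * z.1 <= c * tau1 by rewrite ler_pM2l.
  by move: h1 h2 h3 ctau1 nrho1; clear; lra.
Qed.

Lemma cyl_interior (t0 t1 rho t x : _) (y0 : V) : (t0 : R) < t < t1 -> `|x - y0| < rho ->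
  exists2 d : R, 0 < d & forall z, `|z - (t, x)| < d ->
    t0 < z.1 < t1 /\ `|z.2 - y0| < rho.
Proof.
move=> /andP[t0t tt1] xr; exists (Num.min (Num.min (t - t0) (t1 - t)) (rho - `|x - y0|)).
  by rewrite !lt_min !subr_gt0 t0t tt1.
move=> [t' x']; rewrite !lt_min prod_normE /= !gt_max.
move=> /andP[/andP[/andP[h1 _] /andP[h2 _]] /andP[_ h3]]; split.
  by move: h1 h2; rewrite !ltr_norml; clear; lra.
by have := ler_normD (x' - x) (x - y0); rewrite addrA subrK; move: h3; clear; lra.
Qed.

(** [w] is a classical solution, which replaces the doubling of variables: at a negative interior
    minimum of [u - w + chi + e t], the function [w - chi - e t] touches [u] from below, and the
    supersolution inequality contradicts [C |D_x chi| <= d_t chi] because [e > 0]. The barrier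
    excludes the lateral and top boundaries. The last premise abstracts the viscosity property, so
    that the opposite inequality follows by a change of sign. *)
Lemma comparison (tau rho B : R) (y0 : V) (h : Z -> R) (u w : R * V -> R)
    (q : R * V -> V) : 0 < tau -> 0 < rho ->
  (forall z, cyl 0 tau y0 rho z -> contw (cyl 0 tau y0 rho) u z) ->
  (forall z, cyl 0 tau y0 rho z -> contw (cyl 0 tau y0 rho) w z) ->
  (forall x, `|x - y0| <= rho -> u (0, x) = w (0, x)) ->
  (forall z, cyl 0 tau y0 rho z -> `|q z| <= B) ->
  (forall t x, 0 < t < tau -> `|x - y0| < rho ->
     C1_near w (fun z => (- h (z.1, z.2, q z), q z)) (t, x)) ->
  (forall M, exists C, forall t x p p', 0 <= t <= tau -> `|x - y0| <= rho ->
     `|p| <= M -> `|p'| <= M -> `|h (t, x, p') - h (t, x, p)| <= C * `|p' - p|) ->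
  (forall t x f g, 0 < t < tau -> `|x - y0| < rho -> C1_near f g (t, x) ->
     (exists2 d : R, 0 < d & forall z, `|z - (t, x)| < d ->
        u (t, x) - f (t, x) <= u z - f z) ->
     0 <= (g (t, x)).1 + h (t, x, (g (t, x)).2)) ->
  exists tau1 rho1, [/\ 0 < tau1, tau1 < tau, 0 < rho1, rho1 <= rho &
    forall z, cyl 0 tau1 y0 rho1 z -> w z <= u z].
Proof.
move=> tau0 rho0 cu cw uw0 qB wgrad hlip touch.
have [eta eta0 etaP] : exists2 eta : R, 0 < eta &
    forall z, cyl 0 tau y0 rho z -> `|u z - w z| <= eta.
  apply: (compact_bdd (K := cyl 0 tau y0 rho) (f := fun z => u z - w z)).
    exact: cyl_compact.
  by move=> z zc; apply: contwB; [exact: cu|exact: cw].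
have [G G0 bar] := barrier y0 rho0 eta0.
(* The momenta to be compared, [q] and [q - D_x chi], are at most [B + G]; since [G] was obtained
   before [C], there is no circularity. *)
have [C0 C0P] := hlip (B + G).
have C_gt0 : 0 < `|C0| + 1 by rewrite ltr_wpDl.
have hC t x p p' : 0 <= t <= tau -> `|x - y0| <= rho -> `|p| <= B + G -> `|p'| <= B + G ->
    `|h (t, x, p') - h (t, x, p)| <= (`|C0| + 1) * `|p' - p|.
  move=> tt xr pM pM'; apply: (le_trans (C0P _ _ _ _ tt xr pM pM')).
  by rewrite ler_wpM2r// (le_trans (ler_norm _))// lerDl.
have [tau1 [tau2 [rho1 [chi [dchi [[tau10 tau12 tau2t rho10 rho1r] gchi cdchi chiP chi0]]]]]] :=
  bar _ _ C_gt0 tau0.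
exists tau1, rho1; split => //; first exact: lt_trans tau2t.
have sub z : cyl 0 tau2 y0 rho z -> cyl 0 tau y0 rho z.
  by move=> [/andP[t0 tt] xr]; split=> //; rewrite t0 (le_trans tt)// ltW.
suff key e : 0 < e -> forall z, cyl 0 tau2 y0 rho z -> 0 <= u z - w z + chi z + e * z.1.
  move=> z zc; have [/andP[t0 tt] xr] := zc.
  apply: (@le_gt0_eps _ _ z.1) => [|e e0]; first exact: t0.
  have zc2 : cyl 0 tau2 y0 rho z.
    by split; [rewrite t0 (le_trans tt)// ltW|exact: le_trans rho1r].
  by have := key e e0 z zc2; rewrite chi0// addr0; clear; lra.
move=> e0; pose Gf z := u z - w z + chi z + e * z.1.
have cG z : cyl 0 tau2 y0 rho z -> contw (cyl 0 tau2 y0 rho) (fun z => - Gf z) z.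
  move=> zc; apply: contwN; apply: contwD; last first.
    by apply: contwM; [exact: contw_cst|exact/contw_linb/linb_fst].
  apply: contwD; last first.
    exact: (contw_sub (@subsetT _ _) (diffw_contw (lin_linb _) (gchi z))).
  by apply: (contw_sub sub); apply: contwB; [exact/cu/sub|exact/cw/sub].
have c00 : cyl 0 tau2 y0 rho (0, y0).
  split; rewrite /= ?subrr ?normr0 ?(ltW rho0)// lexx ltW//.
  exact: lt_trans tau12.
have [[t x] zc zP] := compact_max c00 (@cyl_compact R n _ _ _ _) cG.
suff Gp : 0 <= Gf (t, x) by move=> z /zP; move: Gp; rewrite /Gf; clear; lra.
rewrite leNgt; apply/negP => Gneg.
have [/= /andP[t0 tt2] xr] := zc.
have szc := sub _ zc; have [/= /andP[_ tt] _] := szc.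
have := etaP _ szc; rewrite ler_norml => /andP[eta1 _].
have [chi_ge0 dG dC lat] := chiP _ zc.
have et_ge0 : 0 <= e * t by rewrite mulr_ge0// ltW.
have notlat : t <> tau2 /\ `|x - y0| <> rho.
  by split=> E; move: Gneg; rewrite /Gf /=; [have := lat (or_introl E)
    |have := lat (or_intror E)]; move: eta1 et_ge0; clear; lra.
have t_gt0 : 0 < t.
  rewrite lt_neqAle t0 andbT; apply: contraTneq Gneg => t_eq; rewrite -leNgt.
  have uw : u (t, x) = w (t, x) by rewrite -t_eq uw0.
  by rewrite /Gf /= uw subrr add0r; move: chi_ge0 et_ge0; clear; lra.
have t_lt : t < tau2 by rewrite lt_neqAle tt2 andbT; apply/eqP; case: notlat.
have x_lt : `|x - y0| < rho by rewrite lt_neqAle xr andbT; apply/eqP; case: notlat.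
have tT : 0 < t < tau by rewrite t_gt0 (lt_trans t_lt).
pose f z := w z - chi z - e * z.1.
pose g z : R * V := (- h (z.1, z.2, q z), q z) - dchi z - e *: (1, 0).
have fg : C1_near f g (t, x).
  have [r r0 rP] := wgrad t x tT x_lt; exists r => // z zr; have [wg gc] := rP z zr.
  split.
    apply: gradB; last by apply: gradZ; exact: grad_time.
    by apply: gradB.
  by apply: contwB; [apply: contwB|exact: contw_cst].
have [d d0 dP] : exists2 d : R, 0 < d & forall z, `|z - (t, x)| < d ->
    0 < z.1 < tau2 /\ `|z.2 - y0| < rho by apply: cyl_interior; rewrite ?t_gt0.
have loc : exists2 d : R, 0 < d & forall z, `|z - (t, x)| < d ->
    u (t, x) - f (t, x) <= u z - f z.
  exists d => // z /dP[/andP[z0 z2] zr].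
  have zc' : cyl 0 tau2 y0 rho z by split; rewrite ltW// ltW.
  by have := zP _ zc'; rewrite /Gf /f /=; clear; lra.
have := touch t x f g tT x_lt fg loc; apply/negP; rewrite -ltNge.
have -> : (g (t, x)).1 = - h (t, x, q (t, x)) - (dchi (t, x)).1 - e.
  by rewrite /g /= /GRing.scale /= mulr1.
have -> : (g (t, x)).2 = q (t, x) - (dchi (t, x)).2.
  by rewrite /g /= scaler0 subr0.
have qM := qB _ szc.
have p1 : `|q (t, x)| <= B + G by move: qM G0; clear; lra.
have p2 : `|q (t, x) - (dchi (t, x)).2| <= B + G.
  by rewrite (le_trans (ler_normB _ _))// lerD.
have t_in : 0 <= t <= tau by rewrite t0.
have := hC t x _ _ t_in xr p1 p2.
rewrite addrAC subrr add0r normrN => /(le_trans (ler_norm _)) h1.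
by move: h1 dC e0; clear; lra.
Qed.

End Comparison.

(** * From semiconvex data to C^{1,1} regularity *)

Section Forward.
Context {R : realType} {n : nat}.
Notation V := 'rV[R]_n.
Notation Z := (R * V * V)%type.

Lemma locally_lipschitz_ball (V1 V2 : normedModType R) (D : set V1) (f : V1 -> V2) z :
  locally_lipschitz D f -> D z -> exists d k : R, [/\ 0 < d, 0 <= k &
    forall y y', `|y - z| < d -> `|y' - z| < d -> D y -> D y' ->
    `|f y' - f y| <= k * `|y' - y|].
Proof.
move=> lf Dz; have [U zU [k0 [_ kP]]] := lf z Dz.
have /near_iff[d d0 dU] : \forall y \near z, U y by exact: zU.
exists d, (`|k0| + 1); split => // y y' yd y'd Dy Dy'.
have := kP (`|k0| + 1); rewrite (le_lt_trans (ler_norm k0)) ?ltrDl//.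
by move=> /(_ isT (y', y)) /=; apply; split; split => //; exact: dU.
Qed.

Lemma ball_locally_lipschitz (V1 V2 : normedModType R) (D : set V1) (f : V1 -> V2) :
  (forall z, D z -> exists d k : R, 0 < d /\
    forall y y', `|y - z| < d -> `|y' - z| < d -> D y -> D y' ->
    `|f y' - f y| <= k * `|y' - y|) -> locally_lipschitz D f.
Proof.
move=> h z Dz; have [d [k [d0 dP]]] := h z Dz.
exists [set y | `|y - z| < d]; first by apply/near_iff; exists d.
exists k; split; first by rewrite num_real.
move=> k' kk' [y' y] [/= [yd Dy] [y'd Dy']].
by rewrite (le_trans (dP _ _ y'd yd Dy' Dy))// ler_wpM2r// ltW.
Qed.

(** [- u] and [- w] belong to the Hamiltonian [- h (t, x, - p)], for which sub- and supersolutions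
    are exchanged. *)
Lemma solution_comparison_sub (tau rho B : R) (y0 : V) (h : Z -> R) (u w : R * V -> R)
    (q : R * V -> V) : 0 < tau -> 0 < rho ->
  (forall z, cyl 0 tau y0 rho z -> contw (cyl 0 tau y0 rho) u z) ->
  (forall z, cyl 0 tau y0 rho z -> contw (cyl 0 tau y0 rho) w z) ->
  (forall x, `|x - y0| <= rho -> u (0, x) = w (0, x)) ->
  (forall z, cyl 0 tau y0 rho z -> `|q z| <= B) ->
  (forall t x, 0 < t < tau -> `|x - y0| < rho ->
     C1_near w (fun z => (- h (z.1, z.2, q z), q z)) (t, x)) ->
  (forall M, exists C, forall t x p p', 0 <= t <= tau -> `|x - y0| <= rho ->
     `|p| <= M -> `|p'| <= M -> `|h (t, x, p') - h (t, x, p)| <= C * `|p' - p|) ->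
  (forall t x f g, 0 < t < tau -> `|x - y0| < rho -> C1_near f g (t, x) ->
     (exists2 d : R, 0 < d & forall z, `|z - (t, x)| < d ->
        u z - f z <= u (t, x) - f (t, x)) ->
     (g (t, x)).1 + h (t, x, (g (t, x)).2) <= 0) ->
  exists tau1 rho1, [/\ 0 < tau1, tau1 < tau, 0 < rho1, rho1 <= rho &
    forall z, cyl 0 tau1 y0 rho1 z -> u z <= w z].
Proof.
move=> tau0 rho0 cu cw uw0 qB wg hl touch.
have [||||||||| tau1 [rho1 [h1 h2 h3 h4 h5]]] := @comparison R n tau rho B y0
  (fun z => - h (z.1.1, z.1.2, - z.2)) (fun z => - u z) (fun z => - w z)
  (fun z => - q z).
- exact: tau0.
- exact: rho0.
- by move=> z zc; apply: contwN; exact: cu.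
- by move=> z zc; apply: contwN; exact: cw.
- by move=> x xr; rewrite uw0.
- by move=> z zc; rewrite normrN; exact: qB.
- move=> t x tt xr; have [r r0 rP] := wg t x tt xr; exists r => // z zr.
  have [g1 g2] := rP z zr; split.
    apply: (grad_eqg _ (gradN g1)); rewrite (opprK (q z)).
    by congr (_, _).
  have e : (fun z => (- - h (z.1, z.2, - - q z), - q z)) =
      fun z => - (- h (z.1, z.2, q z), q z).
    by apply/funext => z'; rewrite (opprK (q z')).
  by move: (contwN g2); rewrite -e.
- move=> M; have [C CP] := hl M; exists C => t x p p' tt xr pM pM' /=.
  have := CP t x (- p) (- p') tt xr; rewrite !normrN => /(_ pM pM').
  rewrite -opprD normrN; have -> : - h (t, x, - p') - - h (t, x, - p) =
    - (h (t, x, - p') - h (t, x, - p)) by ring.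
  by rewrite normrN.
- move=> t x f g tt xr [r r0 rP] [d d0 dP].
  have := touch t x (fun z => - f z) (fun z => - g z) tt xr.
  have fg : C1_near (fun z => - f z) (fun z => - g z) (t, x).
    exists r => // z zr; have [g1 g2] := rP z zr.
    by split; [exact: gradN|exact: contwN].
  have loc : exists2 d : R, 0 < d & forall z, `|z - (t, x)| < d ->
      u z - - f z <= u (t, x) - - f (t, x).
    by exists d => // z /dP; rewrite !opprK; lra.
  by move=> /(_ fg loc) /=; lra.
exists tau1, rho1; split => // z zc; by have := h5 z zc; lra.
Qed.

Lemma semiconvex_C11 (Omega : set V) (T : R) (H : Z -> R) (u0 : V -> R)
    (u : R * V -> R) (y0 : V) (K : R) :
  open Omega -> 0 < T -> C2_on ((`[0, T] `*` Omega) `*` setT) H ->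
  (forall (t : R) (x p : V), 0 <= t <= T -> Omega x ->
       posdefmx (hessian (fun q => H (t, x, q)) p)) ->
  locally_lipschitz Omega u0 -> viscosity_solution T Omega H u0 u -> Omega y0 ->
  0 < K -> (\forall y \near y0, exists p : V, proximal_subgradient K u0 y p) ->
  exists r t0 : R,
     [/\ 0 < r, 0 < t0,
         `]0, t0] `*` eball y0 r `<=` `]0, T[ `*` Omega &
         C11_loc (`]0, t0] `*` eball y0 r) u].
Proof.
move=> Oo T0 HC2 Hpos lip [uc usub usup u_init] Oy0 K0 /near_iff[d1 d10 prox].
have [d2 [L [d20 L0 LP]]] := locally_lipschitz_ball lip Oy0.
have /near_iff[d3 d30 d3P] : \forall y \near y0, Omega y by exact: Oo.
pose r0 := Num.min d1 (Num.min d2 d3).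
have r00 : 0 < r0 by rewrite !lt_min d10 d20.
have r0P y : `|y - y0| < r0 -> [/\ `|y - y0| < d1, `|y - y0| < d2 & Omega y].
  by rewrite !lt_min => /and3P[? ? ?]; split=> //; exact: d3P.
pose r := r0 / 2; pose rho := r / 2.
have r_gt0 : 0 < r by rewrite divr_gt0.
have rho_gt0 : 0 < rho by rewrite divr_gt0.
have rho_r : rho < r by rewrite /rho; lra.
have rr0 : r < r0 by rewrite /r; lra.
have rO x : `|x - y0| <= r -> Omega x.
  by move=> xr; have [] := r0P x (le_lt_trans xr rr0).
have rhoO x : `|x - y0| <= rho -> Omega x.
  by move=> xr; apply: rO; rewrite (le_trans xr)// ltW.
have prox' y : `|y - y0| < r0 -> exists p, proximal_subgradient K u0 y p.
  by move=> /r0P[+ _ _]; exact: prox.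
have lip' x y : `|x - y0| < r0 -> `|y - y0| < r0 -> `|u0 y - u0 x| <= L * `|y - x|.
  by move=> /r0P[_ x2 Ox] /r0P[_ y2 Oy]; exact: LP.
have supp := semiconvex_support (ltW K0) L0 rho_gt0 (lt_trans rho_r rr0) prox' lip'.
set M0 := L + K + (K + 1) * (`|y0| + rho) in supp.
have [Hx [Hp HB]] := Hbounds_exist HC2 Hpos.
(* The momentum bound is what [genfun_exist] requires: the slope, the term [(K + 1) X 0] on the box,
   and [1] for the drift of [P]. It is fixed before the time [tau]. *)
have [C [lam HB1]] := HB y0 r (M0 + (K + 1) * (`|y0| + r) + 1) rO.
have K10 : 0 <= K + 1 by rewrite addr_ge0// ltW.
have [tau [A [mu [S [Q [Y [tau0 tauT A0 mu0 gf]]]]]]] :=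
  genfun_exist HB1 K10 T0 r_gt0 (lexx _).
have [w [q [w0 [Lw wL] qA wq]]] := hopf_solution gf tau0 rho_gt0 A0 mu0 supp.
rewrite -/rho in gf w0 wL qA wq.
have cylD z : cyl 0 tau y0 rho z -> (`[0, T] `*` Omega) z.
  move: z => [t x] [/= /andP[t0 tt] xr]; split; last exact: rhoO.
  by rewrite /= in_itv /= t0 (le_trans tt).
have cu z : cyl 0 tau y0 rho z -> contw (cyl 0 tau y0 rho) u z.
  move=> zc; apply: (contw_sub cylD); have /contwP h := uc.
  by apply: h; exact: cylD.
have cw z : cyl 0 tau y0 rho z -> contw (cyl 0 tau y0 rho) w z.
  by move=> zc; apply: (contw_lip (C := Lw)) => y yc; exact: wL.
have uw0 x : `|x - y0| <= rho -> u (0, x) = w (0, x).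
  by move=> xr; rewrite w0// u_init//; exact: rhoO.
have wgrad_at t0 z : 0 < t0 -> cyl t0 tau y0 rho z ->
    diffw (cyl t0 tau y0 rho) w z (lin (- H (z.1, z.2, q z), q z)).
  move=> t00 zc; have [L' LP'] := wq t0 t00.
  move=> e e0; exists (e / (`|L'| + 1)); first by rewrite divr_gt0// ltr_wpDl.
  move=> y yd yc; have [_ _ h] := LP' z y zc yc.
  have -> : lin (- H (z.1, z.2, q z), q z) (y - z) =
     dot (q z) (y - z).2 - H (z.1, z.2, q z) * (y - z).1 by rewrite /lin /=; ring.
  apply: (le_trans h); rewrite expr2 mulrA ler_wpM2r//.
  move: yd; rewrite ltr_pdivlMr ?ltr_wpDl// => /ltW; apply: le_trans.
  by rewrite mulrC ler_wpM2l// (le_trans (ler_norm _))// lerDl.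
have inner t x : 0 < t < tau -> `|x - y0| < rho -> exists2 d, 0 < d &
    forall z, `|z - (t, x)| < d -> cyl (t / 2) tau y0 rho z.
  move=> /andP[t0 tt] xr; exists (Num.min (Num.min (t / 2) (tau - t)) (rho - `|x - y0|)).
    by rewrite !lt_min divr_gt0// !subr_gt0 tt.
  move=> [t' x']; rewrite !lt_min prod_normE /= !gt_max.
  move=> /andP[/andP[/andP[h1 _] /andP[h2 _]] /andP[_ h3]]; split => /=.
    by move: h1 h2; rewrite !ltr_norml; clear; lra.
  by have := ler_normD (x' - x) (x - y0); rewrite addrA subrK; move: h3; clear; lra.
have wgrad t x : 0 < t < tau -> `|x - y0| < rho ->
     C1_near w (fun z => (- H (z.1, z.2, q z), q z)) (t, x).
  move=> tt xr; have [d d0 dP] := inner t x tt xr.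
  have t20 : 0 < t / 2 by rewrite divr_gt0//; case/andP: tt.
  have [L' LP'] := wq _ t20.
  exists d => // z zd; have zc := dP z zd.
  have e0 : 0 < d - `|z - (t, x)| by rewrite subr_gt0.
  have near_z y : `|y - z| < d - `|z - (t, x)| -> cyl (t / 2) tau y0 rho y.
    move=> yz; apply: dP; have := ler_normD (y - z) (z - (t, x)).
    by rewrite addrA subrK => /le_lt_trans; apply; move: yz; clear; lra.
  split.
    by apply: (diffw_near e0 _ _ (wgrad_at _ _ t20 zc)) => // y /near_z.
  have cq : contw (cyl (t / 2) tau y0 rho) (fun z => (- H (z.1, z.2, q z), q z)) z.
    apply: contw_pair; first apply: contwN.
      by apply: (contw_lip (C := L')) => y yc; have [] := LP' z y zc yc.
    by apply: (contw_lip (C := L')) => y yc; have [] := LP' z y zc yc.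
  move=> e e'0; have [d' d'0 d'P] := cq e e'0.
  exists (Num.min d' (d - `|z - (t, x)|)); first by rewrite lt_min d'0.
  by move=> y; rewrite lt_min => /andP[yd' /near_z yc] _; exact: d'P.
have hlip M : exists C, forall t x p p', 0 <= t <= tau -> `|x - y0| <= rho ->
     `|p| <= M -> `|p'| <= M -> `|H (t, x, p') - H (t, x, p)| <= C * `|p' - p|.
  have [C' [lam' HB2]] := HB y0 rho M rhoO.
  exists C' => t x p p' /andP[t0 tt] xr pM pM'.
  have b p1 : `|p1| <= M -> Hbox T rho M y0 (t, x, p1).
    by move=> p1M; split => //=; rewrite t0 (le_trans tt).
  have [|h _ _] := Hb_lip HB2 (b p pM) (b p' pM') (d := `|p' - p|) => //.
  by rewrite !prod_normE /= !subrr !normr0 !ge_max !normr_ge0 lexx.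
have tauin t : 0 < t < tau -> 0 < t < T.
  by move=> /andP[-> tt]; rewrite (lt_le_trans tt).
have rhoin x : `|x - y0| < rho -> Omega x by move=> /ltW; exact: rhoO.
have [ta [ra [ta0 tatau ra0 rarho lo]]] := comparison tau0 rho_gt0 cu cw uw0 qA wgrad hlip
  (fun t x f g tt xr fg loc => supersolution_test usup (tauin t tt) (rhoin x xr) fg loc).
have [tb [rb [tb0 tbtau rb0 rbrho up]]] := solution_comparison_sub tau0 rho_gt0 cu cw uw0 qA wgrad hlip
  (fun t x f g tt xr fg loc => subsolution_test usub (tauin t tt) (rhoin x xr) fg loc).
pose t1 := Num.min ta tb; pose r1 := Num.min ra rb.
have t10 : 0 < t1 by rewrite lt_min ta0.
have r10 : 0 < r1 by rewrite lt_min ra0.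
have t1tau : t1 < tau by rewrite gt_min tatau.
have r1rho : r1 <= rho by rewrite ge_min rarho.
have uw z : cyl 0 t1 y0 r1 z -> u z = w z.
  move=> [/andP[z0 zt] zr]; apply/eqP; rewrite eq_le.
  move: zt zr; rewrite !le_min => /andP[zta ztb] /andP[zra zrb].
  rewrite up ?lo//; first by split=> //; rewrite z0.
  by split=> //; rewrite z0.
have DE z : (`]0, t1] `*` eball y0 r1) z -> 0 < z.1 <= t1 /\ `|z.2 - y0| < r1.
  move: z => [t x] [/=]; rewrite in_itv /= => tt xr; split=> //.
  exact: le_lt_trans (norm_le_enorm _) xr.
exists r1, t1; split => //.
  move=> [t x] /DE[/= /andP[t0 tt] xr]; split => /=.
    by rewrite in_itv /= t0 (le_lt_trans tt)// (lt_le_trans t1tau).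
  by apply: rhoO; rewrite ltW// (lt_le_trans xr).
(* Each point [z] gets its own initial time [z.1 / 2], because the regularity constants of [w] blow
   up at time [0]. *)
have half z : (`]0, t1] `*` eball y0 r1) z ->
    0 < z.1 / 2 /\ forall y, `|y - z| < z.1 / 2 -> (`]0, t1] `*` eball y0 r1) y ->
    cyl (z.1 / 2) tau y0 rho y /\ cyl 0 t1 y0 r1 y.
  move=> /DE[/andP[z0 zt] zr]; split; first by rewrite divr_gt0.
  move=> y; rewrite prod_normE gt_max /= => /andP[yz _] /DE[/andP[y0' yt] yr].
  split; split.
  - by rewrite (le_trans yt (ltW t1tau)) andbT; move: yz; rewrite ltr_norml; clear; lra.
  - by rewrite (le_trans (ltW yr)).
  - by rewrite yt ltW.
  - exact: ltW.
exists (fun z => (- H (z.1, z.2, q z), q z)); split.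
  move=> z Dz; have [z20 hz] := half z Dz.
  have zz : `|z - z| < z.1 / 2 by rewrite subrr normr0.
  have [zc zc1] := hz z zz Dz.
  apply/diffwP; apply: (diffw_near z20 _ _ (wgrad_at _ _ z20 zc)).
    by move=> y yz Dy; have [yc yc1] := hz y yz Dy; rewrite uw.
  by rewrite uw.
apply: ball_locally_lipschitz => z Dz; have [z20 hz] := half z Dz.
have [L' LP'] := wq _ z20.
exists (z.1 / 2), L'; split => // y y' yz y'z Dy Dy'.
have [yc _] := hz y yz Dy; have [yc' _] := hz y' y'z Dy'.
have [h1 h2 _] := LP' y y' yc yc'.
rewrite [X in X <= _]prod_normE /= ge_max h1 andbT.
by rewrite -opprD normrN.
Qed.

End Forward.

(** * From C11 regularity to semiconvexity *)

Section GradientBound.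
Context {R : realType} {n : nat}.
Notation V := 'rV[R]_n.
Notation Z := (R * V * V)%type.

(** The Huber function: [s^2 / (2 e)] for [|s| <= e] and [|s| - e / 2] beyond, in a form whose
    derivative follows from that of [sp]. Summed over coordinates it gives [hubs], a C^1 version of
    the sum norm. *)
Definition hub (e s : R) : R := (s ^+ 2 - sp (s - e) - sp (- s - e)) / (2 * e).
Definition dhub (e s : R) : R := (s - pp (s - e) + pp (- s - e)) / e.

Lemma hub_der e s : 0 < e -> der setT (hub e) s (dhub e s).
Proof.
move=> e0.
have d1 : der setT (fun s => sp (s - e)) s (2 * pp (s - e)).
  have h := derB (der_id setT s) (der_cst setT e s).
  have := der_comp (D := setT) (fun _ _ => Logic.I) (linb_line _) h (sp_der (s - e)).
  by apply: der_eqd; rewrite subr0 scale1r.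
have d2 : der setT (fun s => sp (- s - e)) s (- (2 * pp (- s - e))).
  have h := derB (derN (der_id setT s)) (der_cst setT e s).
  have := der_comp (D := setT) (fun _ _ => Logic.I) (linb_line _) h (sp_der (- s - e)).
  by apply: der_eqd; rewrite subr0 scaleN1r.
have := derM (derB (derB (derM (der_id setT s) (der_id setT s)) d1) d2)
  (der_cst setT (2 * e)^-1 s).
apply: der_eqd; rewrite mulr0 addr0 /dhub; field; exact: lt0r_neq0.
Qed.

Lemma hub_bounds e s : 0 < e -> [/\ 0 <= hub e s, `|s| - e / 2 <= hub e s,
  hub e s <= `|s| & `|dhub e s| <= 1].
Proof.
move=> e0; have e2 : 0 < 2 * e by rewrite mulr_gt0.
pose m := s ^+ 2 - sp (s - e) - sp (- s - e); pose d := s - pp (s - e) + pp (- s - e).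
have [m0 m1 m2 [d1 d2]] : [/\ 0 <= m, `|s| * (2 * e) - e * e <= m, m <= `|s| * (2 * e) &
    - e <= d /\ d <= e].
  rewrite /m /d /sp /pp; have := sqr_ge0 s; have := sqr_ge0 (s - e); have := sqr_ge0 (s + e).
  case: (lerP 0 s) => s0.
    rewrite (ger0_norm s0); have := mulr_ge0 s0 (ltW e0); have := mulr_ge0 (ltW e0) (ltW e0).
    rewrite [Num.max (- s - e) 0]max_r; last by move: s0 e0; clear; lra.
    case: (lerP (s - e) 0) => h1; last by have := mulr_ge0 (ltW e0) (ltW h1); clear m d; split; [| | |split]; lra.
    have : 0 <= s * (e - s) by rewrite mulr_ge0//; move: h1; clear; lra.
    by clear m d; split; [| | |split]; lra.
  rewrite (ltr0_norm s0).
  have : 0 <= - s * e by rewrite mulr_ge0 ?(ltW e0)// oppr_ge0 ltW.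
  have := mulr_ge0 (ltW e0) (ltW e0).
  rewrite [Num.max (s - e) 0]max_r; last by move: s0 e0; clear; lra.
  case: (lerP (- s - e) 0) => h1; last by have := mulr_ge0 (ltW e0) (ltW h1); clear m d; split; [| | |split]; lra.
  have : 0 <= - s * (e + s).
    by rewrite mulr_ge0 ?oppr_ge0 ?(ltW s0)//; move: h1; clear; lra.
  by clear m d; split; [| | |split]; lra.
rewrite /hub /dhub -/m -/d; split.
- by rewrite divr_ge0// ltW.
- by rewrite ler_pdivlMr//; move: m1; clear; lra.
- by rewrite ler_pdivrMr.
- by rewrite ler_norml ler_pdivlMr// ler_pdivrMr// mul1r mulN1r d1.
Qed.

Definition hubs (e : R) (h : V) : R := \sum_i hub e (h 0 i).
Definition dhubs (e : R) (h : V) : V := \row_i dhub e (h 0 i).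

Lemma diffw_sum (W W' : normedModType R) (D : set W) k (f : 'I_k -> W -> W') z L :
  (forall i, diffw D (f i) z (L i)) ->
  diffw D (fun y => \sum_i f i y) z (fun h => \sum_i L i h).
Proof.
move=> df; elim: (index_enum _) => [|i l IH].
  apply: (diffw_eqL _ (diffw_ext _ (diffw_cst D 0 z))) => h; by rewrite big_nil.
apply: (diffw_eqL _ (diffw_ext _ (diffwD (df i) IH))) => h; by rewrite big_cons.
Qed.

Lemma grad_hubs e s (a : V) z : 0 < e ->
  grad (fun z => hubs e (a + s *: z.2)) z (0, s *: dhubs e (a + s *: z.2)).
Proof.
move=> e0; pose F i (z : R * V) := hub e ((a + s *: z.2) 0 i).
have dF i : diffw setT (F i) z (fun h => (s * h.2 0 i) * dhub e ((a + s *: z.2) 0 i)).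
  have l : linb (fun h : R * V => s * h.2 0 i).
    by apply: linb_scale; exact: (linb_comp (linb_snd _ _) (coord_linb i)).
  have d : diffw setT (fun z : R * V => (a + s *: z.2) 0 i) z (fun h => s * h.2 0 i).
    apply: (diffw_eqL _ (diffw_ext _ (diffwD (diffw_cst setT (a 0 i) z)
      (diffw_linb setT z l)))) => [h|y]; first by rewrite add0r.
    by rewrite !mxE.
  exact: (diffw_comp (E := setT) _ l (linb_line _) d (hub_der _ e0)).
apply: (diffw_eqL _ (diffw_sum dF)) => h.
rewrite /lin /= mul0r add0r; apply: eq_bigr => i _.
by rewrite !mxE; ring.
Qed.

Lemma hubs_ge0 e h : 0 < e -> 0 <= hubs e h.
Proof. by move=> e0; apply: sumr_ge0 => i _; have [] := hub_bounds (h 0 i) e0. Qed.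

Lemma norm_le_hubs e h : 0 < e -> `|h| <= hubs e h + n%:R * e.
Proof.
move=> e0; apply: norm_le_coord => [|i].
  by rewrite addr_ge0 ?hubs_ge0// mulr_ge0// ltW.
have [_ h1 _ _] := hub_bounds (h 0 i) e0.
have h2 : hub e (h 0 i) <= hubs e h.
  rewrite /hubs (bigD1 i)//= lerDl sumr_ge0// => j _.
  by have [] := hub_bounds (h 0 j) e0.
have h3 : e <= n%:R * e.
  by rewrite ler_peMl ?(ltW e0)// ler1n (leq_ltn_trans _ (ltn_ord i)).
by move: h1 h2 h3 e0; clear; lra.
Qed.

Lemma hubs_le_norm e h : 0 < e -> hubs e h <= n%:R * `|h|.
Proof.
move=> e0; rewrite mulr_natl -[X in _ <= _ *+ X]card_ord -sumr_const ler_sum// => i _.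
have [_ _ h1 _] := hub_bounds (h 0 i) e0.
by rewrite (le_trans h1)// coord_le_norm.
Qed.

Lemma dhubs_le1 e h : 0 < e -> `|dhubs e h| <= 1.
Proof.
by move=> e0; apply: norm_le_coord => // i; rewrite mxE; have [] := hub_bounds (h 0 i) e0.
Qed.

Lemma diffw_dir_bound (W : normedModType R) (f : W -> R) x L h (K d : R) :
  linb L -> diffw setT f x L -> 0 < d ->
  (forall s, 0 < s < d -> f (x + s *: h) - f x <= K * s) -> L h <= K.
Proof.
move=> lL df d0 fK; apply: (@le_gt0_eps _ _ _ `|h|) => // e e0.
have [r r0 rP] := df e e0.
pose s := Num.min d (r / (`|h| + 1)) / 2.
have m0 : 0 < Num.min d (r / (`|h| + 1)) by rewrite lt_min d0 divr_gt0// ltr_wpDl.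
have s0 : 0 < s by rewrite divr_gt0.
have sm : s < Num.min d (r / (`|h| + 1)) by rewrite /s; lra.
move: sm; rewrite lt_min => /andP[sd]; rewrite ltr_pdivlMr ?ltr_wpDl// => sr.
have sh : `|s *: h| = s * `|h| by rewrite normrZ gtr0_norm.
have := fK s; rewrite s0 sd => /(_ isT) h1.
have H : `|f (x + s *: h) - f x - s * L h| <= e * (s * `|h|).
  have := rP (x + s *: h); rewrite addrAC subrr add0r sh (linbZ _ _ lL); apply => //.
  by move: sr s0; clear; lra.
rewrite -(ler_pM2l s0); move: H h1; rewrite ler_norml; clear; lra.
Qed.

Lemma grad_max0 (f : R * V -> R) z g : grad f z g ->
  (exists2 d : R, 0 < d & forall z', `|z' - z| < d -> f z' <= f z) -> g = 0.
Proof.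
move=> df [d d0 dP].
have key h : lin g h <= 0.
  apply: (@diffw_dir_bound _ f z (lin g) h 0 (d / (`|h| + 1)) (lin_linb g) df).
    by rewrite divr_gt0// ltr_wpDl.
  move=> s /andP[s0]; rewrite ltr_pdivlMr ?ltr_wpDl// => sd.
  rewrite mul0r subr_le0 dP// addrAC subrr add0r normrZ gtr0_norm//.
  by move: sd s0; clear; lra.
have h0 : lin g g = 0.
  apply/eqP; rewrite eq_le key /=.
  by rewrite /lin addr_ge0 ?dot_ge0// -expr2 sqr_ge0.
have [h1 h2] : g.1 ^+ 2 = 0 /\ dot g.2 g.2 = 0.
  move: h0; rewrite /lin -expr2 => h0.
  by have := sqr_ge0 g.1; have := dot_ge0 g.2; split; lra.
have g1 : g.1 = 0 by apply/eqP; rewrite -sqrf_eq0 h1.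
have g2 : g.2 = 0.
  apply/eqP; rewrite -normr_eq0 -sqrf_eq0 eq_le sqr_ge0 andbT -h2.
  exact: sqr_norm_le_dot.
by rewrite [g]surjective_pairing g1 g2.
Qed.

Lemma grad_slice (f : R * V -> R) (t : R) (x y : V) g : grad f (t, y) g ->
  grad (fun z => f (z.1, y)) (t, x) (g.1, 0).
Proof.
move=> df.
have l : linb (fun h : R * V => (h.1, 0) : R * V).
  split=> [a b c|]; first by congr (_, _); rewrite /= scaler0 addr0.
  by exists 1 => h; rewrite mul1r !prod_normE /= normr0 ge_max !le_max lexx normr_ge0.
have d : diffw setT (fun z : R * V => (z.1, y) : R * V) (t, x) (fun h => (h.1, 0)).
  apply: (diffw_eqL _ (diffw_ext _ (diffwD (diffw_linb setT ((t, x) : R * V) l)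
    (diffw_cst setT ((0, y) : R * V) (t, x))))) => [h|s]; first by rewrite addr0.
  by congr (_, _); rewrite /= ?addr0 ?add0r.
have h := diffw_comp (E := setT) (fun _ _ => Logic.I) l (lin_linb g) d df.
by apply: (diffw_eqL _ h) => k; rewrite /lin /= dot0l dot0r.
Qed.

(* Doubling of variables, with the penalization [hubs], which has bounded
   gradient and vanishes to second order on the diagonal. *)
Lemma gradient_bound (tau rho L : R) (y0 : V) (H : Z -> R) (u : R * V -> R)
    (g : R * V -> R * V) : 0 < tau -> 0 < rho -> 0 <= L ->
  (forall z, cyl 0 tau y0 rho z -> contw (cyl 0 tau y0 rho) u z) ->
  (forall x y, `|x - y0| <= rho -> `|y - y0| <= rho ->
     u (0, x) - u (0, y) <= L * `|x - y|) ->
  (forall t x, 0 < t < tau -> `|x - y0| < rho ->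
     grad u (t, x) (g (t, x)) /\ (g (t, x)).1 + H (t, x, (g (t, x)).2) = 0) ->
  (forall M, exists C, forall t x x' p p', 0 <= t <= tau -> `|x - y0| <= rho ->
     `|x' - y0| <= rho -> `|p| <= M -> `|p'| <= M ->
     `|H (t, x', p') - H (t, x, p)| <= C * (`|x' - x| + `|p' - p|)) ->
  exists tau1 rho1 B, [/\ 0 < tau1, tau1 < tau, 0 < rho1, rho1 <= rho &
    forall t x, 0 < t <= tau1 -> `|x - y0| < rho1 -> `|(g (t, x)).2| <= B].
Proof.
move=> tau0 rho0 L0 cu u0L ug hlip.
have [eta eta0 etaP] : exists2 eta : R, 0 < eta &
    forall z, cyl 0 tau y0 rho z -> `|u z| <= eta.
  by apply: (compact_bdd (K := cyl 0 tau y0 rho) (f := u)) => //; exact: cyl_compact.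
(* The barrier has to beat the difference of two values of [u], which is at most [2 * eta]. *)
have eta20 : 0 < 2 * eta by rewrite mulr_gt0.
have [G G0 bar] := barrier y0 rho0 eta20.
pose M := L + 1; have M0 : 0 < M by rewrite ltr_wpDl.
have LM : L <= M by rewrite lerDl.
have [C0 C0P] := hlip (2 * M + G).
pose C := `|C0| + 1; have C_gt0 : 0 < C by rewrite ltr_wpDl.
have hC t x x' p p' : 0 <= t <= tau -> `|x - y0| <= rho -> `|x' - y0| <= rho ->
    `|p| <= 2 * M + G -> `|p'| <= 2 * M + G ->
    `|H (t, x', p') - H (t, x, p)| <= C * (`|x' - x| + `|p' - p|).
  move=> tt xr xr' pM pM'; apply: (le_trans (C0P _ _ _ _ _ tt xr xr' pM pM')).
  by rewrite ler_wpM2r ?addr_ge0// (le_trans (ler_norm _))// lerDl.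
(* Since [M Lam = C], the slope of the penalization grows at the rate that pays for the dependence
   of [H] on [x]; for [Lam t <= 1] it at most doubles. [M = L + 1] is positive and dominates the
   Lipschitz constant of the datum. *)
pose Lam := C / M; have Lam0 : 0 < Lam by rewrite divr_gt0.
have MLam : M * Lam = C by rewrite /Lam mulrC divfK// gt_eqF.
have mtau : 0 < Num.min tau (1 / Lam) by rewrite lt_min tau0 divr_gt0.
have [tau1 [tau2 [rho1 [chi [dchi [[tau10 tau12 tau2m rho10 rho1r] gchi _ chiP chi0]]]]]] :=
  bar _ _ C_gt0 mtau.
move: tau2m; rewrite lt_min => /andP[tau2t tau2L].
clearbody M C Lam.
have Lamt t : t <= tau2 -> Lam * t <= 1.
  move=> tt; have := le_lt_trans tt tau2L; rewrite ltr_pdivlMr// mulrC => /ltW.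
  exact.
have sub z : cyl 0 tau2 y0 rho z -> cyl 0 tau y0 rho z.
  by move=> [/andP[t0 tt] xr]; split=> //; rewrite t0 (le_trans tt)// ltW.
have tau20 := lt_trans tau10 tau12.
pose dbl : set Z := [set z | cyl 0 tau2 y0 rho z.1 /\ `|z.2 - y0| <= rho].
have dbl_compact : compact dbl.
  have -> : dbl = cyl 0 tau2 y0 rho `*` [set x | `|x - y0| <= rho] by [].
  by apply: compact_setX; [exact: cyl_compact|exact: box_compact].
have dblC z : dbl z -> cyl 0 tau2 y0 rho (z.1.1, z.2) by move=> [[? ?] ?].
have dblC1 z : dbl z -> cyl 0 tau2 y0 rho z.1 by case.
(* Space is doubled but time is not: [u] is differentiable for positive times and the equation holds
   pointwise. In the last term, [C * n%:R * e] pays for the gap between the norm and [hubs], and the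
   additional [e] makes the inequality strict. *)
pose Phi e (z : Z) := u z.1 - u (z.1.1, z.2) - M * (1 + Lam * z.1.1) * hubs e (z.1.2 - z.2)
  - chi z.1 - chi (z.1.1, z.2) - (C * n%:R * e + e) * z.1.1.
have key e : 0 < e -> forall z, dbl z -> Phi e z <= M * n%:R * e.
  move=> e0.
  have cP z : dbl z -> contw dbl (Phi e) z.
    move=> dz.
    have c11 : contw dbl (fun z : Z => z.1.1) z.
      by apply: contw_linb; exact: (linb_comp (linb_fst _ _) (linb_fst _ _)).
    have c12 : contw dbl (fun z : Z => z.1.2) z.
      by apply: contw_linb; exact: (linb_comp (linb_fst _ _) (linb_snd _ _)).
    have c2 : contw dbl (fun z : Z => z.2) z by apply: contw_linb; exact: linb_snd.
    have c1 : contw dbl (fun z : Z => z.1) z by apply: contw_linb; exact: linb_fst.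
    have cs : contw dbl (fun z : Z => (z.1.1, z.2)) z by exact: contw_pair.
    have cu' z' : cyl 0 tau2 y0 rho z' -> contw (cyl 0 tau2 y0 rho) u z'.
      by move=> z'c; apply: (contw_sub sub); exact/cu/sub.
    have cchi z' : contw (cyl 0 tau2 y0 rho) chi z'.
      exact: (contw_sub (@subsetT _ _) (diffw_contw (lin_linb _) (gchi z'))).
    apply: contwB; last by apply: contwM => //; exact: contw_cst.
    apply: contwB; last first.
      by apply: (contw_comp (E := cyl 0 tau2 y0 rho) dblC cs); exact: cchi.
    apply: contwB; last first.
      by apply: (contw_comp (E := cyl 0 tau2 y0 rho) dblC1 c1); exact: cchi.
    apply: contwB; last first.
      apply: contwM.
        apply: contwM; first exact: contw_cst.
        by apply: contwD; [exact: contw_cst|apply: contwM => //; exact: contw_cst].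
      apply: contw_sum => i.
      apply: (contw_comp (E := setT) (f := fun z : Z => (z.1.2 - z.2) 0 i) (g := hub e)) => //.
        apply: (contw_comp (E := setT) (f := fun z : Z => z.1.2 - z.2)
          (g := fun v : V => v 0 i)) => //; first exact: contwB.
        exact/contw_linb/coord_linb.
      exact: der_contw (hub_der _ e0).
    apply: contwB.
      by apply: (contw_comp (E := cyl 0 tau2 y0 rho) dblC1 c1); exact/cu'/dblC1.
    by apply: (contw_comp (E := cyl 0 tau2 y0 rho) dblC cs); exact/cu'/dblC.
  have y0d : dbl (0, y0, y0).
    by split; [split|]; rewrite /= ?subrr ?normr0 ?(ltW rho0)// lexx ltW.
  have [[[t x] y] zd zP] := compact_max y0d dbl_compact cP.
  suff Pm : Phi e (t, x, y) <= M * n%:R * e by move=> z /zP /le_trans; apply.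
  rewrite leNgt; apply/negP => big.
  have zx := dblC1 _ zd; have zy := dblC _ zd; rewrite /= in zx zy.
  have [/= /andP[t0 tt2] xr] := zx; have [/= _ yr] := zy.
  have ux := etaP _ (sub _ zx); have uy := etaP _ (sub _ zy).
  have [cx0 Gx Cx latx] := chiP _ zx; have [cy0 Gy Cy laty] := chiP _ zy.
  have hub0 := hubs_ge0 (x - y) e0.
  have Mne : 0 <= M * n%:R * e by rewrite !mulr_ge0// ltW.
  have kap : 0 <= (C * n%:R * e + e) * t.
    by rewrite mulr_ge0// addr_ge0// ?mulr_ge0// ltW.
  have Mhub : 0 <= M * (1 + Lam * t) * hubs e (x - y).
    by rewrite !mulr_ge0// ?(ltW M0)// addr_ge0// mulr_ge0// ltW.
  have notlat : [/\ t <> tau2, `|x - y0| <> rho & `|y - y0| <> rho].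
    move: ux uy big; rewrite /Phi /= !ler_norml => /andP[_ ux] /andP[uy _] big.
    split=> E.
    - by have := latx (or_introl E); move: ux uy big Mne kap Mhub cy0; clear; lra.
    - by have := latx (or_intror E); move: ux uy big Mne kap Mhub cy0; clear; lra.
    - by have := laty (or_intror E); move: ux uy big Mne kap Mhub cx0; clear; lra.
  have t_gt0 : 0 < t.
    rewrite lt_neqAle t0 andbT; apply: contraTneq big => t_eq; rewrite -leNgt /Phi /= -t_eq.
    have h1 := u0L _ _ xr yr.
    have h2 := ler_wpM2l L0 (norm_le_hubs (x - y) e0).
    have h3 : L * (n%:R * e) <= M * n%:R * e by rewrite -mulrA ler_wpM2r// mulr_ge0// ltW.
    have h4 := ler_wpM2r hub0 LM.
    rewrite -t_eq in cx0 cy0.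
    by rewrite mulr0 addr0 mulr1 mulr0; move: h1 h2 h3 h4 cx0 cy0; clear; lra.
  have t_lt : t < tau2 by rewrite lt_neqAle tt2 andbT; apply/eqP; case: notlat.
  have x_lt : `|x - y0| < rho by rewrite lt_neqAle xr andbT; apply/eqP; case: notlat.
  have y_lt : `|y - y0| < rho by rewrite lt_neqAle yr andbT; apply/eqP; case: notlat.
  have tT : 0 < t < tau by rewrite t_gt0 (lt_trans t_lt).
  have tt : 0 < t < tau2 by rewrite t_gt0.
  have [gx eqx] := ug t x tT x_lt; have [gy eqy] := ug t y tT y_lt.
  have [d d0 dP] := cyl_interior tt x_lt; have [d' d'0 d'P] := cyl_interior tt y_lt.
  have gM a s z : grad (fun z => M * (1 + Lam * z.1) * hubs e (a + s *: z.2)) z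
     (C * hubs e (a + s *: z.2), (M * (1 + Lam * z.1) * s) *: dhubs e (a + s *: z.2)).
    have h := gradM (gradZ M (gradD (grad_cst 1 z) (gradZ Lam (grad_time z))))
      (grad_hubs s a z e0).
    apply: grad_eqg h; congr (_, _) => /=.
      by rewrite /GRing.scale /= -MLam; ring.
    by rewrite ?scaler0 ?addr0 ?scaler0 ?add0r scalerA.
  have hx : forall z : R * V, z.2 - y = - y + 1 *: z.2 by move=> z; rewrite scale1r addrC.
  have hy : forall z : R * V, x - z.2 = x + (-1) *: z.2 by move=> z; rewrite scaleN1r.
  have F1 : grad (fun z => Phi e (z, y)) (t, x)
      (g (t, x) - ((g (t, y)).1, 0) - (C * hubs e (x - y), (M * (1 + Lam * t)) *: dhubs e (x - y))
       - dchi (t, x) - ((dchi (t, y)).1, 0) - (C * n%:R * e + e) *: (1, 0)).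
    apply: gradB; last exact: gradZ (grad_time _).
    apply: gradB; last exact: grad_slice.
    apply: gradB => //; apply: gradB; first by apply: gradB => //; exact: grad_slice.
    have := gM (- y) 1 (t, x); rewrite -hx /= mulr1.
    by apply: diffw_ext => z; rewrite hx.
  have F2 : grad (fun z => Phi e (z.1, x, z.2)) (t, y)
      (((g (t, x)).1, 0) - g (t, y) - (C * hubs e (x - y), (M * (1 + Lam * t) * -1) *: dhubs e (x - y))
       - ((dchi (t, x)).1, 0) - dchi (t, y) - (C * n%:R * e + e) *: (1, 0)).
    apply: gradB; last exact: gradZ (grad_time _).
    have ext (f : R * V -> R) : (fun z => f (z.1, z.2)) = f by apply/funext => -[].
    apply: gradB; last by rewrite (ext chi).
    apply: gradB; last exact: grad_slice.
    apply: gradB; first by apply: gradB; [exact: grad_slice|rewrite (ext u)].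
    have := gM x (-1) (t, y); rewrite -hy /=.
    by apply: diffw_ext => z; rewrite hy.
  have loc1 : exists2 d : R, 0 < d & forall z', `|z' - (t, x)| < d ->
      Phi e (z', y) <= Phi e (t, x, y).
    exists d => // z' /dP[/andP[a b] c]; apply: zP; split; last exact: yr.
    by split; rewrite ltW// ltW.
  have loc2 : exists2 d : R, 0 < d & forall z', `|z' - (t, y)| < d ->
      Phi e (z'.1, x, z'.2) <= Phi e (t, x, y).
    exists d' => // z' /d'P[/andP[a b] c]; apply: zP; split; last exact: ltW.
    by split; rewrite //= ltW// ltW.
  (* Both space gradients equal [P] up to the barriers. Subtracting the equations at [x] and [y]
     leaves a difference of values of [H], which is dominated by the time derivatives of the
     penalization and of the two barriers; the strict term gives the contradiction. *)
  have Z1 := grad_max0 F1 loc1; have Z2 := grad_max0 F2 loc2.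
  have /= := congr1 fst Z1; rewrite /GRing.scale /= mulr1 => e1.
  have /= := congr1 snd Z1; rewrite scaler0 !subr0 => e2.
  have /= := congr1 snd Z2; rewrite scaler0 !subr0 sub0r => e3.
  set P := (M * (1 + Lam * t)) *: dhubs e (x - y) in e2.
  have gxE : (g (t, x)).2 = P + (dchi (t, x)).2.
    by apply/eqP; rewrite -subr_eq0 opprD addrA e2.
  have gyE : (g (t, y)).2 = P - (dchi (t, y)).2.
    apply/eqP; rewrite -subr_eq0 -oppr_eq0 -{1}e3; apply/eqP/rowP => i.
    by rewrite /P !mxE; ring.
  have Pn : `|P| <= 2 * M.
    have f1 : 0 <= 1 + Lam * t by rewrite addr_ge0// mulr_ge0// ltW.
    rewrite normrZ ger0_norm ?mulr_ge0 ?(ltW M0)//.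
    have := dhubs_le1 (x - y) e0; have := Lamt t tt2 => f2 f3.
    have f4 : M * (1 + Lam * t) <= 2 * M.
      by rewrite mulrC ler_pM2r//; move: f2; clear; lra.
    by rewrite -[2 * M]mulr1 ler_pM// mulr_ge0// ltW.
  have px : `|(g (t, x)).2| <= 2 * M + G.
    by rewrite gxE (le_trans (ler_normD _ _))// lerD.
  have py : `|(g (t, y)).2| <= 2 * M + G.
    by rewrite gyE (le_trans (ler_normB _ _))// lerD.
  have tin : 0 <= t <= tau by case/andP: tT => /ltW -> /ltW ->.
  have hH := hC t x y _ _ tin xr yr px py.
  have dg : `|(g (t, y)).2 - (g (t, x)).2| <= `|(dchi (t, x)).2| + `|(dchi (t, y)).2|.
    have -> : (g (t, y)).2 - (g (t, x)).2 = - ((dchi (t, y)).2 + (dchi (t, x)).2).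
      by rewrite gxE gyE; apply/rowP => i; rewrite !mxE; ring.
    by rewrite normrN addrC ler_normD.
  have nh := norm_le_hubs (x - y) e0; rewrite (distrC x y) in nh.
  have h1 : C * (`|y - x| + `|(g (t, y)).2 - (g (t, x)).2|) <=
      C * (hubs e (x - y) + n%:R * e) + C * `|(dchi (t, x)).2| + C * `|(dchi (t, y)).2|.
    by rewrite -!mulrDr ler_pM2l//; move: nh dg; clear; lra.
  have := ler_norm (H (t, y, (g (t, y)).2) - H (t, x, (g (t, x)).2)).
  move: e1 eqx eqy hH h1 Cx Cy e0; clear; lra.
exists tau1, rho1, (2 * M * n%:R); split => //; first exact: lt_trans tau2t.
move=> t x /andP[t0 tt1] xr.
have tt2 := lt_le_trans (le_lt_trans tt1 tau12) (lexx tau2).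
have tT : 0 < t < tau by rewrite t0 (lt_trans tt2).
have in1 y : `|y - y0| < rho1 -> cyl 0 tau1 y0 rho1 (t, y).
  by move=> yr; split; rewrite /= ?(ltW t0)// ltW.
have in2 y : `|y - y0| < rho1 -> cyl 0 tau2 y0 rho (t, y).
  move=> yr; split; rewrite /= ?(ltW t0) ?(ltW tt2)//.
  by rewrite (le_trans (ltW yr)).
(* On the small cylinder the barriers vanish, and [e -> 0] leaves a Lipschitz bound in space at each
   fixed time, hence a bound on the gradient. *)
have lipt a b : `|a - y0| < rho1 -> `|b - y0| < rho1 ->
    u (t, a) - u (t, b) <= 2 * M * n%:R * `|a - b|.
  move=> ar br; apply: (@le_gt0_eps _ _ _ (M * n%:R + (C * n%:R + 1) * t)) => [|e e0].
    rewrite addr_ge0 ?mulr_ge0 ?addr_ge0 ?mulr_ge0 ?(ltW M0) ?(ltW C_gt0) ?(ltW t0)//.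
  have := key e e0 (t, a, b); rewrite /Phi /= (chi0 _ (in1 a ar)) (chi0 _ (in1 b br)).
  have dd : dbl (t, a, b) by split; [exact: in2|have [] := in2 b br].
  move=> /(_ dd) h1.
  have h2 := hubs_le_norm (a - b) e0; have h3 := hubs_ge0 (a - b) e0.
  have h4 : M * (1 + Lam * t) <= 2 * M.
    by rewrite mulrC ler_pM2r//; move: (Lamt t (ltW tt2)); clear; lra.
  have h5 := ler_wpM2r h3 h4.
  have h6 : 2 * M * hubs e (a - b) <= 2 * M * (n%:R * `|a - b|).
    by rewrite ler_wpM2l// mulr_ge0// ltW.
  by move: h1 h5 h6; clear; lra.
have [gu _] := ug t x tT (lt_le_trans xr rho1r).
have Mn0 : 0 <= 2 * M * n%:R by rewrite !mulr_ge0// ltW.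
have dir v : `|v| <= 1 -> dot (g (t, x)).2 v <= 2 * M * n%:R.
  move=> v1; have r0 : 0 < rho1 - `|x - y0| by rewrite subr_gt0.
  have := @diffw_dir_bound _ u (t, x) (lin (g (t, x))) (0, v) (2 * M * n%:R)
    (rho1 - `|x - y0|) (lin_linb _) gu r0.
  rewrite /lin /= mulr0 add0r; apply => s /andP[s0 sr].
  have -> : (t, x) + s *: (0, v) = (t, x + s *: v) :> R * V.
    by congr (_, _); rewrite /= scaler0 addr0.
  have sv : `|s *: v| <= s by rewrite normrZ gtr0_norm// ler_piMr// ltW.
  apply: (le_trans (lipt _ _ _ xr)).
    rewrite addrAC (le_lt_trans (ler_normD _ _))//.
    by move: sv sr; clear; lra.
  by rewrite addrAC subrr add0r ler_wpM2l.
apply: norm_le_coord => // i; rewrite -dot_delta ler_norml.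
have := dir _ (norm_delta_le i); have := dir (- delta_mx 0 i).
rewrite normrN dotNr => /(_ (norm_delta_le i)); clear; lra.
Qed.

End GradientBound.

(** * The Picard theorem on a prescribed time interval *)

Section ODE.
Context {R : realType} {n : nat}.
Notation V := 'rV[R]_n.
Notation Z := (R * V * V)%type.

(** The interval is prescribed and may be long compared with [1 / L]; the weight [exp (2 L s)] still
    gives the Picard operator the factor [1 / 2]. *)
Lemma ode_exist (F : R -> V -> V) (B L t0 t1 : R) (y : V) : 0 <= t0 -> t0 <= t1 ->
  0 < L -> 0 <= B -> (forall s x, `|F s x| <= B) ->
  (forall s s' x x', `|F s' x' - F s x| <= L * `|(s', x') - (s, x)|) ->
  exists X : R -> V, X t0 = y /\
    forall s, t0 <= s <= t1 -> der `[t0, t1] X s (F s (X s)).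
Proof.
move=> t00 t01 L0 B0 FB FL; have t10 := le_trans t00 t01.
pose I := ('I_n * R)%type.
pose Xof (z : I -> R) s : V := \row_i z (i, s).
pose f z i s := F s (Xof z s) 0 i.
pose cl s := clamp t0 t1 s.
have clP s : t0 <= cl s /\ cl s <= t1 by apply/andP/clamp_in.
pose ex s := expR (2 * L * s).
have dex s : der setT ex s (2 * L * ex s).
  have h1 := derM (der_cst setT (2 * L) s) (der_id setT s).
  have h2 : der setT expR (2 * L * s) (expR (2 * L * s)).
    by apply: is_derive_der; exact: is_derive_expR.
  have := der_comp (D := setT) (fun _ _ => Logic.I) (linb_line _) h1 h2.
  by apply: der_eqd; rewrite mul0r add0r mulr1.
have ex0 s : 0 < ex s by exact: expR_gt0.
have ex1 s : 0 <= s -> 1 <= ex s.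
  by move=> s0; rewrite -expR0 ler_expR mulr_ge0// mulr_ge0// ltW.
have exm s : s <= t1 -> ex s <= ex t1.
  by move=> st; rewrite ler_expR ler_wpM2l// mulr_ge0// ltW.
pose Adm (z : I -> R) := forall i s, contw setT (fun s => z (i, s)) s.
have fc z i : Adm z -> forall s, contw setT (f z i) s.
  move=> az s; apply: (contw_lip_comp (f := fun s => (s, Xof z s))
    (g := fun w : R * V => F w.1 w.2 0 i) (C := L)).
    move=> s' _ /=; apply: le_trans (FL s s' _ _).
    by have := coord_le_norm (F s' (Xof z s') - F s (Xof z s)) i; rewrite !mxE.
  apply: contw_pair; first exact/contw_linb/linb_id.
  apply: contw_row => j; have := az j s.
  by under [X in _ -> contw _ X _]eq_fun do rewrite mxE.
pose Phi (z : I -> R) (w : I) :=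
  y 0 w.1 + (prim 0 (f z w.1) (cl w.2) - prim 0 (f z w.1) t0).
have [|||||||z Az zP] := @fixpoint R I Adm (fun w => ex (cl w.2)) Phi (fun=> 0)
    (`|y| + B * t1).
- by move=> w; exact: ltW.
- by move=> i s; exact: contw_cst.
- move=> z az i s; rewrite /Phi /=; apply: contwD; first exact: contw_cst.
  apply: contwD; last exact: contw_cst.
  apply: (contw_comp (E := `[t0, t1]) (f := cl) (g := prim 0 (f z i))).
  + by move=> s' _; rewrite /= in_itv; apply/andP; exact: clP.
  + by apply: (contw_lip (C := 1)) => s' _; rewrite mul1r clamp_lip.
  + apply: (contw_sub (subsetT _)); apply: der_contw (prim_der (fc z i az) _).
    by have [h _] := clP s; exact: le_trans h.
- move=> z z' d az az' d0 zd [i s] /=; rewrite /Phi /=; have [c1 c2] := clP s.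
  set s1 := cl s in c1 c2 *.
  (* The derivative of [D] is at most [L d ex] in absolute value, and this is exactly the derivative
     of [d / 2 * ex]. *)
  pose D s := prim 0 (f z i) s - prim 0 (f z' i) s.
  have dD s' : t0 <= s' <= s1 -> der `[t0, s1] D s' (f z i s' - f z' i s').
    move=> /andP[h1 h2]; apply: (der_sub (subsetT _)).
    by apply: derB; apply: prim_der; rewrite ?(le_trans t00)//; exact: fc.
  have fd s' : t0 <= s' <= s1 -> `|f z i s' - f z' i s'| <= d / 2 * (2 * L * ex s').
    move=> /andP[h1 h2].
    have -> : d / 2 * (2 * L * ex s') = L * (d * ex s') by field.
    have := FL s' s' (Xof z' s') (Xof z s').
    have := coord_le_norm (F s' (Xof z s') - F s' (Xof z' s')) i.
    rewrite !mxE => h3 h4; apply: (le_trans (le_trans h3 h4)).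
    rewrite ler_pM2l// prod_normE /= subrr normr0 ge_max mulr_ge0 ?(ltW (ex0 _))//=.
    apply: norm_le_coord => [|j]; first by rewrite mulr_ge0// ltW.
    rewrite !mxE; have := zd (j, s'); rewrite /= /cl clamp_id//.
    by rewrite h1 (le_trans h2).
  have dex' s' : der `[t0, s1] (fun s => d / 2 * ex s) s' (d / 2 * (2 * L * ex s')).
    have := derM (der_cst `[t0, s1] (d / 2) s') (der_sub (@subsetT _ `[t0, s1]) (dex s')).
    by apply: der_eqd; rewrite mul0r add0r.
  have h1 : (D s1 - d / 2 * ex s1) - (D t0 - d / 2 * ex t0) <= 0 * (s1 - t0).
    apply: (der_le (f := fun s => D s - d / 2 * ex s)
      (d := fun s' => (f z i s' - f z' i s') - d / 2 * (2 * L * ex s'))) => // s' st.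
      by apply: derB; [exact: dD|exact: dex'].
    by have := fd s' st; rewrite ler_norml subr_le0 => /andP[].
  have h2 : 0 * (s1 - t0) <= (D s1 + d / 2 * ex s1) - (D t0 + d / 2 * ex t0).
    apply: (der_ge (f := fun s => D s + d / 2 * ex s)
      (d := fun s' => (f z i s' - f z' i s') + d / 2 * (2 * L * ex s'))) => // s' st.
      by apply: derD; [exact: dD|exact: dex'].
    by have := fd s' st; rewrite ler_norml => /andP[+ _]; clear; lra.
  have h3 : 0 <= d / 2 * ex t0 by rewrite mulr_ge0 ?divr_ge0// ltW.
  move: h1 h2 h3; rewrite /D mul0r ler_norml; clear; lra.
- by rewrite addr_ge0// mulr_ge0.
- move=> [i s]; rewrite subr0 /Phi /=; have [c1 c2] := clP s.
  have az0 : Adm (fun=> 0) by move=> j s'; exact: contw_cst.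
  have h1 : `|prim 0 (f (fun=> 0) i) (cl s) - prim 0 (f (fun=> 0) i) t0| <= B * (cl s - t0).
    apply: prim_le; [by rewrite t00|exact: fc|].
    by move=> s' _; rewrite (le_trans (coord_le_norm _ _)).
  have h2 : B * (cl s - t0) <= B * t1 by rewrite ler_wpM2l//; move: c2 t00; clear; lra.
  have h3 : `|y| + B * t1 <= (`|y| + B * t1) * ex (cl s).
    rewrite ler_peMr ?addr_ge0 ?mulr_ge0//; apply: ex1; exact: le_trans c1.
  apply: le_trans h3; rewrite (le_trans (ler_normD _ _))// lerD ?coord_le_norm//.
  exact: le_trans h2.
- move=> z zlim i s e e0.
  have [z' az' z'P] := zlim (e / 3 / ex t1) (divr_gt0 (divr_gt0 e0 (ltr0Sn R 2)) (ex0 _)).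
  have z'P' w : `|z' w - z w| <= e / 3.
    apply: (le_trans (z'P w)); rewrite mulrAC ler_pdivrMr// ler_pM2l ?divr_gt0//.
    by apply: exm; have [] := clP w.2.
  have [d d0 dP] := az' i s _ (divr_gt0 e0 (ltr0Sn R 2)).
  exists d => // s' sd _; have := dP s' sd Logic.I.
  have := z'P' (i, s'); have := z'P' (i, s).
  by rewrite !ler_norml; clear; lra.
exists (fun s => \row_i (y 0 i + (prim 0 (f z i) s - prim 0 (f z i) t0))); split.
  by apply/rowP => i; rewrite mxE subrr addr0.
move=> s st; have XE : \row_i (y 0 i + (prim 0 (f z i) s - prim 0 (f z i) t0)) = Xof z s.
  by apply/rowP => i; rewrite !mxE -zP /Phi /= /cl clamp_id.
rewrite XE; apply: der_row => i; have /andP[s0 _] := st.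
have h := derD (der_cst `[t0, t1] (y 0 i) s) (derB (der_sub (@subsetT _ `[t0, t1])
  (prim_der (fc z i Az) (le_trans t00 s0))) (der_cst `[t0, t1] (prim 0 (f z i) t0) s)).
apply: (diffw_ext _ (der_eqd _ h)) => [s'|]; first by rewrite mxE.
by rewrite add0r subr0.
Qed.

End ODE.

(** * Support inequalities along curves, and their limit at time zero *)

Section Backward.
Context {R : realType} {n : nat}.
Notation V := 'rV[R]_n.
Notation Z := (R * V * V)%type.

Lemma nbhs_right_lt_gt0 (c : R) : 0 < c -> \forall t \near (0 : R)^'+, 0 < t < c.
Proof.
by move=> c0; near=> t; apply/andP; split; near: t; [exact: nbhs_right_gt|exact: nbhs_right_lt].
Unshelve. all: by end_near. Qed.

Lemma young (a b lam : R) : 0 < lam -> a * b <= a ^+ 2 / (2 * lam) + lam / 2 * b ^+ 2.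
Proof.
move=> lam0; have : 0 <= (a - lam * b) ^+ 2 / (2 * lam).
  by rewrite divr_ge0 ?sqr_ge0// mulr_ge0// ltW.
have -> : (a - lam * b) ^+ 2 / (2 * lam) = a ^+ 2 / (2 * lam) - a * b + lam / 2 * b ^+ 2.
  by field; exact: lt0r_neq0.
by clear; lra.
Qed.

(** The Lipschitz constant of [g] on the times [[t, tau]] is uncontrolled as [t -> 0], so it may
    enter the existence of [X] but not [K]. For this reason the gradients along the two curves are
    never compared through the regularity of [g]. *)
Lemma curve_support (T rho M tau : R) (y0 : V) (H : Z -> R) (Hx Hp : Z -> V)
    (C lam : R) (u : R * V -> R) (g : R * V -> R * V) :
  Hbounds T rho M y0 H Hx Hp C lam -> 0 < rho -> 0 < tau -> tau <= T -> C * tau <= rho / 4 ->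
  (forall t, 0 < t -> exists2 L : R, 0 < L &
     forall z z', cyl t tau y0 rho z -> cyl t tau y0 rho z' -> `|g z' - g z| <= L * `|z' - z|) ->
  (forall z, 0 < z.1 <= tau -> `|z.2 - y0| <= rho ->
     [/\ grad u z (g z), (g z).1 + H (z.1, z.2, (g z).2) = 0 & `|(g z).2| <= M]) ->
  exists2 K : R, 0 < K & forall t y, 0 < t <= tau / 2 -> `|y - y0| <= rho / 4 ->
    exists l : V, forall x, `|x - y0| <= rho / 4 ->
      u (t, y) + dot l (x - y) - K / 2 * dot (x - y) (x - y) <= u (t, x).
Proof.
move=> HB rho0 tau0 tauT Ctau gL ug.
have C1 := Hb_C HB; have C0 : 0 < C := lt_le_trans ltr01 C1; have lam0 := Hb_lam HB.
(* The first [C] is the Taylor remainder in [x]. The second term is what Young's inequality leaves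
   of the gradient difference paired with a vector of size [(C + 2 / tau) |h|]: the variation of
   [H_p] between the curves, and the speed [1 / (tau - t)] of [sigma], at most [2 / tau] as
   [t <= tau / 2]. *)
pose C6 := C + (n%:R * (C + 2 / tau)) ^+ 2 / (2 * lam).
have C60 : 0 < C6.
  by rewrite ltr_wpDr// divr_ge0 ?sqr_ge0// mulr_ge0// ltW.
exists (2 * (C6 * tau)) => [|t y /andP[t0 tt] yr].
  by rewrite !mulr_gt0.
have t_tau : t < tau by move: tt tau0; clear; lra.
have M0 : 0 <= M.
  have [||_ _ h] := ug (tau, y0); rewrite /= ?tau0 ?lexx ?subrr ?normr0 ?(ltW rho0)//.
  exact: le_trans h.
have [L L0 LP] := gL t t0.
(* Clamped, the vector field is globally bounded by [C] and Lipschitz; [C * tau <= rho / 4] keeps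
   [X] where the clamp is inactive. *)
pose arg s x : R * V := (clamp t tau s, clampv y0 rho x).
have argC s x : cyl t tau y0 rho (arg s x).
  by split; [apply: clamp_in; exact: ltW|apply: clampv_in; exact: ltW].
have gB z : cyl t tau y0 rho z -> Hbox T rho M y0 (z.1, z.2, (g z).2).
  move=> [/andP[z0 zt] zr]; have z_gt0 : 0 < z.1 := lt_le_trans t0 z0.
  have [||_ _ h] := ug z => //; first by rewrite z_gt0.
  by split => //=; rewrite (ltW z_gt0) (le_trans zt).
pose F s x := Hp ((arg s x).1, (arg s x).2, (g (arg s x)).2).
have FB s x : `|F s x| <= C by have [] := Hb_bdd HB (gB _ (argC s x)).
have argL s s' x x' : `|arg s' x' - arg s x| <= `|(s', x') - (s, x)|.
  rewrite !prod_normE /= ge_max !le_max.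
  by rewrite clamp_lip clampv_lip orbT.
have FL s s' x x' : `|F s' x' - F s x| <= C * (1 + L) * `|(s', x') - (s, x)|.
  rewrite -mulrA; have [|_ _] := Hb_lip HB (gB _ (argC s x)) (gB _ (argC s' x'))
    (d := (1 + L) * `|(s', x') - (s, x)|); last by [].
  have h1 := argL s s' x x'; have h2 := LP _ _ (argC s x) (argC s' x').
  have h3 : `|(g (arg s' x')).2 - (g (arg s x)).2| <= `|g (arg s' x') - g (arg s x)|.
    by rewrite [leRHS]prod_normE le_max lexx orbT.
  have h4 := ler_wpM2l (ltW L0) h1.
  have h5 := normr_ge0 ((s', x') - (s, x)); have h6 := mulr_ge0 (ltW L0) h5.
  rewrite prod_normE /= ge_max; apply/andP; split.
    have h7 : `|(clamp t tau s', clampv y0 rho x') - (clamp t tau s, clampv y0 rho x)|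
        <= (1 + L) * `|(s', x') - (s, x)| by apply: (le_trans h1); rewrite mulrDl mul1r lerDl.
    by move: h7; rewrite [leLHS]prod_normE.
  by move: h2 h3 h4 h5; clear; lra.
have [X [Xt dX']] := ode_exist y (ltW t0) (ltW t_tau) (mulr_gt0 C0 (addr_gt0 ltr01 L0)) (ltW C0) FB FL.
have Xy s : t <= s <= tau -> `|X s - y| <= rho / 4.
  move=> /andP[ts st]; rewrite -Xt.
  have : `|X s - X t| <= C * (s - t).
    apply: (der_norm (d := fun s => F s (X s))) => // [|s' /andP[h1 h2]]; first exact: ltW.
    apply: (@der_sub _ _ `[t, tau]); last by apply: dX'; rewrite h1 (le_trans h2).
    by move=> v /=; rewrite !in_itv /= => /andP[-> /le_trans]; apply.
  move/le_trans; apply; apply: le_trans Ctau; rewrite ler_wpM2l// ?(ltW C0)//.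
  by move: st t0; clear; lra.
have Xr s : t <= s <= tau -> `|X s - y0| <= rho / 2.
  move=> /Xy; have := ler_normD (X s - y) (y - y0); rewrite addrA subrK.
  by move: yr; clear; lra.
have Xr' s : t <= s <= tau -> `|X s - y0| <= rho.
  by move=> /Xr; move: rho0; clear; lra.
pose P s := (g (s, X s)).2.
have argE s : t <= s <= tau -> arg s (X s) = (s, X s).
  by move=> st; rewrite /arg clamp_id// clampv_id// Xr'.
have dX s : t <= s <= tau -> der `[t, tau] X s (Hp (s, X s, P s)).
  by move=> st; have := dX' s st; rewrite /F argE.
pose sig s := (tau - s) / (tau - t).
have tau_t : 0 < tau - t by rewrite subr_gt0.
have dsig s E : der E sig s (- (tau - t)^-1).
  have := derM (derB (der_cst E tau s) (der_id E s)) (der_cst E (tau - t)^-1 s).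
  by apply: der_eqd; rewrite mulr0 addr0 sub0r mulN1r.
have sig01 s : t <= s <= tau -> 0 <= sig s <= 1.
  move=> /andP[ts st]; rewrite /sig divr_ge0 ?subr_ge0 ?(ltW t_tau)//=.
  by rewrite ler_pdivrMr// mul1r lerD2l lerN2.
(* Paired with [h], this is minus the first order part of the rate of [u (s, Y s) - u (s, X s)]; its
   integral over [[t, tau]] is the slope [l]. *)
pose m s : V := (tau - t)^-1 *: P s + sig s *: Hx (s, X s, P s).
pose cl s := clamp t tau s.
have clP s : t <= cl s <= tau.
  by apply: clamp_in; exact: ltW.
have cc s : contw setT cl s.
  by apply: (contw_lip (C := 1)) => s' _; rewrite mul1r clamp_lip.
have cX s : contw setT (fun s => X (cl s)) s.
  apply: (contw_comp (E := `[t, tau]) (f := cl)) => //.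
    by move=> s' _; rewrite /= in_itv; exact: clP.
  exact: der_contw (dX _ (clP s)).
have zC s : t <= s <= tau -> cyl t tau y0 rho (s, X s) by split; rewrite ?Xr'.
have cP s : contw setT (fun s => P (cl s)) s.
  apply: (contw_lip_comp (f := fun s => (cl s, X (cl s))) (g := fun z => (g z).2) (C := L)).
    move=> s' _; apply: le_trans (LP _ _ (zC _ (clP s)) (zC _ (clP s'))).
    by rewrite [leRHS]prod_normE le_max lexx orbT.
  exact: contw_pair.
have cHx s : contw setT (fun s => Hx (cl s, X (cl s), P (cl s))) s.
  apply: (contw_lip_comp (f := fun s => (cl s, X (cl s), P (cl s))) (g := Hx) (C := C)).
    by move=> s' _; have [] := Hb_lip HB (gB _ (zC _ (clP s))) (gB _ (zC _ (clP s'))) (lexx _).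
  by apply: contw_pair => //; exact: contw_pair.
have cm i s : contw setT (fun s => m (cl s) 0 i) s.
  apply: (contw_comp (E := setT) (f := fun s => m (cl s)) (g := fun v : V => v 0 i)) => //; last first.
    exact/contw_linb/coord_linb.
  apply: contwD; first by apply: contwZ => //; exact: contw_cst.
  apply: contwZ => //; apply: contwM; last exact: contw_cst.
  by apply: contwB => //; exact: contw_cst.
pose J s : V := \row_i prim 0 (fun s => m (cl s) 0 i) s.
have dJ s : t <= s <= tau -> der `[t, tau] J s (m s).
  move=> st; apply: der_row => i; have /andP[ts _] := st.
  have h := der_sub (@subsetT _ `[t, tau]) (prim_der (cm i) (le_trans (ltW t0) ts)).
  rewrite /cl clamp_id// in h.
  by apply: (diffw_ext _ h) => s'; rewrite mxE.
exists (J tau - J t) => x xr.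
pose h := x - y.
have hr : `|h| <= rho / 2.
  have -> : h = (x - y0) - (y - y0) by rewrite /h opprB addrA subrK.
  by rewrite (le_trans (ler_normB _ _))//; move: xr yr; clear; lra.
pose Y s := X s + sig s *: h.
have Yr s : t <= s <= tau -> `|Y s - y0| <= rho.
  move=> st; have -> : Y s - y0 = (X s - y0) + sig s *: h by rewrite /Y addrAC.
  rewrite (le_trans (ler_normD _ _))//; have /andP[s0 s1] := sig01 s st.
  have : `|sig s *: h| <= `|h| by rewrite normrZ ger0_norm// ler_piMl.
  by have := Xr s st; move: hr; clear; lra.
have dY s : t <= s <= tau -> der `[t, tau] Y s (Hp (s, X s, P s) - (tau - t)^-1 *: h).
  by move=> st; apply: der_eqd (derD (dX s st) (derZ h (dsig s _))); rewrite scaleNr.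
have pos s : t <= s <= tau -> 0 < s <= tau by move=> /andP[/(lt_le_trans t0) -> ->].
(* [f] is nonincreasing. The curves meet at [tau], so the values of [u] cancel there, and
   [f tau <= f t] is the claim. *)
pose f s := u (s, Y s) - u (s, X s) + dot (J s) h - C6 * `|h| ^+ 2 * s.
pose f' s := lin (g (s, Y s)) (1, Hp (s, X s, P s) - (tau - t)^-1 *: h)
  - lin (g (s, X s)) (1, Hp (s, X s, P s)) + dot (m s) h - C6 * `|h| ^+ 2.
have df s : t <= s <= tau -> der `[t, tau] f s (f' s).
  move=> st; apply: derB; last first.
    have := derM (der_cst `[t, tau] (C6 * `|h| ^+ 2) s) (der_id `[t, tau] s).
    by apply: der_eqd; rewrite mul0r add0r mulr1.
  apply: derD; last first.
    by apply: der_eqd (der_dot (dJ s st) (der_cst _ h s)); rewrite dot0r addr0.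
  apply: derB.
    have [gY _ _] := ug (s, Y s) (pos s st) (Yr s st).
    exact: (der_comp (D := setT) _ (lin_linb _) (der_pair (der_id _ s) (dY s st)) gY).
  have [gX _ _] := ug (s, X s) (pos s st) (Xr' s st).
  exact: (der_comp (D := setT) _ (lin_linb _) (der_pair (der_id _ s) (dX s st)) gX).
have f'le s : t <= s <= tau -> f' s <= 0.
  move=> st.
  have [_ eqY qM] := ug (s, Y s) (pos s st) (Yr s st).
  have [_ eqX pM] := ug (s, X s) (pos s st) (Xr' s st).
  rewrite /= in eqY eqX qM pM; set q := (g (s, Y s)).2 in eqY qM *.
  rewrite -/(P s) in eqX pM; have sT : 0 <= s <= T.
    by have /andP[s0 s1] := pos s st; rewrite (ltW s0) (le_trans s1).
  have BX : Hbox T rho M y0 (s, X s, P s) by split; rewrite //= Xr'.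
  have BYP : Hbox T rho M y0 (s, Y s, P s) by split; rewrite //= Yr.
  have BYq : Hbox T rho M y0 (s, Y s, q) by split; rewrite //= Yr.
  have /andP[sg0 sg1] := sig01 s st.
  have YX : Y s - X s = sig s *: h by rewrite /Y addrAC subrr add0r.
  have YXn : `|Y s - X s| <= `|h| by rewrite YX normrZ ger0_norm// ler_piMl.
  (* Convexity is applied at the position [Y s], from the momentum [P s] to [q]; passing from [X s]
     to [Y s] is a Taylor expansion in [x] at fixed momentum. *)
  have cvx := Hb_convex HB BYP BYq.
  have P0 : `|P s - P s| <= `|h| by rewrite subrr normr0.
  have := Hb_taylor HB BX BYP YXn P0; rewrite subrr dot0r subr0 YX dotZr ler_norml.
  move=> /andP[tay _].
  have zz : `|(s, Y s, P s) - (s, X s, P s)| <= `|h|.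
    by rewrite !prod_normE /= !subrr !normr0 !ge_max !normr_ge0 YXn.
  have [_ _ hp] := Hb_lip HB BX BYP zz.
  set k := (tau - t)^-1 *: h.
  have kn : `|k| <= 2 / tau * `|h|.
    rewrite normrZ ger0_norm ?invr_ge0 ?(ltW tau_t)// ler_wpM2r//.
    rewrite -[2 / tau]invf_div lef_pV2 ?posrE ?divr_gt0//.
    by move: tt; clear; lra.
  have vn : `|Hp (s, X s, P s) - Hp (s, Y s, P s) - k| <= (C + 2 / tau) * `|h|.
    by rewrite (le_trans (ler_normB _ _))// mulrDl lerD// distrC.
  have dv := dot_le_norm (Hp (s, X s, P s) - Hp (s, Y s, P s) - k) (q - P s).
  have dv2 : n%:R * (`|Hp (s, X s, P s) - Hp (s, Y s, P s) - k| * `|q - P s|) <=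
     n%:R * (C + 2 / tau) * `|h| * `|q - P s|.
    by rewrite -!mulrA ler_wpM2l// mulrA ler_wpM2r.
  have yg := young (n%:R * (C + 2 / tau) * `|h|) `|q - P s| lam0.
  have sq : lam / 2 * `|q - P s| ^+ 2 <= lam / 2 * dot (q - P s) (q - P s).
    by rewrite ler_wpM2l ?sqr_norm_le_dot// divr_ge0// ltW.
  have C6E : C6 * `|h| ^+ 2 = C * `|h| ^+ 2 + (n%:R * (C + 2 / tau) * `|h|) ^+ 2 / (2 * lam).
    by rewrite /C6 exprMn; field; rewrite !lt0r_neq0.
  have dvv := le_trans (ler_norm _) (le_trans dv dv2).
  rewrite /f' /lin /= -/q -/(P s) -/k C6E /m dotDl !dotZl.
  have kE : (tau - t)^-1 * dot (P s) h = dot (P s) k by rewrite dotZr.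
  rewrite kE.
  set qq := dot (q - P s) (q - P s) in cvx sq.
  set bb := _ ^+ 2 / (2 * lam) in yg *.
  move: dvv cvx tay eqX eqY sq yg; clear.
  rewrite (dotC _ (q - P s)) !dotBl !dotBr.
  rewrite (dotC (Hp (s, Y s, P s)) q) (dotC (Hp (s, Y s, P s)) (P s)).
  lra.
have := der_le (ltW t_tau) df f'le.
have sigt : sig t = 1 by rewrite /sig divff// gt_eqF.
have sigtau : sig tau = 0 by rewrite /sig subrr mul0r.
have Yt : Y t = x by rewrite /Y sigt scale1r Xt /h addrC subrK.
have Ytau : Y tau = X tau by rewrite /Y sigtau scale0r addr0.
rewrite /f Yt Ytau Xt mul0r -/h dotBl => hf.
have hh : C6 * `|h| ^+ 2 * (tau - t) <= C6 * tau * dot h h.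
  have h1 := sqr_norm_le_dot h.
  have h2 : C6 * `|h| ^+ 2 * (tau - t) <= C6 * `|h| ^+ 2 * tau.
    by rewrite ler_wpM2l ?mulr_ge0 ?sqr_ge0 ?(ltW C60)// gerBl ltW.
  apply: (le_trans h2); rewrite mulrAC ler_wpM2l// mulr_ge0// ltW//.
by move: hf hh; clear; lra.
Qed.

(** The slopes at positive times are bounded, since a step of length [rho - |y - y0|] along an axis
    stays where [u] is bounded. Compactness is applied to the negation: if every slope failed at
    time [0], then by continuity all slopes of a compact ball would fail at all small positive
    times. *)
Lemma limit_subgradient (tau rho K : R) (y0 y : V) (u : R * V -> R) : 0 < tau -> 0 <= K ->
  (forall z, cyl 0 tau y0 rho z -> contw (cyl 0 tau y0 rho) u z) -> `|y - y0| < rho ->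
  (forall t, 0 < t <= tau -> exists l : V, forall x, `|x - y0| <= rho ->
      u (t, y) + dot l (x - y) - K / 2 * dot (x - y) (x - y) <= u (t, x)) ->
  exists l : V, forall x, `|x - y0| <= rho ->
      u (0, y) + dot l (x - y) - K / 2 * dot (x - y) (x - y) <= u (0, x).
Proof.
move=> tau0 K0 cu yr supp.
have [eta eta0 etaP] : exists2 eta : R, 0 < eta &
    forall z, cyl 0 tau y0 rho z -> `|u z| <= eta.
  by apply: (compact_bdd (K := cyl 0 tau y0 rho) (f := u)) => //; exact: cyl_compact.
pose d := rho - `|y - y0|; have d0 : 0 < d by rewrite subr_gt0.
pose B := (2 * eta + K / 2 * d ^+ 2) / d.
have B0 : 0 <= B.
  by rewrite divr_ge0 ?(ltW d0)// addr_ge0 ?mulr_ge0 ?sqr_ge0 ?divr_ge0// ltW.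
have inc t x : 0 <= t <= tau -> `|x - y0| <= rho -> cyl 0 tau y0 rho (t, x) by [].
have lB t l : 0 < t <= tau -> (forall x, `|x - y0| <= rho ->
      u (t, y) + dot l (x - y) - K / 2 * dot (x - y) (x - y) <= u (t, x)) -> `|l| <= B.
  move=> /andP[t0 tt] lP.
  have tin : 0 <= t <= tau by rewrite ltW.
  have dir s i : s ^+ 2 = 1 -> s * l 0 i <= B.
    move=> s1; pose v : V := (s * d) *: delta_mx 0 i.
    have ss : `|s| = 1 by apply/eqP; rewrite -sqrp_eq1// real_normK ?num_real// s1.
    have vn : `|v| <= d.
      rewrite normrZ normrM ss mul1r (gtr0_norm d0) ler_piMr ?(ltW d0)//.
      exact: norm_delta_le.
    have vr : `|y + v - y0| <= rho.
      rewrite addrAC (le_trans (ler_normD _ _))//.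
      by move: vn; rewrite /d; clear; lra.
    have := lP _ vr; rewrite [y + v - y]addrAC subrr add0r.
    have -> : dot l v = d * (s * l 0 i) by rewrite dotZr dot_delta; ring.
    have -> : dot v v = d ^+ 2.
      rewrite dotZr dotZl dot_delta mxE !eqxx mulr1.
      by rewrite -[d ^+ 2]mul1r -s1; ring.
    have := etaP _ (inc t _ tin vr); have := etaP _ (inc t _ tin (ltW yr)).
    rewrite !ler_norml /B ler_pdivlMr// => h1 h2 h3.
    by move: h1 h2 h3; clear; lra.
  apply: norm_le_coord => // i; rewrite ler_norml.
  have h1 := dir 1 i (expr1n _ 2); have := dir (-1) i; rewrite sqrrN => /(_ (expr1n _ 2)).
  by move: h1; clear; lra.
have [//|none] := pselect (exists l : V, forall x, `|x - y0| <= rho ->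
      u (0, y) + dot l (x - y) - K / 2 * dot (x - y) (x - y) <= u (0, x)).
pose bad t l := exists2 x, `|x - y0| <= rho &
  u (t, x) < u (t, y) + dot l (x - y) - K / 2 * dot (x - y) (x - y).
have bad0 l : bad 0 l.
  have [//|nb] := pselect (bad 0 l); exfalso; apply: none; exists l => x xr.
  by rewrite leNgt; apply/negP => h; apply: nb; exists x.
have cB : compact [set l : V | `|l - 0| <= B] by exact: box_compact.
have : \forall t \near (0 : R)^'+, [set l : V | `|l - 0| <= B] `<=` bad t.
  move/compact_near_coveringP: cB; apply => l lB0.
  have [x xr hx] := bad0 l.
  set D := dot (x - y) (x - y) in hx.
  pose e := (u (0, y) + dot l (x - y) - K / 2 * D - u (0, x)) / 4.
  have e0 : 0 < e by rewrite divr_gt0// subr_gt0.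
  have t00 : (0 : R) <= 0 <= tau by rewrite lexx ltW.
  have [d1 d10 d1P] := cu _ (inc 0 x t00 xr) e e0.
  have [d2 d20 d2P] := cu _ (inc 0 y t00 (ltW yr)) e e0.
  have cl : contw setT (fun l : V => dot l (x - y)) l by apply: contw_linb; exact: dot_linbl.
  have [d3 d30 d3P] := cl e e0.
  exists ([set l' | `|l' - l| < d3], [set t | 0 < t < Num.min tau (Num.min d1 d2)]).
    split; first by apply: (near_iff l (fun l' => `|l' - l| < d3)).2; exists d3.
    by apply: nbhs_right_lt_gt0; rewrite !lt_min tau0 d10.
  move=> [l' t] /= [l'd /andP[t0]]; rewrite !lt_min => /and3P[ttau td1 td2].
  have tin : 0 <= t <= tau by rewrite !ltW.
  have dist v : `|(t, v) - (0, v) : R * V| = t.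
    by rewrite prod_normE /= subrr normr0 subr0 max_l// gtr0_norm.
  exists x => //; rewrite -/D.
  have := d1P (t, x); rewrite dist => /(_ td1 (inc _ _ tin xr)).
  have := d2P (t, y); rewrite dist => /(_ td2 (inc _ _ tin (ltW yr))).
  have := d3P l' l'd Logic.I.
  have : 4 * e = u (0, y) + dot l (x - y) - K / 2 * D - u (0, x) by rewrite /e; field.
  by move: e0; rewrite !ler_norml; clear; lra.
move=> H; have [t [tP /andP[t0 tt]]] : exists t, [set l : V | `|l - 0| <= B] `<=` bad t /\ 0 < t < tau.
  apply: (@filter_ex _ (0 : R)^'+ _ _ (filterI H _)).
  exact: nbhs_right_lt_gt0.
have tin : 0 < t <= tau by rewrite t0 ltW.
have [l lP] := supp t tin.
have [|x xr] := tP l; first by rewrite /= subr0; exact: (lB t).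
by have := lP x xr => h1 /(le_lt_trans h1); rewrite ltxx.
Qed.

End Backward.

(** * From C^{1,1} regularity to semiconvex data *)

Section Regular.
Context {R : realType} {n : nat}.
Notation V := 'rV[R]_n.
Notation Z := (R * V * V)%type.

Lemma C11_semiconvex (Omega : set V) (T : R) (H : Z -> R) (u0 : V -> R)
    (u : R * V -> R) (y0 : V) (r t0 : R) :
  0 < T -> C2_on ((`[0, T] `*` Omega) `*` setT) H ->
  (forall (t : R) (x p : V), 0 <= t <= T -> Omega x ->
       posdefmx (hessian (fun q => H (t, x, q)) p)) ->
  locally_lipschitz Omega u0 -> viscosity_solution T Omega H u0 u -> Omega y0 ->
  0 < r -> 0 < t0 -> `]0, t0] `*` eball y0 r `<=` `]0, T[ `*` Omega ->
  C11_loc (`]0, t0] `*` eball y0 r) u ->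
  exists K : R, 0 < K /\
     \forall y \near y0, exists p : V, proximal_subgradient K u0 y p.
Proof.
move=> T0 HC2 Hpos lip [uc usub usup u_init] Oy0 r0 t00 inc [g [dg lg]].
(* The sup norm ball of radius [r1] lies in the Euclidean ball; [n.+1] also covers [n = 0]. *)
pose r1 := r / n.+1%:R; have r10 : 0 < r1 by rewrite divr_gt0.
have eb x : `|x - y0| < r1 -> eball y0 r x.
  rewrite /r1 ltr_pdivlMr// => h; apply: le_lt_trans (enorm_le_norm _) _.
  by apply: le_lt_trans h; rewrite mulrC ler_wpM2l// ler_nat.
have inD t x : 0 < t <= t0 -> `|x - y0| < r1 -> (`]0, t0] `*` eball y0 r) (t, x).
  by move=> tt xr; split; [rewrite /= in_itv|exact: eb].
have tT t : 0 < t <= t0 -> 0 < t < T.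
  move=> tt; have [|+ _] := inc (t, y0); last by rewrite /= in_itv.
  by apply: inD; rewrite // subrr normr0.
have xO x : `|x - y0| < r1 -> Omega x.
  by move=> xr; have [|_ +] := inc (t0, x); first by apply: inD; rewrite // t00 lexx.
have inner z : 0 < z.1 < t0 -> `|z.2 - y0| < r1 -> exists2 d : R, 0 < d &
    forall y, `|y - z| < d -> 0 < y.1 < t0 /\ `|y.2 - y0| < r1.
  move=> /andP[z0 zt] zr; exists (Num.min (Num.min z.1 (t0 - z.1)) (r1 - `|z.2 - y0|)).
    by rewrite !lt_min z0 !subr_gt0 zt.
  move=> y; rewrite prod_normE /= !lt_min !gt_max.
  move=> /andP[/andP[/andP[h1 _] /andP[h2 _]] /andP[_ h3]]; split => /=.
    by move: h1 h2; rewrite !ltr_norml; clear; lra.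
  by have := ler_normD (y.2 - z.2) (z.2 - y0); rewrite addrA subrK; move: h3; clear; lra.
have inD' z : 0 < z.1 < t0 -> `|z.2 - y0| < r1 -> (`]0, t0] `*` eball y0 r) z.
  by move: z => [t x] /= /andP[ta tb]; apply: inD; rewrite ta ltW.
have regular z : 0 < z.1 < t0 -> `|z.2 - y0| < r1 -> grad u z (g z) /\ contw setT g z.
  move=> zt zr; have [d d0 dP] := inner z zt zr; have Dz := inD' z zt zr; split.
    have /diffwP := dg z Dz; apply: (diffw_near d0) => // y yd _; split=> //.
    by have [] := dP y yd; exact: inD'.
  have [d' [k [d'0 k0 kP]]] := locally_lipschitz_ball lg Dz.
  move=> e e0; exists (Num.min (Num.min d d') (e / (k + 1))).
    by rewrite !lt_min d0 d'0 divr_gt0// ltr_wpDl.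
  move=> y; rewrite !lt_min => /andP[/andP[yd yd'] ye] _.
  have Dy : (`]0, t0] `*` eball y0 r) y by have [] := dP y yd; exact: inD'.
  apply: (le_trans (kP z y _ yd' Dz Dy)); first by rewrite subrr normr0.
  move: ye; rewrite ltr_pdivlMr ?ltr_wpDl// mulrDr mulr1 mulrC => /ltW; apply: le_trans.
  by rewrite lerDl.
have C1u z : 0 < z.1 < t0 -> `|z.2 - y0| < r1 -> C1_near u g z.
  move=> zt zr; have [d d0 dP] := inner z zt zr; exists d => // y /dP[yt yr].
  exact: regular.
(* [u] is its own test function from above and from below, so the equation holds classically. *)
have pde t x : 0 < t < t0 -> `|x - y0| < r1 -> (g (t, x)).1 + H (t, x, (g (t, x)).2) = 0.
  move=> tt xr; have tt' : 0 < t < T by apply: tT; case/andP: tt => -> /ltW.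
  have C1 := C1u (t, x) tt xr.
  apply/eqP; rewrite eq_le (subsolution_test usub tt' (xO x xr) C1); last first.
    by exists 1 => // z _; rewrite !subrr.
  rewrite (supersolution_test usup tt' (xO x xr) C1)//.
  by exists 1 => // z _; rewrite !subrr.
have [d2 [L [d20 L0 LP]]] := locally_lipschitz_ball lip Oy0.
pose rho := Num.min d2 r1 / 2.
have m0 : 0 < Num.min d2 r1 by rewrite lt_min d20.
have rho0 : 0 < rho by rewrite divr_gt0.
have rhoP x : `|x - y0| <= rho -> `|x - y0| < d2 /\ `|x - y0| < r1.
  move=> h; apply/andP; rewrite -lt_min (le_lt_trans h)//.
  by move: m0; rewrite /rho; clear; lra.
(* Times stay strictly below [t0], where differentials relative to the domain are two-sided. *)
pose tau := t0 / 2; have tau0 : 0 < tau by rewrite divr_gt0.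
have taut0 : tau < t0 by rewrite /tau; move: t00; clear; lra.
have tauT : tau <= T.
  by have /andP[_ /ltW] : 0 < tau < T by apply: tT; rewrite tau0 ltW.
have cylD z : cyl 0 tau y0 rho z -> (`[0, T] `*` Omega) z.
  move: z => [t x] [/= /andP[ta tb] xr]; split.
    by rewrite /= in_itv /= ta (le_trans tb).
  by apply: xO; have [] := rhoP x xr.
have cu z : cyl 0 tau y0 rho z -> contw (cyl 0 tau y0 rho) u z.
  move=> zc; apply: (contw_sub cylD); have /contwP h := uc.
  by apply: h; exact: cylD.
have u0L x y : `|x - y0| <= rho -> `|y - y0| <= rho -> u (0, x) - u (0, y) <= L * `|x - y|.
  move=> /rhoP[xd xr] /rhoP[yd yr]; rewrite !u_init; [|exact: xO..].
  apply: (le_trans (ler_norm _)); apply: LP => //; exact: xO.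
have [Hx [Hp HB]] := Hbounds_exist HC2 Hpos.
have rhoO x : `|x - y0| <= rho -> Omega x by move=> /rhoP[_ /xO].
have hlip M : exists C, forall t x x' p p', 0 <= t <= tau -> `|x - y0| <= rho ->
     `|x' - y0| <= rho -> `|p| <= M -> `|p'| <= M ->
     `|H (t, x', p') - H (t, x, p)| <= C * (`|x' - x| + `|p' - p|).
  have [C [lam HB2]] := HB y0 rho M rhoO.
  exists C => t x x' p p' /andP[ta tb] xr xr' pM pM'.
  have tin : 0 <= t <= T by rewrite ta (le_trans tb).
  have [||//|h _ _] := @Hb_lip _ _ _ _ _ _ _ _ _ _ _ HB2 (t, x, p) (t, x', p') (`|x' - x| + `|p' - p|) => //.
  by rewrite !prod_normE /= !subrr !normr0 !ge_max addr_ge0// lerDl lerDr !normr_ge0.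
have sol t x : 0 < t < tau -> `|x - y0| < rho ->
    grad u (t, x) (g (t, x)) /\ (g (t, x)).1 + H (t, x, (g (t, x)).2) = 0.
  move=> /andP[ta tb] xr; have tt : 0 < t < t0 by rewrite ta (lt_trans tb).
  have [_ xr1] := rhoP x (ltW xr); split; last exact: pde.
  by have [] := regular (t, x) tt xr1.
have [tau1 [rho1 [B [tau10 tau1tau rho10 rho1rho gB]]]] := gradient_bound tau0 rho0 L0 cu u0L sol hlip.
pose rho2 := rho1 / 2; have rho20 : 0 < rho2 by rewrite divr_gt0.
have rho21 : rho2 < rho1 by rewrite /rho2; move: rho10; clear; lra.
have rho2P x : `|x - y0| <= rho2 -> `|x - y0| <= rho.
  by move/le_trans; apply; exact: le_trans (ltW rho21) rho1rho.
(* The box uses the gradient bound [B], valid at all small times, and [tau2] is chosen after it; so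
   [C] and [lam], hence [K], are the same for every [t]. *)
have [C [lam HB2]] := HB y0 rho2 B (fun x xr => rhoO x (rho2P x xr)).
have C0 : 0 < C by apply: lt_le_trans (Hb_C HB2).
pose tau2 := Num.min tau1 (rho2 / 4 / C).
have tau20 : 0 < tau2 by rewrite lt_min tau10 !divr_gt0.
have tau21 : tau2 <= tau1 by rewrite ge_min lexx.
have Ctau2 : C * tau2 <= rho2 / 4 by rewrite mulrC -ler_pdivlMr// ge_min lexx orbT.
have tau2t0 : tau2 < t0 by rewrite (le_lt_trans tau21)// (lt_trans tau1tau).
have [|||K K0 KP] := curve_support (u := u) (g := g) HB2 rho20 tau20 _ Ctau2.
- by rewrite (le_trans tau21)// (le_trans (ltW tau1tau)).
- move=> t t_gt0; apply: (compact_lip (D := `]0, t0] `*` eball y0 r)) => //.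
    exact: cyl_compact.
  move=> z [/andP[za zb] zr]; apply: inD'.
    by rewrite (lt_le_trans t_gt0)// (le_lt_trans zb).
  by have [] := rhoP _ (rho2P _ zr).
- move=> [t x] /= /andP[ta tb] xr; have [_ xr1] := rhoP x (rho2P x xr).
  have tt : 0 < t < t0 by rewrite ta (le_lt_trans tb).
  split; [by have [] := regular (t, x) tt xr1|exact: pde|].
  by apply: gB; [rewrite ta (le_trans tb)|exact: le_lt_trans rho21].
exists K; split=> //.
have rho4 : 0 < rho2 / 4 by rewrite divr_gt0.
apply/near_iff; exists (rho2 / 4) => // y yr.
have tau220 : 0 < tau2 / 2 by rewrite divr_gt0.
have inc2 z : cyl 0 (tau2 / 2) y0 (rho2 / 4) z -> cyl 0 tau y0 rho z.
  move=> [/andP[za zb] zr]; split.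
    by rewrite za (le_trans zb)//; move: tau21 tau1tau tau10 tau20; clear; lra.
  by apply: rho2P; rewrite (le_trans zr)//; move: rho20; clear; lra.
have [||l lP] := limit_subgradient (u := u) tau220 (ltW K0) _ yr.
- by move=> z zc; apply: (contw_sub inc2); apply: cu; exact: inc2.
- by move=> t tt; apply: KP => //; exact: ltW.
have xO2 x : `|x - y0| <= rho2 / 4 -> Omega x.
  by move=> xr; apply: rhoO; apply: rho2P; apply: (le_trans xr); move: rho20; clear; lra.
exists l; apply/near_iff; exists (rho2 / 4 - `|y - y0|); first by rewrite subr_gt0.
move=> x xy; have xr : `|x - y0| <= rho2 / 4.
  by have := ler_normD (x - y) (y - y0); rewrite addrA subrK; move: xy; clear; lra.
by rewrite enorm_sqr -(u_init x (xO2 x xr)) -(u_init y (xO2 y (ltW yr))); exact: lP.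
Qed.

End Regular.

Theorem theorem3 (R : realType) (n : nat) (Omega : set 'rV[R]_n) (T : R)
    (H : R * 'rV[R]_n * 'rV[R]_n -> R) (u0 : 'rV[R]_n -> R)
    (u : R * 'rV[R]_n -> R) (y0 : 'rV[R]_n)
    (Omega_open : open Omega) (T_gt0 : 0 < T)
    (H_C2 : C2_on ((`[0, T] `*` Omega) `*` setT) H)
    (H_convex : forall (t : R) (x p : 'rV[R]_n), 0 <= t <= T -> Omega x ->
       posdefmx (hessian (fun q => H (t, x, q)) p))
    (u0_lipschitz : locally_lipschitz Omega u0)
    (u_solution : viscosity_solution T Omega H u0 u)
    (Omega_y0 : Omega y0) :
  (exists K : R, 0 < K /\
     \forall y \near y0, exists p : 'rV[R]_n, proximal_subgradient K u0 y p)
  <->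
  (exists r t0 : R,
     [/\ 0 < r, 0 < t0,
         `]0, t0] `*` eball y0 r `<=` `]0, T[ `*` Omega &
         C11_loc (`]0, t0] `*` eball y0 r) u]).
Proof.
split=> [[K [K0 prox]]|[r [t0 [r0 t00 inc reg]]]].
  exact: semiconvex_C11 Omega_open T_gt0 H_C2 H_convex u0_lipschitz u_solution Omega_y0 K0 prox.
exact: C11_semiconvex T_gt0 H_C2 H_convex u0_lipschitz u_solution Omega_y0 r0 t00 inc reg.
Qed.
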